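(* Let $\mathfrak{s}_{\dim}$ be the category whose objects are the simplicial $\mathrm{Cu}$-semigroups and whose morphisms are the retractable $\mathrm{Cu}$-morphisms. Then $\mathfrak{s}_{\dim}$ is a (Cuntz) Fraïssé category, and its Fraïssé limit $\mathcal{S}$ is the Cuntz semigroup of the universal AF-algebra.
   Context: **$\mathrm{Cu}$-semigroups.** For $x,y$ in a partially ordered set, $x\ll y$ means: for every increasing sequence $(z_n)_n$ having a supremum with $y\le\sup_n z_n$, there is $n$ with $x\le z_n$. A $\mathrm{Cu}$-semigroup is a positively ordered (commutative) monoid $S$ such that (O1) every increasing sequence has a supremum; (O2) every element is the supremum of a $\ll$-increasing sequence; (O3) $x'\ll x$ and $y'\ll y$ imply $x'+y'\ll x+y$; (O4) $\sup_n(x_n+y_n)=\sup_n x_n+\sup_n y_n$ for increasing sequences. A $\mathrm{Cu}$-morphism is a monoid morphism preserving the order, the relation $\ll$, and suprema of increasing sequences; a generalized $\mathrm{Cu}$-morphism is an ordered monoid morphism preserving suprema of increasing sequences (not necessarily $\ll$). $\mathrm{Cu}$ denotes the category of $\mathrm{Cu}$-semigroups and $\mathrm{Cu}$-morphisms; it has inductive limits. $S$ is countably-based if there is a countable subset $B\subseteq S$ such that every element of $S$ is the supremum of a $\ll$-increasing sequence in $B$. **Cuntz semigroup.** For a C*-algebra $A$, $\mathrm{Cu}(A)=(A\otimes\mathcal{K})_+/\!\sim$, where $a\precsim b$ iff $a=\lim_n r_nbr_n^*$ for some sequence $(r_n)$ in $A\otimes\mathcal{K}$, and $a\sim b$ iff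 $a\precsim b\precsim a$; the order is induced by $\precsim$ and the addition by diagonal addition. **Simplicial and retractable.** A $\mathrm{Cu}$-semigroup is simplicial if it is isomorphic to $\overline{\mathbb{N}}^r$ for some $r\in\mathbb{N}$, where $\overline{\mathbb{N}}=\{0,1,2,\ldots,\infty\}$. A $\mathrm{Cu}$-morphism $\iota\colon S\to T$ is retractable if there is a generalized $\mathrm{Cu}$-morphism $\rho\colon T\to S$ with $\rho\circ\iota=\mathrm{id}_S$. **Universal AF-algebra** (Ghasemi–Kubiś). It is the (C*-algebraic) Fraïssé limit of the category of finite-dimensional C*-algebras and left-invertible $*$-homomorphisms (those $\varphi$ for which there is a $*$-homomorphism $\pi$ with $\pi\circ\varphi=\mathrm{id}$). That is, it is the (unique up to isomorphism) inductive limit of a sequence $(A_n,\varphi_{n,m})$ of finite-dimensional C*-algebras with left-invertible connecting maps such that every finite-dimensional C*-algebra admits a left-invertible $*$-homomorphism into some $A_n$ and, for every $n$, every $\varepsilon>0$ and every left-invertible $\gamma\colon A_n\to D$ with $D$ finite-dimensional, there are $m\ge n$ and a left-invertible $\delta\colon D\to A_m$ with $\|\delta\circ\gamma-\varphi_{n,m}\|<\varepsilon$. **Finite-set comparison.** For $\mathrm{Cu}$-morphisms $\alpha,\beta\colon S\to T$ and a finite set $F\subseteq S$, write $\alpha\simeq_F\beta$ if $\alpha(x')\le\beta(x)$ and $\beta(x')\le\alpha(x)$ for all $x',x\in F$ with $x'\ll x$. **Fraïssé categories.** A subcategory $\mathfrak{c}$ of $\mathrm{Cu}$ is a (Cuntz)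 Fraïssé category if: - (JEP) for any $A_1,A_2\in\mathfrak{c}$ there is $B\in\mathfrak{c}$ with $\mathrm{Hom}_{\mathfrak{c}}(A_1,B)$ and $\mathrm{Hom}_{\mathfrak{c}}(A_2,B)$ nonempty; - (NAP) for any $\mathfrak{c}$-morphisms $\alpha_1\colon A\to B_1$, $\alpha_2\colon A\to B_2$ and any finite $F\subseteq A$, there are $C\in\mathfrak{c}$ and $\mathfrak{c}$-morphisms $\beta_1\colon B_1\to C$, $\beta_2\colon B_2\to C$ with $\beta_1\circ\alpha_1\simeq_F\beta_2\circ\alpha_2$; - (SEP) there is a subcategory $\mathfrak{s}\subseteq\mathfrak{c}$ whose objects are countably-based, whose set of morphisms is countable, such that every $A\in\mathfrak{c}$ admits a $\mathfrak{c}$-morphism to some $S\in\mathfrak{s}$, and such that for any $\mathfrak{c}$-morphism $\sigma\colon S\to A$ with $S\in\mathfrak{s}$ and any finite $F\subseteq S$ there are $T\in\mathfrak{s}$, $\alpha\in\mathrm{Hom}_{\mathfrak{c}}(A,T)$, $\tau\in\mathrm{Hom}_{\mathfrak{s}}(S,T)$ with $\alpha\circ\sigma\simeq_F\tau$. **Fraïssé sequences and limits.** An inductive sequence $(S_i,\sigma_{i,j})_{i\in\mathbb{N}}$ in $\mathfrak{c}$ is a Fraïssé sequence if every $S_i$ is countably-based and, for every $i$, every finite $F\subseteq S_i$ and every $\mathfrak{c}$-morphism $\alpha\colon S_i\to C$, there are $j\ge i$ and a $\mathfrak{c}$-morphism $\beta_F\colon C\to S_j$ with $\beta_F\circ\alpha\simeq_F\sigma_{i,j}$.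 The Fraïssé limit of a Fraïssé category is the $\mathrm{Cu}$-limit of any of its Fraïssé sequences (such a sequence exists, and its limit is unique up to isomorphism). *)

(* Defs.v *)
From HB Require Import structures.
From mathcomp Require Import all_boot all_order all_algebra.
From mathcomp Require Import all_classical all_reals all_analysis.
From mathcomp Require Import complex.

Set Implicit Arguments.
Unset Strict Implicit.
Unset Printing Implicit Defensive.

Import Order.TTheory GRing.Theory Num.Theory.
Import numFieldNormedType.Exports.

Local Open Scope classical_set_scope.
Local Open Scope ring_scope.

(** * Cu-semigroups *)

Definition way_below (S : porderType ring_display) (x y : S) : Prop :=
  forall (z : nat -> S) (s : S),
    nondecreasing_seq z -> supremums (range z) s -> y <= s ->
    exists n, x <= z n.

Notation "x ≪ y" := (way_below x y) (at level 70, y at next level).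

HB.mixin Record isCuSemigroup S of Order.POrder ring_display S := {
  cu_zero : S;
  cu_add : S -> S -> S;
  cu_addA : associative cu_add;
  cu_addC : commutative cu_add;
  cu_add0 : left_id cu_zero cu_add;
  cu_ge0 : forall x : S, cu_zero <= x;
  cu_leD2r : forall x y z : S, x <= y -> cu_add x z <= cu_add y z;
  cu_O1 : forall z : nat -> S,
    nondecreasing_seq z -> exists s : S, supremums (range z) s;
  cu_O2 : forall x : S, exists z : nat -> S,
    (forall n, z n ≪ z n.+1) /\ supremums (range z) x;
  cu_O3 : forall x' x y' y : S,
    x' ≪ x -> y' ≪ y -> cu_add x' y' ≪ cu_add x y;
  cu_O4 : forall (u v : nat -> S) (x y : S),
    nondecreasing_seq u -> nondecreasing_seq v ->
    supremums (range u) x -> supremums (range v) y ->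
    supremums (range (fun n => cu_add (u n) (v n))) (cu_add x y);
}.

#[short(type="cuType")]
HB.structure Definition CuSemigroup :=
  { S of Order.POrder ring_display S & isCuSemigroup S }.

Record gen_cu_morphism (S T : cuType) (f : S -> T) : Prop := GenCuMorphism {
  gen_cu_zero : f cu_zero = cu_zero;
  gen_cu_add : {morph f : x y / cu_add x y};
  gen_cu_homo : {homo f : x y / x <= y};
  gen_cu_sup : forall (z : nat -> S) (s : S),
    nondecreasing_seq z -> supremums (range z) s ->
    supremums (range (f \o z)) (f s);
}.

Record cu_morphism (S T : cuType) (f : S -> T) : Prop := CuMorphism {
  cu_morphism_gen :> gen_cu_morphism f;
  cu_morphism_way_below : {homo f : x y / x ≪ y};
}.

Definition countably_based (S : cuType) : Prop :=
  exists2 B : set S, countable B &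
    forall x : S, exists z : nat -> S,
      [/\ forall n, B (z n), forall n, z n ≪ z n.+1 & supremums (range z) x].

Definition retractable (S T : cuType) (f : S -> T) : Prop :=
  cu_morphism f /\ exists2 r : T -> S, gen_cu_morphism r & r \o f = id.

(** * Simplicial Cu-semigroups *)

(* [None] is the infinite element *)
Definition nbar : Type := option nat.

HB.instance Definition _ := Choice.on nbar.

Definition nbar_add (x y : nbar) : nbar :=
  if x is Some m then if y is Some n then Some (m + n)%N else None else None.

Definition nbar_le (x y : nbar) : bool :=
  if y is Some n then if x is Some m then (m <= n)%N else false else true.

Fact nbar_le_refl : reflexive nbar_le.
Proof. by case=> /=. Qed.

Fact nbar_le_anti : antisymmetric nbar_le.
Proof. by move=> [x|] [y|] //= /anti_leq ->. Qed.

Fact nbar_le_trans : transitive nbar_le.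
Proof. by move=> [x|] [y|] [z|] //=; apply: leq_trans. Qed.

HB.instance Definition _ := Order.Le_isPOrder.Build ring_display nbar
  nbar_le_refl nbar_le_anti nbar_le_trans.

(* The relation ≪ and the suprema of sequences are determined by the order, so
   isomorphisms of Cu-semigroups are isomorphisms of ordered monoids; addition
   and order on [nbar ^ r] are pointwise. *)
Definition simplicial (S : cuType) : Prop :=
  exists (r : nat) (f : S -> {ffun 'I_r -> nbar}),
    [/\ bijective f,
        f cu_zero = [ffun=> Some 0%N],
        forall x y : S, f (cu_add x y) = [ffun i => nbar_add (f x i) (f y i)] &
        forall x y : S, x <= y <-> forall i, f x i <= f y i].

(** * Subcategories of Cu *)

Record cu_subcat := CuSubcat {
  cat_ob : cuType -> Prop;
  cat_hom : forall S T : cuType, (S -> T) -> Prop;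
  cat_hom_ob : forall (S T : cuType) (f : S -> T),
    cat_hom f -> cat_ob S /\ cat_ob T;
  cat_hom_cu : forall (S T : cuType) (f : S -> T), cat_hom f -> cu_morphism f;
  cat_hom_id : forall S : cuType, cat_ob S -> cat_hom (@id S);
  cat_hom_comp : forall (S T U : cuType) (f : S -> T) (g : T -> U),
    cat_hom f -> cat_hom g -> cat_hom (g \o f);
}.

Definition sub_cat (s c : cu_subcat) : Prop :=
  (forall S : cuType, cat_ob s S -> cat_ob c S) /\
  (forall (S T : cuType) (f : S -> T), cat_hom s f -> cat_hom c f).

Definition cu_arrow := {S : cuType & {T : cuType & S -> T}}.

(* An explicit enumeration instead of [countable], to avoid relating the
   universe of [cuType] to the one of [set]. *)
Definition countably_many_homs (s : cu_subcat) : Prop :=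
  exists e : nat -> option cu_arrow,
    forall (S T : cuType) (f : S -> T), cat_hom s f ->
      exists n, e n = Some (existT _ S (existT _ T f)).

Definition approx_on (S T : cuType) (F : set S) (f g : S -> T) : Prop :=
  forall x' x : S, F x' -> F x -> x' ≪ x -> f x' <= g x /\ g x' <= f x.

Definition joint_embedding (c : cu_subcat) : Prop :=
  forall A1 A2 : cuType, cat_ob c A1 -> cat_ob c A2 ->
    exists B : cuType, [/\ cat_ob c B,
      exists f : A1 -> B, cat_hom c f & exists g : A2 -> B, cat_hom c g].

Definition near_amalgamation (c : cu_subcat) : Prop :=
  forall (A B1 B2 : cuType) (a1 : A -> B1) (a2 : A -> B2) (F : set A),
    cat_hom c a1 -> cat_hom c a2 -> finite_set F ->
    exists (C : cuType) (b1 : B1 -> C) (b2 : B2 -> C),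
      [/\ cat_hom c b1, cat_hom c b2 & approx_on F (b1 \o a1) (b2 \o a2)].

Definition separable (c : cu_subcat) : Prop :=
  exists s : cu_subcat,
    [/\ sub_cat s c,
        forall S : cuType, cat_ob s S -> countably_based S,
        countably_many_homs s,
        forall A : cuType, cat_ob c A ->
          exists (S : cuType) (f : A -> S), cat_ob s S /\ cat_hom c f &
        forall (S A : cuType) (f : S -> A) (F : set S),
          cat_ob s S -> cat_hom c f -> finite_set F ->
          exists (T : cuType) (a : A -> T) (t : S -> T),
            [/\ cat_hom c a, cat_hom s t & approx_on F (a \o f) t]].

Definition fraisse_category (c : cu_subcat) : Prop :=
  [/\ joint_embedding c, near_amalgamation c & separable c].

(* Only the values [f i j] with [i <= j] are meaningful. *)
Definition inductive_sequence (c : cu_subcat) (S : nat -> cuType)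
    (f : forall i j, S i -> S j) : Prop :=
  [/\ forall i, cat_ob c (S i),
      forall i j, (i <= j)%N -> cat_hom c (f i j),
      forall i, f i i = id &
      forall i j k, (i <= j)%N -> (j <= k)%N -> f j k \o f i j = f i k].

Definition fraisse_sequence (c : cu_subcat) (S : nat -> cuType)
    (f : forall i j, S i -> S j) : Prop :=
  [/\ inductive_sequence c f,
      forall i, countably_based (S i) &
      forall (i : nat) (F : set (S i)) (C : cuType) (a : S i -> C),
        finite_set F -> cat_hom c a ->
        exists (j : nat) (b : C -> S j),
          [/\ (i <= j)%N, cat_hom c b & approx_on F (b \o a) (f i j)]].

Definition cu_cocone (S : nat -> cuType) (f : forall i j, S i -> S j)
    (L : cuType) (g : forall i, S i -> L) : Prop :=
  (forall i, cu_morphism (g i)) /\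
  (forall i j, (i <= j)%N -> g j \o f i j = g i).

Definition is_cu_limit (S : nat -> cuType) (f : forall i j, S i -> S j)
    (L : cuType) (g : forall i, S i -> L) : Prop :=
  cu_cocone f g /\
  forall (T : cuType) (h : forall i, S i -> T), cu_cocone f h ->
    exists! u : L -> T, cu_morphism u /\ forall i, u \o g i = h i.

Definition is_fraisse_limit (c : cu_subcat) (L : cuType) : Prop :=
  exists (S : nat -> cuType) (f : forall i j, S i -> S j)
         (g : forall i, S i -> L),
    fraisse_sequence c f /\ is_cu_limit f g.

(** * The category of simplicial Cu-semigroups and retractable morphisms *)

Fact gen_cu_morphism_id (S : cuType) : gen_cu_morphism (@id S).
Proof. by split. Qed.

Fact cu_morphism_id (S : cuType) : cu_morphism (@id S).
Proof. by split=> //; apply: gen_cu_morphism_id. Qed.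

Fact gen_cu_morphism_comp (S T U : cuType) (f : S -> T) (g : T -> U) :
  gen_cu_morphism f -> gen_cu_morphism g -> gen_cu_morphism (g \o f).
Proof.
move=> [f0 fD fle fsup] [g0 gD gle gsup]; split.
- by rewrite /= f0 g0.
- by move=> x y /=; rewrite fD gD.
- by move=> x y /fle /gle.
- move=> z s zle zs; apply: gsup; last exact: fsup.
  by move=> m n mn /=; apply/fle/zle.
Qed.

Fact cu_morphism_comp (S T U : cuType) (f : S -> T) (g : T -> U) :
  cu_morphism f -> cu_morphism g -> cu_morphism (g \o f).
Proof.
move=> [fg fw] [gg gw]; split; first exact: gen_cu_morphism_comp.
by move=> x y /fw /gw.
Qed.

Fact retractable_id (S : cuType) : retractable (@id S).
Proof.
split; first exact: cu_morphism_id.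
by exists id => //; apply: gen_cu_morphism_id.
Qed.

Fact retractable_comp (S T U : cuType) (f : S -> T) (g : T -> U) :
  retractable f -> retractable g -> retractable (g \o f).
Proof.
move=> [fm [r rm rf]] [gm [q qm qg]]; split; first exact: cu_morphism_comp.
exists (r \o q); first exact: gen_cu_morphism_comp.
apply/funext => x /=; have /= := congr1 (@^~ (f x)) qg => ->.
exact: (congr1 (@^~ x) rf).
Qed.

Definition sdim_hom (S T : cuType) (f : S -> T) : Prop :=
  [/\ simplicial S, simplicial T & retractable f].

Fact sdim_hom_ob (S T : cuType) (f : S -> T) :
  sdim_hom f -> simplicial S /\ simplicial T.
Proof. by case. Qed.

Fact sdim_hom_cu (S T : cuType) (f : S -> T) : sdim_hom f -> cu_morphism f.
Proof. by case=> _ _ []. Qed.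

Fact sdim_hom_id (S : cuType) : simplicial S -> sdim_hom (@id S).
Proof. by split=> //; apply: retractable_id. Qed.

Fact sdim_hom_comp (S T U : cuType) (f : S -> T) (g : T -> U) :
  sdim_hom f -> sdim_hom g -> sdim_hom (g \o f).
Proof.
by move=> [Ss _ fr] [_ Us gr]; split=> //; apply: retractable_comp.
Qed.

Definition sdim : cu_subcat :=
  CuSubcat sdim_hom_ob sdim_hom_cu sdim_hom_id sdim_hom_comp.

(** * C*-algebras *)

(* C*-algebras are not assumed to be unital, and may be zero. *)
HB.mixin Record isCStarAlgebra (R : realType) A
    of CompleteNormedModule (R[i]) A := {
  cmul : A -> A -> A;
  cstar : A -> A;
  cmulA : associative cmul;
  cmulDl : forall a b c, cmul (a + b) c = cmul a c + cmul b c;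
  cmulDr : forall a b c, cmul a (b + c) = cmul a b + cmul a c;
  cmulZl : forall (k : R[i]) a b, cmul (k *: a) b = k *: cmul a b;
  cmulZr : forall (k : R[i]) a b, cmul a (k *: b) = k *: cmul a b;
  cstarK : involutive cstar;
  cstarD : {morph cstar : a b / a + b};
  cstarZ : forall (k : R[i]) a, cstar (k *: a) = k^* *: cstar a;
  cstarM : forall a b, cstar (cmul a b) = cmul (cstar b) (cstar a);
  cnormM : forall a b, `|cmul a b| <= `|a| * `|b|;
  cnorm_cstar : forall a, `|cmul (cstar a) a| = `|a| ^+ 2;
}.

#[short(type="cstarType")]
HB.structure Definition CStarAlgebra (R : realType) :=
  { A of CompleteNormedModule (R[i]) A & isCStarAlgebra R A }.

Section CStarAlgebras.
Variable R : realType.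
Implicit Types A B D : cstarType R.

Record star_hom A B (f : A -> B) : Prop := StarHom {
  star_hom_linear : linear f;
  star_hom_mul : {morph f : a b / cmul a b};
  star_hom_star : {morph f : a / cstar a};
}.

Definition left_invertible A B (f : A -> B) : Prop :=
  star_hom f /\ exists2 p : B -> A, star_hom p & p \o f = id.

Definition finite_dimensional A : Prop :=
  exists (n : nat) (e : 'I_n -> A),
    forall a, exists k : 'I_n -> R[i], a = \sum_(i < n) k i *: e i.

(* the operator norm of [f - g] is less than [eps] *)
Definition norm_dist_lt A B (f g : A -> B) (eps : R[i]) : Prop :=
  exists2 k : R[i], k < eps & forall a, `|f a - g a| <= k * `|a|.

Definition star_cocone (A : nat -> cstarType R) (f : forall i j, A i -> A j)
    B (g : forall i, A i -> B) : Prop :=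
  (forall i, star_hom (g i)) /\
  (forall i j, (i <= j)%N -> g j \o f i j = g i).

Definition is_star_limit (A : nat -> cstarType R) (f : forall i j, A i -> A j)
    B (g : forall i, A i -> B) : Prop :=
  star_cocone f g /\
  forall D (h : forall i, A i -> D), star_cocone f h ->
    exists! u : B -> D, star_hom u /\ forall i, u \o g i = h i.

Definition universal_AF B : Prop :=
  exists (A : nat -> cstarType R) (f : forall i j, A i -> A j)
         (g : forall i, A i -> B),
    [/\ [/\ forall i, finite_dimensional (A i),
            forall i j, (i <= j)%N -> left_invertible (f i j),
            forall i, f i i = id &
            forall i j k, (i <= j)%N -> (j <= k)%N -> f j k \o f i j = f i k],
        is_star_limit f g,
        forall D, finite_dimensional D ->
          exists (i : nat) (d : D -> A i), left_invertible d &
        forall (i : nat) (eps : R[i]) D (c : A i -> D),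
          0 < eps -> finite_dimensional D -> left_invertible c ->
          exists (j : nat) (d : D -> A j),
            [/\ (i <= j)%N, left_invertible d &
                norm_dist_lt (d \o c) (f i j) eps]].

(** * The Cuntz semigroup *)

(* [is_stabilization e] says that [B] is the tensor product of [A] with the
   compact operators on l^2, where [e i j a] is [a (x) e_ij] for the matrix
   units [e_ij]: [B] is a C*-completion of the *-algebra of finitely supported
   infinite matrices over [A]. That *-algebra is an increasing union of the
   matrix algebras over [A], so that it has only one C*-norm. Injectivity of
   [e 0 0] implies injectivity on all matrices. *)
Record is_stabilization A B (e : nat -> nat -> A -> B) : Prop :=
  IsStabilization {
  stab_linear : forall i j, linear (e i j);
  stab_mul : forall i j k l a b,
    cmul (e i j a) (e k l b) = if j == k then e i l (cmul a b) else 0;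
  stab_star : forall i j a, cstar (e i j a) = e j i (cstar a);
  stab_inj : injective (e 0%N 0%N);
  stab_dense : closure [set x | exists (n : nat) (a : 'I_n -> 'I_n -> A),
      x = \sum_(i < n) \sum_(j < n) e i j (a i j)] = setT;
}.

Definition positive B : set B := [set a | exists b, a = cmul (cstar b) b].

Definition cuntz_sub B (a b : B) : Prop :=
  exists r : nat -> B, cmul (cmul (r n) b) (cstar (r n)) @[n --> \oo] --> a.

Definition cuntz_eq B (a b : B) : Prop := cuntz_sub a b /\ cuntz_sub b a.

Section CuntzSemigroup.
Variables (A B : cstarType R) (e : nat -> nat -> A -> B).

(* Diagonal addition uses the isomorphism between M_2(B) and B induced by the
   bijection (k, n) |-> 2 n + k from {0, 1} x nat to nat; [diag_embed k] is the
   restriction of this isomorphism to the k-th diagonal corner of M_2(B). It is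
   the only *-homomorphism with the given values on the matrix units. *)
Definition diag_embed (k : nat) : B -> B :=
  xget (id : {classic B -> B}) [set s | star_hom s /\
    forall i j a, s (e i j a) = e (i.*2 + k)%N (j.*2 + k)%N a].

Definition diag_sum (a b : B) : B := diag_embed 0 a + diag_embed 1 b.

Definition cuntz_class (a : B) : set B := [set b | positive b /\ cuntz_eq a b].

(* the underlying set of Cu(A), whose elements are equivalence classes *)
Definition cuntz_semigroup : set (set B) := cuntz_class @` @positive B.

Definition cuntz_le (x y : set B) : Prop :=
  exists a b, [/\ x a, y b & cuntz_sub a b].

Definition cuntz_add (x y : set B) : set B :=
  [set c | positive c /\ exists a b, [/\ x a, y b & cuntz_eq c (diag_sum a b)]].

Definition is_cuntz_semigroup (S : cuType) : Prop :=
  exists f : set B -> S,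
    [/\ set_bij cuntz_semigroup setT f,
        f (cuntz_class 0) = cu_zero,
        forall x y, cuntz_semigroup x -> cuntz_semigroup y ->
          f (cuntz_add x y) = cu_add (f x) (f y) &
        forall x y, cuntz_semigroup x -> cuntz_semigroup y ->
          (cuntz_le x y <-> f x <= f y)].

End CuntzSemigroup.
End CStarAlgebras.

(* Main.v *)
(* Retractable morphisms between simplicial semigroups are exactly the matrices M
   over the natural numbers having, for every column i, a row equal to the i-th unit row;
   such an M has a left inverse W over the natural numbers. Two of them, M1 and M2, with the
   same source are amalgamated exactly by [1; M2 W1] and [M1 W2; 1], whence the Fraïssé
   category.

   Both sides of the second assertion are limits of such matrices having the
   extension property of a Fraïssé sequence. For the Fraïssé limit S the limit is read
   on compact elements, which are dense in S. For the Cuntz semigroup, let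
   lev n be the finite matrices over the image of A_n. Murray-von Neumann classes of
   projections of lev n are vectors of ranks, and left-invertible homomorphisms act on
   ranks by retractable matrices. Given such a matrix M out of the ranks of
   A_n, a finite-dimensional algebra D containing A_n and realizing M is found inside the
   stabilization, and the extension property of (A_n) yields the one of the rank
   matrices. A back-and-forth argument then writes S as a limit of the rank
   matrices. Finally every positive element of the stabilization is, up to Cuntz
   equivalence, an increasing sequence of projections of the lev n, and sending it to
   the supremum of the corresponding compact elements of S is the isomorphism. *)

Require Import Defs.
From mathcomp Require Import all_boot all_order all_algebra.
From mathcomp Require Import all_classical all_reals all_analysis.
From mathcomp Require Import complex ring lra zify.
From HB Require Import structures.

Set Implicit Arguments.
Unset Strict Implicit.
Unset Printing Implicit Defensive.

Import Order.TTheory GRing.Theory Num.Theory.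
Import numFieldNormedType.Exports.

Local Open Scope classical_set_scope.
Local Open Scope ring_scope.
Local Open Scope complex_scope.

(** * Retractable matrices *)

(** Approximation disappears on both sides because the data are discrete. On compact basis vectors
    [approx_on] is equality, and projections at distance less than 1 have the same rank, so the
    single tolerance 1 is enough in the extension property of the algebras. The back and forth is
    therefore an exact intertwining of matrices. Both limits are known only through their universal
    properties. Order embedding (for S) and injectivity (for the algebra) of the limit maps come
    from a cocone into a fixed stage, built by composing retractions. Density comes from a cocone
    into the candidate for the whole limit, which must first be made an object of the category. The
    algebras need not be unital, and summands of a finite-dimensional algebra are never constructed:
    polynomials in one selfadjoint element replace functional calculus, and orthogonal minimal
    projections replace matrix units. The algebra realizing a matrix needs a C*-norm, which it
    inherits as a closed subalgebra of the stabilization. *)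

Definition retr (s r : nat) (M : 'M[nat]_(s, r)) : Prop :=
  forall i, exists k, forall j, M k j = (i == j : nat).

Definition vle (r : nat) (v w : 'cV[nat]_r) : Prop := forall y, (v y ord0 <= w y ord0)%N.

Lemma vle_anti r (v w : 'cV[nat]_r) : vle v w -> vle w v -> v = w.
Proof.
by move=> vw wv; apply/colP => y; apply/eqP; rewrite eqn_leq vw wv.
Qed.

Lemma vle_mul s r (M : 'M[nat]_(s, r)) v w : vle v w -> vle (M *m v) (M *m w).
Proof.
by move=> vw k; rewrite !mxE; apply: leq_sum => i _; rewrite leq_mul2l vw orbT.
Qed.

Lemma retr_row s r (M : 'M[nat]_(s, r)) i k (v : 'cV[nat]_r) :
  (forall j, M k j = (i == j : nat)) -> (M *m v) k ord0 = v i ord0.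
Proof.
move=> Mk; rewrite mxE (bigD1 i)//= Mk eqxx [_ * _]mul1n big1 ?addr0// => j ji.
by rewrite Mk eq_sym (negbTE ji) [LHS]mul0n.
Qed.

Lemma retr_vle s r (M : 'M[nat]_(s, r)) v w : retr M -> vle (M *m v) (M *m w) -> vle v w.
Proof. by move=> rM h i; have [k Mk] := rM i; have := h k; rewrite !(retr_row _ Mk). Qed.

Lemma retr1 r : retr (1%:M : 'M[nat]_r).
Proof. by move=> i; exists i => j; rewrite mxE; case: (i == j). Qed.

Lemma retr_mul t s r (N : 'M[nat]_(t, s)) (M : 'M[nat]_(s, r)) :
  retr N -> retr M -> retr (N *m M).
Proof.
move=> rN rM i; have [k Mk] := rM i; have [l Nl] := rN k; exists l => j.
rewrite -Mk mxE (bigD1 k)//= Nl eqxx [_ * _]mul1n big1 ?addr0// => k' kk.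
by rewrite Nl eq_sym (negbTE kk) [LHS]mul0n.
Qed.

(** Choosing for each column its unit row is a 0-1 selection matrix, and that selection is the left
    inverse. *)
Lemma retr_linv s r (M : 'M[nat]_(s, r)) : retr M ->
  exists W : 'M[nat]_(r, s), W *m M = 1%:M.
Proof.
move=> /choice[kap hkap]; exists (\matrix_(i, k) (kap i == k : nat)).
apply/matrixP => i j; rewrite !mxE (bigD1 (kap i))//= mxE eqxx [_ * _]mul1n hkap.
rewrite big1 ?addr0; first by case: (i == j).
by move=> k ki; rewrite mxE eq_sym (negbTE ki) [LHS]mul0n.
Qed.

Lemma retr_col_mxl p s r (M : 'M[nat]_(p, r)) (N : 'M[nat]_(s, r)) :
  retr M -> retr (col_mx M N).
Proof. by move=> rM i; have [k hk] := rM i; exists (lshift s k) => j; rewrite col_mxEu. Qed.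

Lemma retr_col_mxr p s r (M : 'M[nat]_(p, r)) (N : 'M[nat]_(s, r)) :
  retr N -> retr (col_mx M N).
Proof. by move=> rM i; have [k hk] := rM i; exists (rshift p k) => j; rewrite col_mxEd. Qed.

(** * The semigroups of extended natural vectors *)

Local Notation Fin m := (Some m : nbar).

Definition nvec (r : nat) : Type := {ffun 'I_r -> nbar}.

Section NVec.
Variable r : nat.
Implicit Types x y : nvec r.

HB.instance Definition _ := Choice.on (nvec r).

Definition nvec_le x y : bool := [forall i, x i <= y i].

Fact nvec_leP x y : reflect (forall i, x i <= y i) (nvec_le x y).
Proof. exact: forallP. Qed.

Fact nvec_le_refl : reflexive nvec_le.
Proof. by move=> x; apply/nvec_leP. Qed.

Fact nvec_le_anti : antisymmetric nvec_le.
Proof.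
move=> x y /andP[/nvec_leP xy /nvec_leP yx]; apply/ffunP => i.
by apply/eqP; rewrite eq_le xy yx.
Qed.

Fact nvec_le_trans : transitive nvec_le.
Proof. by move=> y x z /nvec_leP xy /nvec_leP yz; apply/nvec_leP => i; apply: le_trans (xy i) _. Qed.

HB.instance Definition _ := Order.Le_isPOrder.Build ring_display (nvec r)
  nvec_le_refl nvec_le_anti nvec_le_trans.

Lemma nvleP x y : reflect (forall i, x i <= y i) (x <= y).
Proof. exact: nvec_leP. Qed.

Lemma some_le (m n : nat) : (Fin m <= Fin n) = (m <= n)%N.
Proof. by []. Qed.

(** Finite elements detect the order: if [a] is infinite, a finite [b = n] is refuted by the test
    value [n.+1]. *)
Lemma nbar_le_fin (a b : nbar) : (forall m, Fin m <= a -> Fin m <= b) -> a <= b.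
Proof.
case: a => [m|] h; first exact: h.
case: b h => // n h; have := h n.+1 isT.
by rewrite some_le ltnn.
Qed.

Lemma nbar_le0 (a : nbar) : Fin 0%N <= a.
Proof. by case: a. Qed.

Lemma nbar_leD (a b c d : nbar) : a <= b -> c <= d -> nbar_add a c <= nbar_add b d.
Proof.
case: a b c d => [a|] [b|] [c|] [d|] //=; rewrite !some_le; exact: leq_add.
Qed.

(** A coordinatewise form of the supremum in which finite and infinite values are treated alike:
    every finite number below [s i] is reached by some term. *)
Definition nsup (z : nat -> nvec r) (s : nvec r) : Prop :=
  forall i, (forall n, z n i <= s i) /\
    (forall m, Fin m <= s i -> exists n, Fin m <= z n i).

Lemma nsup_supremum z s : nsup z s -> supremums (range z) s.
Proof.
move=> h; split=> [_ [n _ <-]|t tz].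
  by apply/nvleP => i; have [] := h i.
apply/nvleP => i; apply: nbar_le_fin => m /(h i).2[n /le_trans]; apply.
by apply/nvleP; apply: tz; exists n.
Qed.

Lemma nsup_exists z : nondecreasing_seq z -> exists s, nsup z s.
Proof.
move=> zn.
have ex i : exists s : nbar, (forall n, z n i <= s) /\
    (forall m, Fin m <= s -> exists n, Fin m <= z n i).
  (* A bounded coordinate attains its maximum; an unbounded one has supremum [None]. *)
  have [[b hb]|h] := pselect (exists b : nat, forall n, z n i <= Some b); last first.
    exists None; split=> [n|m _]; first by case: (z n i).
    apply: contrapT => h'; apply: h; exists m => n.
    case E : (z n i) => [k|]; last by case: h'; exists n; rewrite E.
    rewrite some_le leqNgt; apply/negP => mk; case: h'; exists n.
    by rewrite E some_le ltnW.
  pose Q k := `[< exists n, z n i = Some k >].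
  have fin n : exists k, z n i = Some k by case: (z n i) (hb n) => [k|] //; exists k.
  have Q0 : exists k, Q k by have [k zk] := fin 0%N; exists k; apply/asboolP; exists 0%N.
  have Qb k : Q k -> (k <= b)%N by move=> /asboolP[n zk]; have := hb n; rewrite zk.
  case: (ex_maxnP Q0 Qb) => k /asboolP[n zk] kmax; exists (Some k); split=> [n'|m mk].
    by have [k' zk'] := fin n'; rewrite zk'; apply: kmax; apply/asboolP; exists n'.
  by exists n; rewrite zk.
have /choice[s hs] := ex; exists [ffun i => s i] => i; rewrite ffunE; exact: hs.
Qed.

Lemma supremums_uniq (T : porderType ring_display) (A : set T) s t :
  supremums A s -> supremums A t -> s = t.
Proof.
by move=> [us ls] [ut lt]; apply/eqP; rewrite eq_le ls// lt.
Qed.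

Lemma supremum_nsup z s : nondecreasing_seq z -> supremums (range z) s -> nsup z s.
Proof.
move=> zn zs; have [t zt] := nsup_exists zn.
by rewrite (supremums_uniq zs (nsup_supremum zt)).
Qed.

(** Finite vectors increasing to [x]. This one sequence serves for (O2), for the countable base and
    for the determination of morphisms by their values on unit vectors. *)
Definition trunc x (n : nat) : nvec r :=
  [ffun i => if x i is Some m then Some (minn n m) else Some n].

Lemma trunc_homo x : nondecreasing_seq (trunc x).
Proof.
move=> m n mn; apply/nvleP => i; rewrite !ffunE; case: (x i) => [k|] //.
rewrite some_le leq_min geq_minr andbT; exact: leq_trans (geq_minl _ _) mn.
Qed.

Lemma trunc_nsup x : nsup (trunc x) x.
Proof.
move=> i; split=> [n|m]; rewrite ?ffunE.
  by case: (x i) => [k|] //; rewrite some_le geq_minr.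
move=> mx; exists m; rewrite ffunE; case: (x i) mx => [k|] //.
by rewrite !some_le leq_min leqnn.
Qed.

(** One direction tests [x ≪ y] on the truncations of [y]. In the other, each finite coordinate is
    reached at some index, and there are finitely many coordinates. *)
Lemma nvec_way_below x y : x ≪ y <-> forall i, x i <> None /\ x i <= y i.
Proof.
split=> [xy|h z s zn zs ys].
  have [n xn] := xy _ _ (@trunc_homo y) (nsup_supremum (@trunc_nsup y)) (lexx y).
  move=> i; have /nvleP/(_ i) := xn; rewrite ffunE.
  case: (x i) => [a|]; case: (y i) => [b|] //.
  by rewrite !some_le leq_min => /andP[].
have /choice[n hn] i : exists n, x i <= z n i.
  have [xf xy] := h i; case E : (x i) xf => [m|] // _.
  apply: (supremum_nsup zn zs i).2; rewrite -E (le_trans xy)//.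
  by move/nvleP: ys.
exists (\max_i n i)%N; apply/nvleP => i; rewrite (le_trans (hn i))//.
by move/nvleP: (zn _ _ (leq_bigmax i) : z (n i) <= z (\max_i n i)%N).
Qed.

Definition nvec_zero : nvec r := [ffun=> Some 0%N].
Definition nvec_add x y : nvec r := [ffun i => nbar_add (x i) (y i)].

Lemma nbar_addA : associative nbar_add.
Proof. by move=> [a|] [b|] [c|] //=; rewrite addnA. Qed.
Lemma nbar_addC : commutative nbar_add.
Proof. by move=> [a|] [b|] //=; rewrite addnC. Qed.
Lemma nbar_add0 : left_id (Some 0%N) nbar_add.
Proof. by case. Qed.

Fact nvec_addA : associative nvec_add.
Proof. by move=> x y z; apply/ffunP => i; rewrite !ffunE nbar_addA. Qed.
Fact nvec_addC : commutative nvec_add.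
Proof. by move=> x y; apply/ffunP => i; rewrite !ffunE nbar_addC. Qed.
Fact nvec_add0 : left_id nvec_zero nvec_add.
Proof. by move=> x; apply/ffunP => i; rewrite !ffunE nbar_add0. Qed.
Fact nvec_ge0 x : nvec_zero <= x.
Proof. by apply/nvleP => i; rewrite ffunE nbar_le0. Qed.
Fact nvec_leD2r x y z : x <= y -> nvec_add x z <= nvec_add y z.
Proof. by move=> /nvleP xy; apply/nvleP => i; rewrite !ffunE nbar_leD. Qed.
Fact nvec_O1 (z : nat -> nvec r) : nondecreasing_seq z -> exists s, supremums (range z) s.
Proof. by move=> /nsup_exists[s zs]; exists s; apply: nsup_supremum. Qed.
Fact nvec_O2 x : exists z : nat -> nvec r, (forall n, z n ≪ z n.+1) /\ supremums (range z) x.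
Proof.
exists (trunc x); split=> [n|]; last exact: nsup_supremum (@trunc_nsup x).
apply/nvec_way_below => i; split; first by rewrite ffunE; case: (x i).
by move/nvleP: (trunc_homo x (leqnSn n)).
Qed.
Fact nvec_O3 (x' x y' y : nvec r) : x' ≪ x -> y' ≪ y -> nvec_add x' y' ≪ nvec_add x y.
Proof.
move=> /nvec_way_below hx /nvec_way_below hy; apply/nvec_way_below => i.
have [x0 xx] := hx i; have [y0 yy] := hy i; rewrite !ffunE; split; last exact: nbar_leD.
by case: (x' i) (y' i) x0 y0 => [a|] [b|].
Qed.
Fact nvec_O4 (u v : nat -> nvec r) x y :
  nondecreasing_seq u -> nondecreasing_seq v ->
  supremums (range u) x -> supremums (range v) y ->
  supremums (range (fun n => nvec_add (u n) (v n))) (nvec_add x y).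
Proof.
move=> un vn /(supremum_nsup un) ux /(supremum_nsup vn) vy; apply: nsup_supremum => i.
split=> [n|m]; rewrite !ffunE.
  by rewrite nbar_leD// ?(ux i).1 ?(vy i).1.
move=> mxy.
(* A finite bound on a sum splits into finite bounds on the summands; next to an infinite summand
   the other one may take 0. *)
have [a [b [mab ax by_]]] : exists a b, [/\ (m <= a + b)%N, Fin a <= x i & Fin b <= y i].
  case: (x i) (y i) mxy => [a|] [b|] /= h.
  - by exists a, b.
  - by exists 0%N, m.
  - by exists m, 0%N; rewrite addn0.
  - by exists m, 0%N; rewrite addn0.
have [n1 h1] := (ux i).2 _ ax; have [n2 h2] := (vy i).2 _ by_.
exists (maxn n1 n2); rewrite ffunE.
apply: (@le_trans _ _ (nbar_add (Some a) (Some b))); first exact: mab.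
apply: nbar_leD; [apply: le_trans h1 _|apply: le_trans h2 _].
  by move/nvleP: (un _ _ (leq_maxl n1 n2)).
by move/nvleP: (vn _ _ (leq_maxr n1 n2)).
Qed.

HB.instance Definition _ := isCuSemigroup.Build (nvec r) nvec_addA nvec_addC nvec_add0
  nvec_ge0 nvec_leD2r nvec_O1 nvec_O2 nvec_O3 nvec_O4.

End NVec.

(** * Sums and morphisms in general Cu-semigroups *)

Section CuAlgebra.
Variable T : cuType.

HB.instance Definition _ := Monoid.isComLaw.Build T cu_zero cu_add
  (@cu_addA T) (@cu_addC T) (@cu_add0 T).

Lemma cu_leD (x y z w : T) : x <= y -> z <= w -> cu_add x z <= cu_add y w.
Proof.
move=> xy zw; rewrite (le_trans (cu_leD2r _ _ z xy))// cu_addC [cu_add y w]cu_addC.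
exact: cu_leD2r.
Qed.

Lemma cu_addACA : interchange (@cu_add T) cu_add.
Proof. by move=> x y z w; rewrite Monoid.mulmACA. Qed.

Lemma cu_zero_way_below : (cu_zero : T) ≪ cu_zero.
Proof. by move=> z s _ _ _; exists 0%N; apply: cu_ge0. Qed.

Lemma way_belowW (x y z w : T) : x <= y -> y ≪ z -> z <= w -> x ≪ w.
Proof.
move=> xy yz zw u s un us ws; have [n yn] := yz _ _ un us (le_trans zw ws).
by exists n; apply: le_trans yn.
Qed.

Lemma way_below_le (x y : T) : x ≪ y -> x <= y.
Proof.
move=> /(_ (fun=> y) y) h; have [|||n //] := h _ _ _.
- by move=> m n _.
- by split=> [_ [n _ <-]//|t]; apply; exists 0%N.
- exact: lexx.
Qed.

Definition nmul (n : nat) (x : T) : T := iter n (cu_add x) cu_zero.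

Lemma nmul0 n : nmul n cu_zero = cu_zero.
Proof. by elim: n => //= n ->; rewrite cu_add0. Qed.

(** The value at [v] of the additive map sending the unit vectors to the [a i]. *)
Definition csum r (v : 'cV[nat]_r) (a : 'I_r -> T) : T :=
  \big[cu_add/cu_zero]_(i < r) nmul (v i ord0) (a i).

End CuAlgebra.

Section CuMorphism.
Variables S T : cuType.

Lemma gen_nmul (f : S -> T) n x : gen_cu_morphism f -> f (nmul n x) = nmul n (f x).
Proof. by move=> hf; elim: n => [|n IH] /=; rewrite ?(gen_cu_zero hf)// (gen_cu_add hf) IH. Qed.

Lemma gen_csum (f : S -> T) r (v : 'cV[nat]_r) a : gen_cu_morphism f ->
  f (csum v a) = csum v (f \o a).
Proof.
move=> hf; rewrite /csum (big_morph f (gen_cu_add hf) (gen_cu_zero hf)).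
by apply: eq_bigr => i _; apply: gen_nmul.
Qed.

Lemma nondecreasing_comp (f : S -> T) z : gen_cu_morphism f -> nondecreasing_seq z ->
  nondecreasing_seq (f \o z).
Proof. by move=> hf zn m n mn; apply: (gen_cu_homo hf); apply: zn. Qed.

Lemma cu_morphism_add (f g : S -> T) : cu_morphism f -> cu_morphism g ->
  cu_morphism (fun x => cu_add (f x) (g x)).
Proof.
move=> [hf fw] [hg gw]; split; first split.
- by rewrite (gen_cu_zero hf) (gen_cu_zero hg) cu_add0.
- by move=> x y; rewrite (gen_cu_add hf) (gen_cu_add hg) cu_addACA.
- by move=> x y xy; apply: cu_leD; [apply: (gen_cu_homo hf)|apply: (gen_cu_homo hg)].
- move=> z s zn zs; apply: cu_O4; try exact: nondecreasing_comp.
    exact: (gen_cu_sup hf).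
  exact: (gen_cu_sup hg).
- by move=> x y xy; apply: cu_O3; [apply: fw|apply: gw].
Qed.

Lemma cu_morphism_zero : cu_morphism (fun _ : S => cu_zero : T).
Proof.
split; first split=> //; [by move=> x y; rewrite cu_add0| |].
  by move=> z s _ _; split=> [_ [n _ <-]//|t]; apply; exists 0%N.
by move=> x y _; apply: cu_zero_way_below.
Qed.

Lemma cu_morphism_nmul (f : S -> T) n : cu_morphism f -> cu_morphism (fun x => nmul n (f x)).
Proof.
by move=> hf; elim: n => [|n IH]; [exact: cu_morphism_zero|exact: (cu_morphism_add hf IH)].
Qed.

Lemma cu_morphism_big I (s : seq I) (F : I -> S -> T) : (forall i, cu_morphism (F i)) ->
  cu_morphism (fun x => \big[cu_add/cu_zero]_(i <- s) F i x).
Proof.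
move=> hF; elim: s => [|i s IH].
  by under eq_fun do rewrite big_nil; exact: cu_morphism_zero.
by under eq_fun do rewrite big_cons; exact: (cu_morphism_add (hF i) IH).
Qed.

Lemma order_iso_sup (f : S -> T) (g : T -> S) (z : nat -> S) s : cancel f g -> cancel g f ->
  (forall x y, x <= y <-> f x <= f y) ->
  supremums (range z) s -> supremums (range (f \o z)) (f s).
Proof.
move=> fg gf fle [us ls]; split=> [_ [n _ <-] /=|t tz].
  by apply/fle; apply: us; exists n.
rewrite -(gf t); apply/fle; apply: ls => _ [n _ <-].
by apply/fle; rewrite gf; apply: tz; exists n.
Qed.

End CuMorphism.

Lemma order_iso_cu_morphism (S T : cuType) (f : S -> T) (g : T -> S) :
  cancel f g -> cancel g f -> f cu_zero = cu_zero -> {morph f : x y / cu_add x y} ->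
  (forall x y, x <= y <-> f x <= f y) -> cu_morphism f.
Proof.
move=> fg gf f0 fD fle; split; first split=> //.
- by move=> x y /fle.
- by move=> z s _; apply: order_iso_sup fg gf fle.
have gle x y : x <= y <-> g x <= g y.
  by split=> h; [apply/fle; rewrite !gf|rewrite -(gf x) -(gf y); apply/fle].
move=> x y xy z s zn zs ys.
have [|||n xn] := xy (fun n => g (z n)) (g s).
- by move=> m n mn; apply/gle; apply: zn.
- exact: order_iso_sup gf fg gle zs.
- by apply/fle; rewrite gf.
- by exists n; rewrite -(gf (z n)); apply/fle.
Qed.

(** * Morphisms of extended vectors as matrices *)

Section NVecMaps.

HB.instance Definition _ := Monoid.isComLaw.Build nbar (Some 0%N) nbar_add
  nbar_addA nbar_addC nbar_add0.

Lemma big_nvecE r I (s : seq I) (F : I -> nvec r) j :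
  (\big[cu_add/cu_zero]_(i <- s) F i) j = \big[nbar_add/Some 0%N]_(i <- s) F i j.
Proof.
apply: (big_morph (fun x : nvec r => x j)) => [x y|]; by rewrite ffunE.
Qed.

Lemma big_some I (s : seq I) (F : I -> nat) :
  \big[nbar_add/Some 0%N]_(i <- s) Some (F i) = Some (\sum_(i <- s) F i)%N.
Proof. by apply/esym; apply: (big_morph Some). Qed.

Definition bas r (i : 'I_r) : nvec r := [ffun j => Some (i == j : nat)].

Definition vec r (v : 'cV[nat]_r) : nvec r := [ffun i => Some (v i ord0)].

Lemma nmul_nvec r n (x : nvec r) j : nmul n x j = iter n (nbar_add (x j)) (Some 0%N).
Proof. by elim: n => [|n IH] /=; rewrite ffunE ?IH. Qed.

Lemma nmul_bas r n (i j : 'I_r) : nmul n (bas i) j = Some (n * (i == j))%N.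
Proof. by rewrite nmul_nvec; elim: n => //= n ->; rewrite ffunE /= mulSn. Qed.

Lemma vecE r (v : 'cV[nat]_r) : vec v = csum v (@bas r).
Proof.
apply/ffunP => j; rewrite big_nvecE ffunE.
under eq_bigr do rewrite nmul_bas.
rewrite big_some (bigD1 j)//= eqxx muln1 big1 ?addn0// => i /negbTE ->.
by rewrite muln0.
Qed.

Lemma vec_le r (v w : 'cV[nat]_r) : vec v <= vec w <-> vle v w.
Proof.
by split=> [/nvleP h y|h]; [have := h y; rewrite !ffunE|apply/nvleP => y; rewrite !ffunE; apply: h].
Qed.

Lemma vec_inj r : injective (@vec r).
Proof. by move=> v w vw; apply: vle_anti; apply/vec_le; rewrite vw. Qed.

Lemma vec_compact r (v : 'cV[nat]_r) : vec v ≪ vec v.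
Proof. by apply/nvec_way_below => i; rewrite ffunE. Qed.

Lemma bas_compact r (i : 'I_r) : bas i ≪ bas i.
Proof. by apply/nvec_way_below => j; rewrite ffunE. Qed.

Lemma trunc_vec r (x : nvec r) n : exists v, trunc x n = vec v.
Proof.
exists (\col_i (if x i is Some m then minn n m else n)).
by apply/ffunP => i; rewrite !ffunE mxE; case: (x i).
Qed.

(** Finite vectors are sums of unit vectors, and every vector is the supremum of its truncations. *)
Lemma gen_ext r (T : cuType) (f g : nvec r -> T) : gen_cu_morphism f -> gen_cu_morphism g ->
  (forall i, f (bas i) = g (bas i)) -> f = g.
Proof.
move=> hf hg fg; apply/funext => x.
have tx := nsup_supremum (@trunc_nsup _ x).
have := gen_cu_sup hg (@trunc_homo _ x) tx.
have := gen_cu_sup hf (@trunc_homo _ x) tx.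
have -> : f \o trunc x = g \o trunc x.
  apply/funext => n /=; have [v ->] := trunc_vec x n.
  by rewrite vecE (gen_csum _ _ hf) (gen_csum _ _ hg); apply: eq_bigr => i _ /=; rewrite fg.
exact: supremums_uniq.
Qed.

Definition single r s (i : 'I_r) (k : 'I_s) (x : nvec r) : nvec s :=
  [ffun l => if k == l then x i else Some 0%N].

Lemma single_cu r s (i : 'I_r) (k : 'I_s) : cu_morphism (single i k).
Proof.
split; first split.
- by apply/ffunP => l; rewrite !ffunE; case: ifP.
- by move=> x y; apply/ffunP => l; rewrite !ffunE; case: ifP.
- by move=> x y /nvleP xy; apply/nvleP => l; rewrite !ffunE; case: ifP.
- move=> z t zn /(supremum_nsup zn) zt; apply: nsup_supremum => l; rewrite ffunE.
  case: ifP => kl.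
    have [h1 h2] := zt i; split=> [n|m /h2[n hn]]; first by rewrite ffunE kl.
    by exists n; rewrite ffunE kl.
  by split=> [n|m m0]; [rewrite ffunE kl|exists 0%N; rewrite ffunE kl].
- move=> x y /nvec_way_below xy; apply/nvec_way_below => l; rewrite !ffunE.
  by case: ifP => // _; apply: xy.
Qed.

(** Written as a sum of multiples of elementary matrices, so that being a Cu-morphism follows from
    closure under addition. *)
Definition mxact r s (M : 'M[nat]_(s, r)) (x : nvec r) : nvec s :=
  \big[cu_add/cu_zero]_(k < s) \big[cu_add/cu_zero]_(i < r) nmul (M k i) (single i k x).

Lemma mxact_cu r s (M : 'M[nat]_(s, r)) : cu_morphism (mxact M).
Proof.
apply: cu_morphism_big => k; apply: cu_morphism_big => i.
exact: cu_morphism_nmul (single_cu i k).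
Qed.

Lemma mxact_bas r s (M : 'M[nat]_(s, r)) j : mxact M (bas j) = vec (col j M).
Proof.
rewrite vecE; apply: eq_bigr => k _; rewrite mxE (bigD1 j)//=.
rewrite big1 => [|i ij].
  rewrite Monoid.mulm1; congr nmul; apply/ffunP => l; rewrite !ffunE eqxx.
  by case: (k == l).
have -> : single i k (bas j) = cu_zero.
  by apply/ffunP => l; rewrite !ffunE [j == i]eq_sym (negbTE ij); case: ifP.
exact: nmul0.
Qed.

Lemma mxact_vec r s (M : 'M[nat]_(s, r)) v : mxact M (vec v) = vec (M *m v).
Proof.
rewrite vecE (gen_csum _ _ (mxact_cu M)) /csum.
under eq_bigr do rewrite /= mxact_bas.
apply/ffunP => k; rewrite big_nvecE [RHS]ffunE mxE.
under eq_bigr => i _.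
  rewrite nmul_nvec ffunE mxE.
  have -> n m : iter n (nbar_add (Some m)) (Some 0%N) = Some (m * n)%N.
    by elim: n => [|n IH] /=; rewrite ?muln0// IH /= mulnS.
  over.
by rewrite big_some.
Qed.

Lemma bas_vec r (i : 'I_r) : bas i = vec (col i 1%:M).
Proof. by apply/ffunP => j; rewrite !ffunE !mxE eq_sym; case: (j == i). Qed.

Lemma mxact_comp r s t (N : 'M[nat]_(t, s)) (M : 'M[nat]_(s, r)) :
  mxact N \o mxact M = mxact (N *m M).
Proof.
apply: gen_ext; [exact: gen_cu_morphism_comp (mxact_cu M) (mxact_cu N)|exact: mxact_cu|].
by move=> i /=; rewrite bas_vec !mxact_vec mulmxA.
Qed.

Lemma mxact_mul r s t (N : 'M[nat]_(t, s)) (M : 'M[nat]_(s, r)) x :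
  mxact N (mxact M x) = mxact (N *m M) x.
Proof. by rewrite -mxact_comp. Qed.

Lemma mxact1 r : mxact (1%:M : 'M[nat]_r) = id.
Proof.
apply: gen_ext; [exact: mxact_cu|exact: gen_cu_morphism_id|].
by move=> i; rewrite mxact_bas -bas_vec.
Qed.

Lemma mxact_inj r s : injective (@mxact r s).
Proof.
move=> M N MN; apply/matrixP => k i; have := congr1 (fun f => f (bas i)) MN.
by rewrite !mxact_bas => /vec_inj/colP/(_ k); rewrite !mxE.
Qed.

Lemma cu_morphism_mxact r s (f : nvec r -> nvec s) : cu_morphism f -> exists M, f = mxact M.
Proof.
(* The default 0 of [odflt] is never taken: unit vectors are compact, so their images are compact,
   hence finite in every coordinate. *)
move=> [hf fw]; exists (\matrix_(k, i) odflt 0%N (f (bas i) k)).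
apply: gen_ext => //; first exact: mxact_cu.
move=> i; rewrite mxact_bas; apply/ffunP => k; rewrite ffunE !mxE.
have /nvec_way_below/(_ k)[] := fw _ _ (@bas_compact _ i).
by case: (f (bas i) k).
Qed.

Lemma nbar_big_ge (I : finType) (F : I -> nbar) k :
  F k <= \big[nbar_add/Some 0%N]_i F i.
Proof.
rewrite (bigD1 k)//=; case: (F k) => [a|] //=.
by case: (\big[_/_]_(i | _) _) => [b|] //=; rewrite some_le leq_addr.
Qed.

Lemma iter_nbar_ge n (a : nbar) : Fin 1%N <= a -> Fin n <= iter n (nbar_add a) (Some 0%N).
Proof.
case: a => [a|] a1; elim: n => //= n; case: (iter _ _ _) => //= b.
by move: a1; rewrite !some_le; lia.
Qed.

(** The vectors [L k = q (bas k)], possibly with infinite entries, form a left inverse of [M]. In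
    the diagonal equation for [i] some term with index [k] is nonzero, so [L k i] is at least 1. The
    equations for the pairs (j, i) then bound [M k j] by 1 for j = i and by 0 otherwise: row [k] is
    the unit row [i]. *)
Lemma retract_retr r s (M : 'M[nat]_(s, r)) (q : nvec s -> nvec r) :
  gen_cu_morphism q -> q \o mxact M = id -> retr M.
Proof.
move=> hq qM i.
pose L k := q (bas k).
have E j l : \big[nbar_add/Some 0%N]_k iter (M k j) (nbar_add (L k l)) (Some 0%N) =
    Some (j == l : nat).
  have /(congr1 (fun f : nvec r -> nvec r => f (bas j) l)) /= := qM.
  rewrite mxact_bas vecE (gen_csum _ _ hq) big_nvecE [in RHS]ffunE => <-.
  by apply: eq_bigr => k _; rewrite nmul_nvec mxE.
have [k k0] : exists k, iter (M k i) (nbar_add (L k i)) (Some 0%N) <> Some 0%N.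
  apply: contrapT => h; have := E i i; rewrite eqxx big1// => k _.
  by apply: contrapT => k0; apply: h; exists k.
have L1 : Fin 1%N <= L k i.
  case E1 : (L k i) k0 => [[|a]|] //= [].
  by elim: (M k i) => //= n ->.
have M0 : M k i != 0%N by apply: contra_notN k0 => /eqP ->.
have bound j : (M k j <= (j == i))%N.
  rewrite -some_le (le_trans (iter_nbar_ge _ L1))//.
  by rewrite -(E j i) (nbar_big_ge (fun k => iter (M k j) (nbar_add (L k i)) (Some 0%N))).
exists k => j; have := bound j; rewrite [j == i]eq_sym; case: eqVneq => [<-|_] /=.
  by rewrite leq_eqVlt ltnS leqn0 (negbTE M0) orbF => /eqP.
by rewrite leqn0 => /eqP.
Qed.

Lemma mxact_retractable r s (M : 'M[nat]_(s, r)) : retr M -> retractable (mxact M).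
Proof.
move=> /retr_linv[W WM]; split; first exact: mxact_cu.
by exists (mxact W); [exact: mxact_cu|rewrite mxact_comp WM mxact1].
Qed.

End NVecMaps.

(** * The category of simplicial semigroups *)

Section Simplicial.

Record cu_iso (S T : cuType) (p : S -> T) (q : T -> S) : Prop := CuIso {
  iso_pq : cancel p q;
  iso_qp : cancel q p;
  iso_p : cu_morphism p;
  iso_q : cu_morphism q;
}.

Lemma simplicial_iso (S : cuType) : simplicial S ->
  exists r (p : S -> nvec r) (q : nvec r -> S), cu_iso p q.
Proof.
move=> [r [f [[g fg gf] f0 fD fle]]]; exists r, f, g.
have fle' (x y : S) : x <= y <-> (f x : nvec r) <= (f y : nvec r).
  by rewrite fle; split=> h; [apply/nvleP|move=> i; move/nvleP: h].
have gle (x y : nvec r) : x <= y <-> g x <= g y.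
  by split=> h; [apply/fle'; rewrite !gf|rewrite -(gf x) -(gf y); apply/fle'].
split=> //.
- exact: (order_iso_cu_morphism (f := f : S -> nvec r) fg gf).
- apply: (order_iso_cu_morphism (f := g : nvec r -> S) gf fg) => //.
    by rewrite -(fg cu_zero) f0.
  by move=> x y; apply: (can_inj fg); rewrite fD !gf.
Qed.

Lemma nvec_simplicial r : simplicial (nvec r).
Proof.
exists r, id; split=> //; first by exists id.
by move=> x y; split=> [/nvleP|h]//; apply/nvleP.
Qed.

Lemma iso_retractable (S T : cuType) (p : S -> T) q : cu_iso p q -> retractable p.
Proof.
move=> h; split; first exact: (iso_p h).
by exists q; [exact: (iso_q h)|apply/funext => x; apply: (iso_pq h)].
Qed.

Lemma cu_iso_sym (S T : cuType) (p : S -> T) q : cu_iso p q -> cu_iso q p.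
Proof. by case. Qed.

Lemma retractable_matrix (S T : cuType) r s (p : S -> nvec r) p' (q : T -> nvec s) q' (f : S -> T) :
  cu_iso p p' -> cu_iso q q' -> retractable f ->
  exists2 M : 'M[nat]_(s, r), retr M & q \o f = mxact M \o p.
Proof.
move=> ip iq rf.
have h : retractable (q \o f \o p').
  apply: retractable_comp; first exact: iso_retractable (cu_iso_sym ip).
  by apply: retractable_comp rf _; apply: iso_retractable iq.
have [hc [t ht tf]] := h; have [M ME] := cu_morphism_mxact hc.
exists M; first by apply: (retract_retr ht); rewrite -ME.
by rewrite -ME; apply/funext => x /=; rewrite (iso_pq ip).
Qed.

Lemma sdim_mxact (S : cuType) r s (p : S -> nvec r) p' (M : 'M[nat]_(s, r)) :
  cu_iso p p' -> simplicial S -> retr M -> sdim_hom (mxact M \o p).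
Proof.
move=> ip sS rM; split=> //; first exact: nvec_simplicial.
by apply: retractable_comp (iso_retractable ip) (mxact_retractable rM).
Qed.

Lemma approx_on_eq (S T : cuType) (F : set S) (f g : S -> T) :
  gen_cu_morphism f -> f = g -> approx_on F f g.
Proof.
by move=> hf <- x' x _ _ /way_below_le xx; split; apply: (gen_cu_homo hf).
Qed.

Lemma sdim_joint_embedding : joint_embedding sdim.
Proof.
move=> S T sS sT; have [r [p [p' ip]]] := simplicial_iso sS.
have [s [q [q' iq]]] := simplicial_iso sT.
exists (nvec (r + s)); split; first exact: nvec_simplicial.
- exists (mxact (col_mx 1%:M 0) \o p); apply: (sdim_mxact ip sS).
  exact/retr_col_mxl/retr1.
- exists (mxact (col_mx 0 1%:M) \o q); apply: (sdim_mxact iq sT).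
  exact/retr_col_mxr/retr1.
Qed.

Lemma sdim_near_amalgamation : near_amalgamation sdim.
Proof.
move=> S T1 T2 a1 a2 F [sS s1 r1] [_ s2 r2] _.
have [r [p [p' ip]]] := simplicial_iso sS.
have [n1 [q1 [q1' i1]]] := simplicial_iso s1.
have [n2 [q2 [q2' i2]]] := simplicial_iso s2.
have [M1 rM1 h1] := retractable_matrix ip i1 r1.
have [M2 rM2 h2] := retractable_matrix ip i2 r2.
have [W1 WM1] := retr_linv rM1; have [W2 WM2] := retr_linv rM2.
pose b1 : T1 -> nvec (n1 + n2) := mxact (col_mx 1%:M (M2 *m W1)) \o q1.
pose b2 : T2 -> nvec (n1 + n2) := mxact (col_mx (M1 *m W2) 1%:M) \o q2.
have hb1 : sdim_hom b1 by apply: (sdim_mxact i1 s1); exact/retr_col_mxl/retr1.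
have hb2 : sdim_hom b2 by apply: (sdim_mxact i2 s2); exact/retr_col_mxr/retr1.
exists (nvec (n1 + n2)), b1, b2; split=> //.
apply: approx_on_eq.
  apply: gen_cu_morphism_comp; first by case: r1 => -[].
  exact: (sdim_hom_cu hb1).
apply/funext => x; have /(congr1 (@^~ x)) /= h1x := h1; have /(congr1 (@^~ x)) /= h2x := h2.
rewrite /b1 /b2 /= h1x h2x !mxact_mul; congr (mxact _ _).
by rewrite !mul_col_mx !mul1mx -!mulmxA WM1 WM2 !mulmx1.
Qed.

(** Objects are equal, not merely isomorphic, to standard ones: this is what leaves only countably
    many morphisms. *)
Definition sdim_std_hom (S T : cuType) (f : S -> T) : Prop :=
  [/\ exists r, S = nvec r, exists s, T = nvec s & retractable f].

Definition sdim_std : cu_subcat.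
Proof.
apply: (@CuSubcat (fun S => exists r, S = nvec r) sdim_std_hom).
- by move=> S T f [].
- by move=> S T f [_ _ []].
- by move=> S hS; split=> //; apply: retractable_id.
- by move=> S T U f g [hS _ rf] [_ hU rg]; split=> //; apply: retractable_comp.
Defined.

Lemma nvec_countably_based r : countably_based (nvec r).
Proof.
exists (range (@vec r)).
  by apply: countableP.
move=> x; exists (trunc x); split=> [n|n|].
- by have [v ->] := trunc_vec x n; exists v.
- apply: (way_belowW (y := trunc x n) (z := trunc x n)) => //.
    by have [v ->] := trunc_vec x n; apply: vec_compact.
  exact: (trunc_homo x (leqnSn n)).
- exact: nsup_supremum (@trunc_nsup _ x).
Qed.

Lemma sdim_separable : separable sdim.
Proof.
exists sdim_std; split.
- split=> [S [r ->]|S T f [[r ?] [s ?] rf]]; first exact: nvec_simplicial.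
  by subst S T; split=> //; apply: nvec_simplicial.
- by move=> S [r ->]; apply: nvec_countably_based.
(* A morphism of standard objects is a matrix, so the enumeration runs through codes of triples of
   two dimensions and a matrix. *)
- pose e (n : nat) : option cu_arrow :=
    if unpickle n is Some (existT r (existT s M)) then
      Some (existT _ (nvec r : cuType) (existT _ (nvec s : cuType) (@mxact r s M)))
    else None.
  exists e => S T f [[r ?] [s ?] [hf _]]; subst S T.
  have [M ->] := cu_morphism_mxact hf.
  pose u : {r : nat & {s : nat & 'M[nat]_(s, r)}} := existT _ r (existT _ s M).
  by exists (pickle u); rewrite /e pickleK.
- move=> S sS; have [r [p [p' ip]]] := simplicial_iso sS.
  exists (nvec r), p; split; first by exists r.
  by split=> //; [apply: nvec_simplicial|apply: iso_retractable ip].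
(* Composing with a coordinate isomorphism of the target already lands in the standard category, so
   the approximation is an equality. *)
- move=> S A f F [r ?] [sS sA rf] _; subst S.
  have [s [q [q' iq]]] := simplicial_iso sA.
  exists (nvec s), q, (q \o f); split.
  + by split=> //; [apply: nvec_simplicial|apply: iso_retractable iq].
  + by split; [exists r|exists s|apply: retractable_comp rf (iso_retractable iq)].
  + apply: approx_on_eq => //; apply: gen_cu_morphism_comp; first by case: rf => -[].
    exact: (iso_q (cu_iso_sym iq)).
Qed.

Lemma sdim_fraisse : fraisse_category sdim.
Proof.
split; [exact: sdim_joint_embedding|exact: sdim_near_amalgamation|exact: sdim_separable].
Qed.

End Simplicial.

(** * Compact elements of the Fraïssé limit *)

Section AlgebraicPart.
Variables (L : cuType) (K : set L).
Hypotheses (K0 : K cu_zero) (KD : forall x y, K x -> K y -> K (cu_add x y)).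
Hypothesis Kc : forall x, K x -> x ≪ x.

Definition algebraic (x : L) : Prop := exists z : nat -> L,
  [/\ nondecreasing_seq z, forall n, K (z n) & supremums (range z) x].

Lemma algebraic_K x : K x -> algebraic x.
Proof.
move=> Kx; exists (fun=> x); split=> //.
by split=> [_ [n _ <-]//|t]; apply; exists 0%N.
Qed.

Lemma compact_sup x (z : nat -> L) s : K x -> nondecreasing_seq z ->
  supremums (range z) s -> x <= s -> exists n, x <= z n.
Proof. by move=> /Kc xx zn zs xs; apply: xx zn zs xs. Qed.

Lemma sup_ge (z : nat -> L) s n : supremums (range z) s -> z n <= s.
Proof. by move=> [us _]; apply: us; exists n. Qed.

Lemma sup_le (z : nat -> L) s t : supremums (range z) s -> (forall n, z n <= t) -> s <= t.
Proof. by move=> [_ ls] h; apply: ls => _ [n _ <-]. Qed.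

(* A diagonal argument: by compactness the double sequence of approximants is dominated
   by a single increasing sequence of its terms. *)
Lemma algebraic_sup (u : nat -> L) x : nondecreasing_seq u -> (forall n, algebraic (u n)) ->
  supremums (range u) x -> algebraic x.
Proof.
move=> un ua ux; have /choice[z hz] := ua.
have zn n : nondecreasing_seq (z n) by have [] := hz n.
have zK n k : K (z n k) by have [] := hz n.
have zu n : supremums (range (z n)) (u n) by have [] := hz n.
have bound N y m : K y -> y <= u N -> (m <= N)%N ->
    exists l, y <= z N l /\ forall n k, (n <= m)%N -> (k <= m)%N -> z n k <= z N l.
  move=> Ky yu mN.
  have /choice[l hl] (p : 'I_m.+1 * 'I_m.+1) : exists l, z p.1 p.2 <= z N l.
    apply: (compact_sup (zK _ _) (zn N) (zu N)); apply: le_trans (sup_ge _ (zu p.1)) _.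
    by apply: un; apply: leq_trans mN; rewrite -ltnS.
  have [l0 h0] := compact_sup Ky (zn N) (zu N) yu.
  exists (maxn l0 (\max_p l p)); split.
    by apply: le_trans h0 _; apply: zn; apply: leq_maxl.
  move=> n k nm km; have := hl (Ordinal (nm : (n < m.+1)%N), Ordinal (km : (k < m.+1)%N)).
  move=> /le_trans; apply; apply: zn; apply: leq_trans (leq_maxr _ _).
  exact: (leq_bigmax (F := l)).
pose Q N (y y' : L) := K y -> y <= u N -> [/\ K y', y' <= u N.+1, y <= y' &
  forall n k, (n <= N)%N -> (k <= N)%N -> z n k <= y'].
have /choice[nx hnx] (p : nat * L) : exists y', Q p.1 p.2 y'.
  have [[Ky yu]|h] := pselect (K p.2 /\ p.2 <= u p.1); last first.
    by exists p.2 => Ky yu; case: h.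
  have [l [yl hl]] := bound p.1.+1 p.2 p.1 Ky (le_trans yu (un _ _ (leqnSn _))) (leqnSn _).
  by exists (z p.1.+1 l) => _ _; split=> //; apply: sup_ge (zu _).
pose w := fix w n := if n is n'.+1 then nx (n', w n') else cu_zero.
have hw n : K (w n) /\ w n <= u n.
  elim: n => [|n [Kw wu]] /=; first by split=> //; apply: cu_ge0.
  by have [] := hnx (n, w n) Kw wu.
have hw' n : w n <= w n.+1 /\ forall i k, (i <= n)%N -> (k <= n)%N -> z i k <= w n.+1.
  by have [Kw wu] := hw n; have [] := hnx (n, w n) Kw wu.
exists w; split.
- by apply/nondecreasing_seqP => n; have [] := hw' n.
- by move=> n; have [] := hw n.
- split=> [_ [n _ <-]|t tw].
    by have [_ /le_trans] := hw n; apply; apply: sup_ge ux.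
  apply: (sup_le ux) => n; apply: (sup_le (zu n)) => k.
  have [_ /(_ n k (leq_maxl _ _) (leq_maxr _ _)) h] := hw' (maxn n k).
  by apply: le_trans h _; apply: tw; exists (maxn n k).+1.
Qed.

Lemma algebraicD x y : algebraic x -> algebraic y -> algebraic (cu_add x y).
Proof.
move=> [u [un uK ux]] [v [vn vK vy]]; exists (fun n => cu_add (u n) (v n)); split.
- by move=> m n mn; apply: cu_leD; [apply: un|apply: vn].
- by move=> n; apply: KD.
- exact: cu_O4.
Qed.

(* The universal property of the limit, applied to this Cu-semigroup, shows that every
   element of the limit is algebraic. *)
Record algpart : Type := AlgPart { alg_val : L; alg_prop : algebraic alg_val }.

Lemma alg_val_inj : injective alg_val.
Proof. by move=> [x ax] [y ay] /= xy; subst y; congr AlgPart; apply: Prop_irrelevance. Qed.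

HB.instance Definition _ := gen_eqMixin algpart.
HB.instance Definition _ := gen_choiceMixin algpart.

Definition alg_le (x y : algpart) : bool := alg_val x <= alg_val y.

Fact alg_le_refl : reflexive alg_le.
Proof. by move=> x; apply: lexx. Qed.
Fact alg_le_anti : antisymmetric alg_le.
Proof. by move=> x y xy; apply: alg_val_inj; apply/eqP; rewrite eq_le. Qed.
Fact alg_le_trans : transitive alg_le.
Proof. by move=> y x z; apply: le_trans. Qed.

HB.instance Definition _ := Order.Le_isPOrder.Build ring_display algpart
  alg_le_refl alg_le_anti alg_le_trans.

(** Suprema are computed in [L] because [algebraic_sup] keeps them inside the algebraic part. *)
Lemma alg_sup (z : nat -> algpart) (s : algpart) : nondecreasing_seq z ->
  supremums (range z) s <-> supremums (range (alg_val \o z)) (alg_val s).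
Proof.
move=> zn; split=> [[us ls]|[us ls]].
  have [t tz] := cu_O1 (alg_val \o z : nat -> L) zn.
  have ta : algebraic t.
    by apply: (algebraic_sup (u := alg_val \o z)) => // n; apply: alg_prop.
  have st : s <= AlgPart ta by apply: ls => _ [n _ <-]; apply: (sup_ge _ tz).
  suff <- : t = alg_val s by [].
  apply/eqP; rewrite eq_le; apply/andP; split; last exact: st.
  by apply: (sup_le tz) => n; apply: us; exists n.
split=> [_ [n _ <-]|t tz]; first by apply: us; exists n.
by apply: ls => _ [n _ <-]; apply: tz; exists n.
Qed.

(** An algebraic [y] is a supremum of elements of [K], which are compact in [L] itself; one of them
    separates [x] from [y], so the relation ≪ of the part is that of [L]. *)
Lemma alg_way_below (x y : algpart) : x ≪ y <-> alg_val x ≪ alg_val y.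
Proof.
split=> [xy|xy z s zn zs ys].
  have [z [zn zK zy]] := alg_prop y.
  pose z' n := AlgPart (algebraic_K (zK n)).
  have z'n : nondecreasing_seq z' := zn.
  have [n xz] := xy z' y z'n ((alg_sup y z'n).2 zy) (lexx y).
  exact: way_belowW xz (Kc (zK n)) (sup_ge n zy).
by apply: (xy (alg_val \o z) (alg_val s)) => //; apply/alg_sup.
Qed.

Definition alg_zero : algpart := AlgPart (algebraic_K K0).
Definition alg_add (x y : algpart) : algpart := AlgPart (algebraicD (alg_prop x) (alg_prop y)).

Fact alg_addA : associative alg_add.
Proof. by move=> x y z; apply: alg_val_inj; apply: cu_addA. Qed.
Fact alg_addC : commutative alg_add.
Proof. by move=> x y; apply: alg_val_inj; apply: cu_addC. Qed.
Fact alg_add0 : left_id alg_zero alg_add.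
Proof. by move=> x; apply: alg_val_inj; apply: cu_add0. Qed.
Fact alg_ge0 x : alg_zero <= x.
Proof. exact: cu_ge0. Qed.
Fact alg_leD2r x y z : x <= y -> alg_add x z <= alg_add y z.
Proof. exact: cu_leD2r. Qed.
Fact alg_O1 (z : nat -> algpart) : nondecreasing_seq z -> exists s, supremums (range z) s.
Proof.
move=> zn; have [t tz] := cu_O1 (alg_val \o z : nat -> L) zn.
have ta : algebraic t.
  by apply: (algebraic_sup (u := alg_val \o z)) => // n; apply: alg_prop.
by exists (AlgPart ta); apply/alg_sup.
Qed.
Fact alg_O2 x : exists z : nat -> algpart, (forall n, z n ≪ z n.+1) /\ supremums (range z) x.
Proof.
have [z [zn zK zx]] := alg_prop x.
pose z' n := AlgPart (algebraic_K (zK n)).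
have z'n : nondecreasing_seq z' := zn.
exists z'; split=> [n|]; last exact/alg_sup.
by apply/alg_way_below; apply: way_belowW (lexx _) (Kc (zK n)) (zn _ _ (leqnSn n)).
Qed.
Fact alg_O3 (x' x y' y : algpart) : x' ≪ x -> y' ≪ y -> alg_add x' y' ≪ alg_add x y.
Proof.
by move=> /alg_way_below xx /alg_way_below yy; apply/alg_way_below; apply: cu_O3.
Qed.
Fact alg_O4 (u v : nat -> algpart) x y :
  nondecreasing_seq u -> nondecreasing_seq v ->
  supremums (range u) x -> supremums (range v) y ->
  supremums (range (fun n => alg_add (u n) (v n))) (alg_add x y).
Proof.
move=> un vn /(alg_sup x un) ux /(alg_sup y vn) vy.
have uvn : nondecreasing_seq (fun n => alg_add (u n) (v n)).
  by move=> m n mn; apply: cu_leD; [apply: un|apply: vn].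
by apply/(alg_sup _ uvn); apply: cu_O4.
Qed.

HB.instance Definition _ := isCuSemigroup.Build algpart alg_addA alg_addC alg_add0
  alg_ge0 alg_leD2r alg_O1 alg_O2 alg_O3 alg_O4.

Definition alg_cuType : cuType := algpart.

Lemma alg_val_cu : cu_morphism (alg_val : algpart -> L).
Proof.
split; first split=> //.
- by move=> z s zn /(alg_sup s zn).
- by move=> x y /alg_way_below.
Qed.

Lemma algpart_cu (T : cuType) (f : T -> L) (fa : forall x, algebraic (f x)) :
  cu_morphism f -> cu_morphism (fun x => AlgPart (fa x) : algpart).
Proof.
move=> [hf fw]; split; first split.
- by apply: alg_val_inj; rewrite /= (gen_cu_zero hf).
- by move=> x y; apply: alg_val_inj; rewrite /= (gen_cu_add hf).
- by move=> x y xy; apply: (gen_cu_homo hf).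
- move=> z s zn zs; have fzn : nondecreasing_seq ((fun x => AlgPart (fa x) : algpart) \o z).
    by move=> m n mn; apply: (gen_cu_homo hf); apply: zn.
  by apply/(alg_sup _ fzn); apply: (gen_cu_sup hf).
- by move=> x y xy; apply/alg_way_below; apply: fw.
Qed.

End AlgebraicPart.

(** * Dimension systems and the compact elements of their limits *)

(** The shape common to both sides; [ds_ext] is the Fraïssé property with equality in place of
    approximation. *)
Record dimsys (r : nat -> nat) (F : forall i j, 'M[nat]_(r j, r i)) : Prop := DimSys {
  ds_id : forall i, F i i = 1%:M;
  ds_comp : forall i j k, (i <= j)%N -> (j <= k)%N -> F j k *m F i j = F i k;
  ds_retr : forall i j, (i <= j)%N -> retr (F i j);
  ds_ext : forall i s (M : 'M[nat]_(s, r i)), retr M ->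
    exists j (L : 'M[nat]_(r j, s)), [/\ (i <= j)%N, retr L & L *m M = F i j];
}.

(* [sig i v] is the image in [L] of the compact element [v] of the i-th simplicial
   semigroup. *)
Record dimlim (L : cuType) (r : nat -> nat) (F : forall i j, 'M[nat]_(r j, r i))
    (sig : forall i, 'cV[nat]_(r i) -> L) : Prop := DimLim {
  dl_zero : forall i, sig i 0 = cu_zero;
  dl_add : forall i v w, sig i (v + w) = cu_add (sig i v) (sig i w);
  dl_le : forall i v w, sig i v <= sig i w <-> vle v w;
  dl_compact : forall i v, sig i v ≪ sig i v;
  dl_map : forall i j v, (i <= j)%N -> sig j (F i j *m v) = sig i v;
  dl_dense : forall x, algebraic [set y | exists i v, y = sig i v] x;
}.

Section SimplicialLimit.
Variables (S : nat -> cuType) (f : forall i j, S i -> S j) (L : cuType) (g : forall i, S i -> L).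
Hypotheses (f_fr : fraisse_sequence sdim f) (g_lim : is_cu_limit f g).

Lemma seq_hom i j : (i <= j)%N -> retractable (@f i j).
Proof. by move=> ij; have [[_ /(_ _ _ ij)[]]] := f_fr. Qed.

Lemma seq_id i x : @f i i x = x.
Proof. by have [[_ _ -> _]] := f_fr. Qed.

Lemma seq_comp i j k x : (i <= j)%N -> (j <= k)%N -> f k (f j x) = @f i k x.
Proof. by move=> ij jk; have [[_ _ _ /(_ _ _ _ ij jk) <-]] := f_fr. Qed.

(** Retractability provides only a generalized morphism as left inverse. A cocone needs maps that
    preserve ≪, and a matrix left inverse has finite entries. *)
Lemma simplicial_retraction i j : (i <= j)%N ->
  exists p : S j -> S i, cu_morphism p /\ p \o @f i j = id.
Proof.
move=> ij; have [[ob _ _ _] _ _] := f_fr.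
have [r [p [p' ip]]] := simplicial_iso (ob i); have [s [q [q' iq]]] := simplicial_iso (ob j).
have [M rM hM] := retractable_matrix ip iq (seq_hom ij).
have [W WM] := retr_linv rM; exists (p' \o mxact W \o q); split.
  apply: cu_morphism_comp (iso_p iq) _; apply: cu_morphism_comp (iso_q ip).
  exact: mxact_cu.
apply/funext => x /=; have /(congr1 (@^~ x)) /= -> := hM.
by rewrite mxact_mul WM mxact1 (iso_pq ip).
Qed.

(* Composing retractions gives a morphism from the limit back to [S i]. *)
Lemma cu_limit_le i (x y : S i) : g x <= g y -> x <= y.
Proof.
pose p k := projT1 (cid (simplicial_retraction (leqnSn k))).
have hp k : cu_morphism (p k) /\ p k \o @f k k.+1 = id :=
  projT2 (cid (simplicial_retraction (leqnSn k))).
(* Retraction from stage [k + i] to stage [i]; with this order of the summands [k.+1 + i] reduces to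
   [(k + i).+1], so the recursion is well typed. Going first from [j] to [j + i] then gives a cocone
   at every [j], also below [i]. *)
pose D := fix D k : S (k + i)%N -> S i :=
  if k is k'.+1 then D k' \o p (k' + i)%N else id.
have hD k : cu_morphism (D k).
  elim: k => [|k IH]; first exact: cu_morphism_id.
  by apply: cu_morphism_comp IH; have [] := hp (k + i)%N.
have Df j k z : (j <= k)%N -> D k (@f (j + i)%N (k + i)%N z) = D j z.
  move=> jk; rewrite -(subnK jk); elim: (k - j)%N => [|m IH].
    by rewrite !add0n seq_id.
  rewrite -IH addSn /= -(@seq_comp _ (m + j + i)%N) ?leq_add2r ?leq_addl//; congr (D _ _).
  by have [_ /(congr1 (@^~ (@f (j + i)%N (m + j + i)%N z)))] := hp (m + j + i)%N.
pose h j := D j \o @f j (j + i)%N.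
have hc : cu_cocone f h.
  split=> [j|j k jk].
    by apply: cu_morphism_comp (hD j); have [] := seq_hom (leq_addr i j).
  apply/funext => z; rewrite /h /= seq_comp ?leq_addr// -(Df j k)//.
  by rewrite seq_comp ?leq_addr// leq_add2r.
have [_ /(_ _ _ hc)[u [[hu ug] _]]] := g_lim.
have hi z : u (g z) = z.
  have /(congr1 (@^~ z)) /= -> := ug i.
  by have := Df 0%N i z (leq0n i).
by move=> /(gen_cu_homo hu); rewrite !hi.
Qed.

Lemma sdim_limit_dimlim : exists r F sig, @dimsys r F /\ @dimlim L r F sig.
Proof.
have [[ob _ _ _] _ ext] := f_fr; have [[gcu gf] univ] := g_lim.
have /choice[r hr] i : exists r (p : S i -> nvec r) (q : nvec r -> S i), cu_iso p q.
  exact: (simplicial_iso (ob i)).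
pose p i := projT1 (cid (hr i)); have hq i := projT2 (cid (hr i)).
pose q i := projT1 (cid (hq i)).
have iso i : cu_iso (p i) (q i) := projT2 (cid (hq i)).
have hF i j : exists M : 'M[nat]_(r j, r i), (i <= j)%N -> retr M /\ p j \o @f i j = mxact M \o p i.
  have [ij|//] := boolP (i <= j)%N; last by exists 0.
  by have [M rM hM] := retractable_matrix (iso i) (iso j) (seq_hom ij); exists M.
pose F i j := projT1 (cid (hF i j)).
have FP i j : (i <= j)%N -> retr (F i j) /\ p j \o @f i j = mxact (F i j) \o p i :=
  projT2 (cid (hF i j)).
have fq i j x : (i <= j)%N -> @f i j (q i x) = q j (mxact (F i j) x).
  move=> ij; have [_ /(congr1 (@^~ (q i x))) /=] := FP i j ij.
  by rewrite (iso_qp (iso i)) => <-; rewrite (iso_pq (iso j)).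
have q_inj i : injective (q i) := can_inj (iso_qp (iso i)).
have qle i (x y : nvec (r i)) : q i x <= q i y -> x <= y.
  by move=> /(gen_cu_homo (iso_p (iso i))); rewrite !(iso_qp (iso i)).
exists r, F, (fun i v => g (q i (vec v))).
pose K := [set y : L | exists i v, y = g (q i (vec v))].
have vec0 n : vec (0 : 'cV[nat]_n) = cu_zero by apply/ffunP => k; rewrite !ffunE mxE.
have vecD n (v w : 'cV[nat]_n) : vec (v + w) = cu_add (vec v) (vec w).
  by apply/ffunP => k; rewrite !ffunE mxE.
have s0 i : g (q i (vec 0)) = cu_zero.
  by rewrite vec0 (gen_cu_zero (iso_q (iso i))) (gen_cu_zero (gcu i)).
have sD i v w : g (q i (vec (v + w))) = cu_add (g (q i (vec v))) (g (q i (vec w))).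
  by rewrite vecD (gen_cu_add (iso_q (iso i))) (gen_cu_add (gcu i)).
have sm i j v : (i <= j)%N -> g (q j (vec (F i j *m v))) = g (q i (vec v)).
  move=> ij; rewrite -mxact_vec -fq//.
  exact: (congr1 (@^~ (q i (vec v))) (gf _ _ ij)).
have sc i v : g (q i (vec v)) ≪ g (q i (vec v)).
  apply: (cu_morphism_way_below (gcu i)); apply: (cu_morphism_way_below (iso_q (iso i))).
  exact: vec_compact.
split; split=> //.
- move=> i; apply: mxact_inj; apply/funext => x; apply: q_inj.
  by rewrite -fq// seq_id mxact1.
- move=> i j k ij jk; apply: mxact_inj; apply/funext => x; apply: (q_inj).
  by rewrite -mxact_mul -!fq ?(leq_trans ij)// seq_comp.
- by move=> i j /FP[].
- move=> i s M rM.
  (* The extension is requested on the finite set of unit vectors. They are compact, so each may be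
     compared with itself, and the two inequalities of [approx_on] give equality. *)
  have [||j [b [ij [_ _ rb] hb]]] := ext i (range (fun k => q i (bas k))) (nvec s) (mxact M \o p i).
  + by apply: finite_image; apply: finite_finset.
  + exact: (sdim_mxact (iso i) (ob i) rM).
  have iN : cu_iso (@id (nvec s)) id by split=> //; apply: cu_morphism_id.
  have [Q rQ hQ] := retractable_matrix iN (iso j) rb.
  exists j, Q; split=> //; apply: mxact_inj; rewrite -mxact_comp.
  apply: gen_ext; [exact: gen_cu_morphism_comp (mxact_cu M) (mxact_cu Q)|exact: mxact_cu|].
  move=> k; apply: (q_inj j); rewrite -fq//.
  have /(congr1 (@^~ (mxact M (bas k)))) /= <- := hQ; rewrite (iso_pq (iso j)).
  have kk : q i (bas k) ≪ q i (bas k).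
    by apply: (cu_morphism_way_below (iso_q (iso i))); apply: bas_compact.
  have [] := hb (q i (bas k)) (q i (bas k)) _ _ kk; [by exists k|by exists k|].
  move=> /= h1 h2; rewrite (iso_qp (iso i)) in h1 h2.
  by apply/eqP; rewrite eq_le h1 h2.
- move=> i v w; split=> [/cu_limit_le/qle/vec_le//|/vec_le vw].
  by apply: (gen_cu_homo (gcu i)); apply: (gen_cu_homo (iso_q (iso i))).
have K0 : K cu_zero by exists 0%N, 0; rewrite s0.
have KD x y : K x -> K y -> K (cu_add x y).
  move=> [i [v ->]] [j [w ->]]; exists (maxn i j), (F _ _ *m v + F _ _ *m w).
  by rewrite sD !sm ?leq_maxl ?leq_maxr.
have Kc x : K x -> x ≪ x by move=> [i [v ->]].
have ga i (x : S i) : algebraic K (g x).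
  exists (fun n => g (q i (trunc (p i x) n))); split=> [|n|].
  - move=> m n mn; apply: (gen_cu_homo (gcu i)); apply: (gen_cu_homo (iso_q (iso i))).
    exact: trunc_homo.
  - by have [v ->] := trunc_vec (p i x) n; exists i, v.
  - have hs := nsup_supremum (@trunc_nsup _ (p i x)).
    have := gen_cu_sup (iso_q (iso i)) (@trunc_homo _ _) hs; rewrite (iso_pq (iso i)).
    apply: (gen_cu_sup (gcu i)).
    exact: (nondecreasing_comp (iso_q (iso i)) (@trunc_homo _ _)).
pose T := alg_cuType K0 KD Kc.
pose h i (x : S i) : T := AlgPart (ga i x).
have hc : cu_cocone f h.
  split=> [i|i j ij]; first exact: (algpart_cu K0 KD Kc (ga i) (gcu i)).
  by apply/funext => x; apply: alg_val_inj; rewrite /= -(gf _ _ ij).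
have [u [[hu ug] _]] := univ _ _ hc.
(* The composite through the algebraic part and the identity both factor the cocone [g], so
   uniqueness identifies them. *)
pose w : L -> L := fun x => alg_val (u x).
have hw : cu_morphism w by apply: cu_morphism_comp hu (alg_val_cu K0 KD Kc).
have wg i : w \o @g i = @g i.
  by apply/funext => x /=; rewrite /w; have /(congr1 (@^~ x)) /= -> := ug i.
have [u' [_ uu]] := univ L g (conj gcu gf).
have wid : w = id by rewrite -(uu w)// -(uu id)//; split=> //; apply: cu_morphism_id.
by move=> x; have := alg_prop (u x); rewrite -[alg_val _]/(w x) wid.
Qed.

End SimplicialLimit.

(** * Back and forth *)

Section BackAndForth.
Variables (r : nat -> nat) (F : forall i j, 'M[nat]_(r j, r i)).
Variables (r' : nat -> nat) (F' : forall i j, 'M[nat]_(r' j, r' i)).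
Hypotheses (dF : dimsys F) (dF' : dimsys F').

Record stage := Stage {
  stage_l : nat;
  stage_r : nat;
  stage_mx : 'M[nat]_(r' stage_r, r stage_l);
  stage_retr : retr stage_mx;
}.

(** [N] is the backward leg of the zigzag; strict growth of both indices makes the stages
    cofinal. *)
Definition stage_next (s t : stage) : Prop :=
  [/\ (stage_l s < stage_l t)%N, (stage_r s < stage_r t)%N &
  exists N : 'M[nat]_(r (stage_l t), r' (stage_r s)),
    N *m stage_mx s = F (stage_l s) (stage_l t) /\
    stage_mx t *m N = F' (stage_r s) (stage_r t)].

Lemma stage_step s : exists t, stage_next s t.
Proof.
case: s => i j M rM; have [i1 [N [ii rN NM]]] := ds_ext dF rM.
(* The extension property gives only a weak inequality of indices; one more connecting matrix makes
   it strict. *)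
have ri : retr (F i1 i1.+1 *m N) by apply: retr_mul rN; apply: (ds_retr dF).
have [j1 [M1 [jj rM1 MN]]] := ds_ext dF' ri.
have rj : retr (F' j1 j1.+1 *m M1) by apply: retr_mul rM1; apply: (ds_retr dF').
exists (Stage rj); split=> //=.
exists (F i1 i1.+1 *m N); split; first by rewrite -mulmxA NM (ds_comp dF).
by rewrite -mulmxA MN (ds_comp dF').
Qed.

Lemma back_and_forth : exists st : nat -> stage, forall k, stage_next (st k) (st k.+1).
Proof.
(* The starting matrix: the second system absorbs the sum [r 0 + r' 0] as an extension of [r' 0],
   and the restriction to [r 0] is a retractable matrix between the two systems. *)
have r0 : retr (col_mx 0 1%:M : 'M[nat]_(r 0%N + r' 0%N, r' 0%N)) by apply/retr_col_mxr/retr1.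
have [j [M [_ rM _]]] := ds_ext dF' r0.
have rM0 : retr (M *m col_mx 1%:M 0 : 'M[nat]_(_, r 0%N)).
  by apply: retr_mul rM _; apply/retr_col_mxl/retr1.
have /choice[nx hnx] := stage_step.
by exists (fun k => iter k nx (Stage rM0)) => k; apply: hnx.
Qed.

Lemma dimlim_transfer (L : cuType) (sig : forall i, 'cV[nat]_(r' i) -> L) :
  dimlim F' sig -> exists tau : forall i, 'cV[nat]_(r i) -> L, dimlim F tau.
Proof.
move=> dS; have [st hst] := back_and_forth.
pose i k := stage_l (st k); pose j k := stage_r (st k).
pose al k : 'M[nat]_(r' (j k), r (i k)) := stage_mx (st k).
have ile k l : (k <= l)%N -> (i k <= i l)%N.
  apply: (homo_leq (f := i) (r := leq)) => // [m n p|n]; first exact: leq_trans.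
  by have [/ltnW] := hst n.
have jle k l : (k <= l)%N -> (j k <= j l)%N.
  apply: (homo_leq (f := j) (r := leq)) => // [m n p|n]; first exact: leq_trans.
  by have [_ /ltnW] := hst n.
have ige k : (k <= i k)%N.
  by elim: k => // k /leq_ltn_trans; apply; have [] := hst k.
have jge k : (k <= j k)%N.
  by elim: k => // k /leq_ltn_trans; apply; have [] := hst k.
have alF k l : (k <= l)%N -> al l *m F (i k) (i l) = F' (j k) (j l) *m al k.
  move=> kl; rewrite -(subnK kl); elim: (l - k)%N => [|m IH].
    by rewrite add0n (ds_id dF) (ds_id dF') mul1mx mulmx1.
  have kml := leq_addl m k; have [_ _ [N [N1 N2]]] := hst (m + k)%N.
  rewrite addSn -(ds_comp dF (ile _ _ kml) (ile _ _ (leqnSn _))).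
  rewrite -(ds_comp dF' (jle _ _ kml) (jle _ _ (leqnSn _))).
  by rewrite -{1}N1 -N2 -!mulmxA -IH !mulmxA.
(* [v] is pushed to the [k]-th stage of the zigzag, crosses it, and is evaluated by [sig]. The
   result is the same for all [k] with [n <= i k], so that [k = n] is a valid choice. *)
pose T k n (v : 'cV[nat]_(r n)) := sig (j k) (al k *m (F n (i k) *m v)).
have Tkl k l n v : (k <= l)%N -> (n <= i k)%N -> T l n v = T k n v.
  move=> kl ni; rewrite /T -(ds_comp dF ni (ile _ _ kl)) -[F _ _ *m _ *m v]mulmxA.
  by rewrite [al l *m _]mulmxA (alF _ _ kl) -mulmxA (dl_map dS)// jle.
exists (fun n v => T n n v); split.
- by move=> n; rewrite /T !mulmx0 (dl_zero dS).
- by move=> n v w; rewrite /T !mulmxDr (dl_add dS).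
- move=> n v w; rewrite /T (dl_le dS); split=> [|vw]; last exact/vle_mul/vle_mul.
  by move=> /(retr_vle (@stage_retr (st n))); apply: retr_vle; apply: (ds_retr dF).
- by move=> n v; apply: (dl_compact dS).
- move=> n m v nm; rewrite -(Tkl n m)// /T [F m _ *m _]mulmxA (ds_comp dF)//.
- move=> x; have [z [zn zK zx]] := dl_dense dS x; exists z; split=> // n.
  have [k [w ->]] := zK n.
  (* The backward leg provides a preimage: [al k.+1 *m N] is a connecting matrix of the second
     system. *)
  have [_ _ [N [N1 N2]]] := hst k.
  exists (i k.+1), (N *m (F' k (j k) *m w)).
  rewrite (Tkl k.+1) ?ige// /T (ds_id dF) mul1mx mulmxA [al _ *m _]N2.
  by rewrite !(dl_map dS)// jle.
Qed.

End BackAndForth.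

(** * Real-valued norms *)

Section RealNorm.
Variable R : realType.
Local Notation C := R[i].

(** Norms take values in [R[i]], whose order is partial; the real part gives access to real
    arithmetic. *)
Definition nrm (V : normedZmodType C) (x : V) : R := complex.Re `|x|.

Section Zmod.
Variable V : normedZmodType C.
Implicit Types x y : V.

Lemma nrmE x : `|x| = (nrm x)%:C.
Proof. by rewrite /nrm RRe_real// normr_real. Qed.

Lemma nrm_ge0 x : 0 <= nrm x.
Proof. by rewrite -ler0c -nrmE. Qed.

Lemma nrm0 : nrm (0 : V) = 0.
Proof. by rewrite /nrm normr0. Qed.

Lemma nrm_eq0 x : nrm x = 0 -> x = 0.
Proof. by move=> x0; apply/normr0_eq0; rewrite nrmE x0. Qed.

Lemma nrm_gt0 x : x <> 0 -> 0 < nrm x.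
Proof.
move=> x0; rewrite lt_neqAle nrm_ge0 andbT eq_sym.
by apply/eqP => /nrm_eq0.
Qed.

Lemma nrmD x y : nrm (x + y) <= nrm x + nrm y.
Proof. by rewrite -lecR rmorphD/= -!nrmE ler_normD. Qed.

Lemma nrmN x : nrm (- x) = nrm x.
Proof. by rewrite /nrm normrN. Qed.

Lemma nrm_distC x y : nrm (x - y) = nrm (y - x).
Proof. by rewrite -nrmN opprB. Qed.

Lemma nrm_distD z x y : nrm (x - y) <= nrm (x - z) + nrm (z - y).
Proof. by rewrite (le_trans _ (nrmD _ _))// addrA subrK. Qed.

Lemma nrm_le_dist x y : nrm x <= nrm y + nrm (x - y).
Proof. by rewrite (le_trans _ (nrmD _ _))// addrC subrK. Qed.

Lemma nrm_sum I (r : seq I) (P : pred I) (F : I -> V) :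
  nrm (\sum_(i <- r | P i) F i) <= \sum_(i <- r | P i) nrm (F i).
Proof.
elim/big_rec2: _ => [|i y x _ xy]; first by rewrite nrm0.
by rewrite (le_trans (nrmD _ _))// lerD.
Qed.

Lemma nrm_small_eq0 x : (forall e, 0 < e -> nrm x < e) -> x = 0.
Proof.
move=> h; apply: nrm_eq0; apply/eqP; rewrite eq_le nrm_ge0 andbT leNgt.
by apply/negP => /h; rewrite ltxx.
Qed.

End Zmod.

Lemma nrm_real (x : R) : nrm (x%:C : C) = `|x|.
Proof. by rewrite /nrm normc_def /= expr0n addr0 sqrtr_sqr. Qed.

Lemma nrmM (k l : C) : nrm (k * l) = nrm k * nrm l.
Proof. by apply: complexI; rewrite rmorphM/= -!nrmE normrM. Qed.

Lemma nrmZ (V : normedModType C) (k : C) (x : V) : nrm (k *: x) = nrm k * nrm x.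
Proof. by apply: complexI; rewrite rmorphM/= -!nrmE normrZ. Qed.

Lemma nrm_norm_lt (V : normedZmodType C) (x : V) (e : R) :
  (`|x| < e%:C) = (nrm x < e).
Proof. by rewrite nrmE ltcR. Qed.

Lemma gt0_complex (e : C) : 0 < e -> exists2 r : R, 0 < r & e = r%:C.
Proof.
move=> e0; exists (complex.Re e); last by rewrite RRe_real// gtr0_real.
by rewrite -ltcR RRe_real// gtr0_real.
Qed.

Definition tends (V : normedZmodType C) (u : nat -> V) (l : V) : Prop :=
  forall e : R, 0 < e -> exists N, forall n, (N <= n)%N -> nrm (u n - l) < e.

Section Tends.
Variable V : normedZmodType C.
Implicit Types (u v : nat -> V) (l m : V).

Lemma tends_unique u l m : tends u l -> tends u m -> l = m.
Proof.
move=> ul um; apply/subr0_eq/nrm_small_eq0 => e e0.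
have e2 : 0 < e / 2 by rewrite divr_gt0.
have [N hN] := ul _ e2; have [M hM] := um _ e2.
rewrite (le_lt_trans (nrm_distD (u (maxn N M)) _ _))// [e]splitr.
rewrite ltrD ?hM ?leq_maxr// nrm_distC hN// leq_maxl//.
Qed.

Lemma tends_cst l : tends (fun=> l) l.
Proof. by move=> e e0; exists 0%N => n _; rewrite subrr nrm0. Qed.

Lemma tends_eventually u v l N : tends u l ->
  (forall n, (N <= n)%N -> v n = u n) -> tends v l.
Proof.
move=> ul uv e e0; have [M hM] := ul _ e0; exists (maxn N M) => n.
by rewrite geq_max => /andP[/uv -> /hM].
Qed.

Lemma tends_bound u l (b : nat -> R) : (forall n, nrm (u n - l) <= b n) ->
  (forall e, 0 < e -> exists N, forall n, (N <= n)%N -> b n < e) -> tends u l.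
Proof.
move=> ub bl e /bl[N hN]; exists N => n /hN; exact: le_lt_trans.
Qed.

Lemma tends_dom (W : normedZmodType C) (w : nat -> W) (k : W) u l (K : R) :
  tends w k -> (forall n, nrm (u n - l) <= K * nrm (w n - k)) -> tends u l.
Proof.
move=> wk h e e0; have K0 : 0 < `|K| + 1 by rewrite ltr_wpDl.
have [N hN] := wk (e / (`|K| + 1)) (divr_gt0 e0 K0).
exists N => n /hN; rewrite ltr_pdivlMr// => /(le_lt_trans _); apply.
rewrite (le_trans (h n))// mulrC ler_wpM2l ?nrm_ge0//.
by rewrite (le_trans (ler_norm _))// lerDl.
Qed.

Lemma tendsD u v l m : tends u l -> tends v m -> tends (fun n => u n + v n) (l + m).
Proof.
move=> ul vm e e0; have e2 : 0 < e / 2 by rewrite divr_gt0.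
have [N hN] := ul _ e2; have [M hM] := vm _ e2.
exists (maxn N M) => n; rewrite geq_max => /andP[/hN nN /hM nM].
by rewrite opprD addrACA (le_lt_trans (nrmD _ _))// [e]splitr ltrD.
Qed.

Lemma tends_subseq u l (s : nat -> nat) : (forall n, (n <= s n)%N) ->
  tends u l -> tends (u \o s) l.
Proof.
move=> sn ul e /ul[N hN]; exists N => n Nn /=; apply: hN.
exact: leq_trans Nn (sn n).
Qed.

Lemma tends_bounded u l : tends u l ->
  exists2 K : R, 0 <= K & exists N, forall n, (N <= n)%N -> nrm (u n) <= K.
Proof.
move=> ul; exists (nrm l + 1); first by rewrite addr_ge0 ?nrm_ge0.
have [N hN] := ul 1 ltr01; exists N => n /hN h.
by rewrite (le_trans (nrm_le_dist _ l))// lerD2l ltW.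
Qed.

End Tends.

Lemma tends_cvg (V : normedModType C) (u : nat -> V) (l : V) :
  tends u l <-> u n @[n --> \oo] --> l.
Proof.
split=> [ul|].
  apply/cvgrPdist_lt => e /gt0_complex[r r0 ->].
  have [N hN] := ul _ r0; exists N => // n Nn /=.
  by rewrite nrm_norm_lt nrm_distC hN.
move/cvgrPdist_lt => ul e e0; have ec0 : 0 < (e%:C : C) by rewrite ltcR.
have [N _ hN] := ul _ ec0; exists N => n Nn.
by rewrite nrm_distC -nrm_norm_lt; apply: hN.
Qed.

Lemma closure_nrmP (V : normedModType C) (E : set V) (x : V) :
  closure E x <-> forall e : R, 0 < e -> exists2 y, E y & nrm (x - y) < e.
Proof.
split=> [cx e e0|h].
  have ec0 : 0 < (e%:C : C) by rewrite ltcR.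
  have [y [Ey xy]] := cx (ball x e%:C) (nbhsx_ballx _ _ ec0).
  by exists y => //; move: xy; rewrite -ball_normE /= nrm_norm_lt.
move=> A /nbhs_ballP[e /= /gt0_complex[r r0 ->] xA].
have [y Ey xy] := h _ r0; exists y; split=> //; apply: xA.
by rewrite -ball_normE /= nrm_norm_lt.
Qed.

Lemma cauchy_tends (V : completeNormedModType C) (u : nat -> V) :
  (forall e : R, 0 < e ->
     exists N, forall m n, (N <= m)%N -> (N <= n)%N -> nrm (u m - u n) < e) ->
  exists l, tends u l.
Proof.
move=> h; suff : cvg (u @ \oo) by move=> /tends_cvg ul; exists (lim (u @ \oo)).
apply/cauchy_cvgP/cauchy_ballP => e /gt0_complex[r r0 ->].
have [N hN] := h _ r0.
exists (u @` [set n | (N <= n)%N], u @` [set n | (N <= n)%N]) => /=.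
  by split; exists N => // n /= Nn; exists n.
move=> [_ _] [/= [m Nm <-] [n Nn <-]]; rewrite -ball_normE /= nrm_norm_lt.
exact: hN.
Qed.

Lemma geom_lt (q e : R) : 0 <= q -> q < 1 -> 0 < e ->
  exists N, forall n, (N <= n)%N -> q ^+ n < e.
Proof.
move=> q0 q1 e0.
have : (geometric 1 q : nat -> R) n @[n --> \oo] --> (0 : R).
  by apply: cvg_geometric; rewrite ger0_norm.
move/cvgrPdist_lt => /(_ _ e0)[N _ hN]; exists N => n Nn.
by have := hN n Nn; rewrite /= mul1r sub0r normrN normrX ger0_norm.
Qed.

Lemma geom_tends (V : completeNormedModType C) (u : nat -> V) (K q : R) :
  0 <= q -> q < 1 -> (forall n, nrm (u n.+1 - u n) <= K * q ^+ n) ->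
  exists l, tends u l.
Proof.
move=> q0 q1 hu; apply: cauchy_tends => e e0.
have K0 : 0 <= K by have := le_trans (nrm_ge0 _) (hu 0%N); rewrite mulr1.
have p1 : 0 < 1 - q by rewrite subr_gt0.
(* The exact partial geometric sum closes the induction; the cruder uniform bound is deduced from
   it. *)
have dist N k : nrm (u (N + k)%N - u N) <= K * q ^+ N / (1 - q) * (1 - q ^+ k).
  elim: k => [|k IH]; first by rewrite addn0 subrr nrm0 subrr mulr0.
  rewrite addnS (le_trans (nrm_distD (u (N + k)%N) _ _))//.
  rewrite (le_trans (lerD (hu _) IH))// exprD exprS le_eqVlt; apply/orP; left.
  by apply/eqP; field; rewrite gt_eqF.
have dist2 N k : nrm (u (N + k)%N - u N) <= K / (1 - q) * q ^+ N.
  rewrite (le_trans (dist N k))// [leRHS]mulrAC.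
  have K2 : 0 <= K * q ^+ N / (1 - q) by rewrite divr_ge0 ?mulr_ge0 ?exprn_ge0// ltW.
  by have := exprn_ge0 k q0; nra.
have K1 : 0 < (K / (1 - q) + 1) by rewrite ltr_wpDl// divr_ge0// ltW.
have [N hN] := geom_lt q0 q1 (divr_gt0 (divr_gt0 e0 K1) (ltr0Sn _ 1)).
exists N => m n Nm Nn; rewrite (le_lt_trans (nrm_distD (u N) _ _))//.
have hk k : (N <= k)%N -> nrm (u k - u N) < e / 2.
  move=> Nk; rewrite -(subnKC Nk) (le_lt_trans (dist2 _ _))//.
  have := hN N (leqnn _); rewrite ltr_pdivlMr// ltr_pdivlMr// => h.
  rewrite ltr_pdivlMr// (le_lt_trans _ h)//.
  have := exprn_ge0 N q0.
  set a := _ ^+ N; set b := K / _ => a0.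
  by rewrite (_ : b * a * 2 = a * 2 * b); [nra|ring].
by rewrite [e]splitr ltrD ?hk// nrm_distC hk.
Qed.

End RealNorm.

Notation "a · b" := (cmul a b) (at level 40, left associativity).
Notation "a ^†" := (cstar a) (at level 2, format "a ^†").

(** * Projections, homomorphisms and subalgebras *)

Section CStarBasics.
Variable R : realType.
Local Notation C := R[i].

Section Algebra.
Variable B : cstarType R.
Implicit Types a b c p q : B.

Lemma cmul0r a : 0 · a = 0.
Proof. by rewrite -[0](scale0r (0 : B)) cmulZl !scale0r. Qed.

Lemma cmulr0 a : a · 0 = 0.
Proof. by rewrite -[0](scale0r (0 : B)) cmulZr !scale0r. Qed.

Lemma cmulNr a b : - a · b = - (a · b).
Proof. by rewrite -scaleN1r cmulZl scaleN1r. Qed.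

Lemma cmulrN a b : a · (- b) = - (a · b).
Proof. by rewrite -scaleN1r cmulZr scaleN1r. Qed.

Lemma cmulBl a b c : (a - b) · c = a · c - b · c.
Proof. by rewrite cmulDl cmulNr. Qed.

Lemma cmulBr a b c : a · (b - c) = a · b - a · c.
Proof. by rewrite cmulDr cmulrN. Qed.

Lemma cmul_suml I (r : seq I) (P : pred I) (F : I -> B) a :
  (\sum_(i <- r | P i) F i) · a = \sum_(i <- r | P i) F i · a.
Proof. by rewrite (big_morph (cmul^~ a) (fun x y => cmulDl x y a) (cmul0r a)). Qed.

Lemma cmul_sumr I (r : seq I) (P : pred I) (F : I -> B) a :
  a · (\sum_(i <- r | P i) F i) = \sum_(i <- r | P i) a · F i.
Proof. by rewrite (big_morph (cmul a) (cmulDr a) (cmulr0 a)). Qed.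

Lemma cstar0 : (0 : B)^† = 0.
Proof. by rewrite -[0](scale0r (0 : B)) cstarZ rmorph0 !scale0r. Qed.

Lemma cstarN a : (- a)^† = - a^†.
Proof. by rewrite -scaleN1r cstarZ rmorphN rmorph1 scaleN1r. Qed.

Lemma cstarB a b : (a - b)^† = a^† - b^†.
Proof. by rewrite cstarD cstarN. Qed.

Lemma cstar_sum I (r : seq I) (P : pred I) (F : I -> B) :
  (\sum_(i <- r | P i) F i)^† = \sum_(i <- r | P i) (F i)^†.
Proof. by rewrite (big_morph cstar (@cstarD _ B) cstar0). Qed.

Lemma cstar_inj : injective (@cstar R B).
Proof. exact: (can_inj (@cstarK _ B)). Qed.

Lemma nrm_cmul a b : nrm (a · b) <= nrm a * nrm b.
Proof. by rewrite -lecR rmorphM/= -!nrmE cnormM. Qed.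

Lemma nrm_cstar_mul a : nrm (a^† · a) = nrm a ^+ 2.
Proof. by apply: complexI; rewrite rmorphXn/= -!nrmE cnorm_cstar. Qed.

Lemma nrm_cstar a : nrm a^† = nrm a.
Proof.
suff le b : nrm b <= nrm b^†.
  by apply/eqP; rewrite eq_le le andbT -{2}(cstarK a) le.
have [->|b0] := eqVneq (nrm b) 0; first exact: nrm_ge0.
have {}b0 : 0 < nrm b by rewrite lt_neqAle eq_sym b0 nrm_ge0.
by rewrite -(ler_pM2r b0) -expr2 -nrm_cstar_mul nrm_cmul.
Qed.

Lemma cstar_mul_eq0 a : a^† · a = 0 -> a = 0.
Proof.
by move=> a0; apply: nrm_eq0; apply/eqP; rewrite -sqrf_eq0 -nrm_cstar_mul a0 nrm0.
Qed.

Lemma mul_cstar_eq0 a : a · a^† = 0 -> a = 0.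
Proof.
by move=> a0; apply: cstar_inj; rewrite cstar0; apply: cstar_mul_eq0; rewrite cstarK.
Qed.

Lemma nrm_conjugate a b : nrm (a · b · a^†) <= nrm a ^+ 2 * nrm b.
Proof.
rewrite (le_trans (nrm_cmul _ _))// nrm_cstar.
have := nrm_cmul a b; have := nrm_ge0 a; nra.
Qed.

Definition is_proj p : Prop := p · p = p /\ p^† = p.

Lemma nrm_proj p : is_proj p -> p <> 0 -> nrm p = 1.
Proof.
move=> [pp ps] /nrm_gt0 p0; have := nrm_cstar_mul p.
rewrite ps pp; nra.
Qed.

Lemma nrm_proj_le1 p : is_proj p -> nrm p <= 1.
Proof.
move=> pp; have [->|/eqP p0] := eqVneq p 0; first by rewrite nrm0.
by rewrite nrm_proj.
Qed.

Lemma nrm_piso_le1 a : is_proj (a^† · a) -> nrm a <= 1.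
Proof.
move=> /nrm_proj_le1; rewrite nrm_cstar_mul => h.
by rewrite -(ler_pXn2r (n := 2)) ?nnegrE ?nrm_ge0// expr1n.
Qed.

Lemma piso_mul_source a p : a^† · a = p -> is_proj p -> a · p = a.
Proof.
move=> ap [pp ps]; apply/subr0_eq/cstar_mul_eq0.
rewrite cstarB cstarM ps !cmulBl !cmulBr.
have -> : p · a^† · (a · p) = p by rewrite cmulA -(cmulA p) ap pp pp.
have -> : p · a^† · a = p by rewrite -cmulA ap pp.
by rewrite cmulA ap pp subrr.
Qed.

Lemma piso_range a p : a^† · a = p -> is_proj p -> is_proj (a · a^†).
Proof.
move=> ap pp; split; last by rewrite cstarM cstarK.
by rewrite cmulA -(cmulA a) ap (piso_mul_source ap).
Qed.

Lemma proj_orthC p q : is_proj p -> is_proj q -> p · q = 0 -> q · p = 0.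
Proof. by move=> [_ ps] [_ qs] pq; apply: cstar_inj; rewrite cstarM ps qs pq cstar0. Qed.

Lemma is_proj_sum (I : finType) (P : pred I) (F : I -> B) :
  (forall i, P i -> is_proj (F i)) ->
  (forall i j, P i -> P j -> i != j -> F i · F j = 0) ->
  is_proj (\sum_(i | P i) F i).
Proof.
move=> pF oF; split.
  rewrite cmul_suml; apply: eq_bigr => i Pi; rewrite cmul_sumr (bigD1 i)//=.
  rewrite (pF i Pi).1 big1 ?addr0// => j /andP[Pj ji].
  by apply: oF => //; rewrite eq_sym.
by rewrite cstar_sum; apply: eq_bigr => i Pi; rewrite (pF i Pi).2.
Qed.

End Algebra.

Lemma tends_cmul (B : cstarType R) (u v : nat -> B) l m :
  tends u l -> tends v m -> tends (fun n => u n · v n) (l · m).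
Proof.
move=> ul vm.
have [K K0 [N0 hK]] := tends_bounded ul.
have ulm : tends (fun n => (u n - l) · m) 0.
  apply: (tends_dom (K := nrm m) ul) => n; rewrite subr0 mulrC; exact: nrm_cmul.
pose w n := if (N0 <= n)%N then u n · (v n - m) else 0.
have uvm : tends w 0.
  apply: (tends_dom (K := K) vm) => n; rewrite /w subr0; case: ifP => [/hK h|_].
    by rewrite (le_trans (nrm_cmul _ _))// ler_wpM2r ?nrm_ge0.
  by rewrite nrm0 mulr_ge0 ?nrm_ge0.
have := tendsD (tendsD ulm uvm) (tends_cst (l · m)); rewrite !add0r.
move/(tends_eventually (N := N0)); apply=> n Nn; rewrite /w Nn.
by rewrite cmulBl cmulBr addrC addrCA addrC !addrA subrK; rewrite addrAC subrr add0r.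
Qed.

Lemma tends_cstar (B : cstarType R) (u : nat -> B) l :
  tends u l -> tends (fun n => (u n)^†) l^†.
Proof.
by move=> ul; apply: (tends_dom (K := 1) ul) => n; rewrite -cstarB nrm_cstar mul1r.
Qed.

Lemma tendsZ (B : cstarType R) (k : C) (u : nat -> B) l :
  tends u l -> tends (fun n => k *: u n) (k *: l).
Proof.
by move=> ul; apply: (tends_dom (K := nrm k) ul) => n; rewrite -scalerBr nrmZ.
Qed.

Section StarHom.
Variables (A B : cstarType R) (f : A -> B).
Hypothesis hf : star_hom f.

Lemma star_homD : {morph f : a b / a + b}.
Proof. by move=> a b; rewrite -[a]scale1r (star_hom_linear hf) !scale1r. Qed.

Lemma star_hom0 : f 0 = 0.
Proof. by apply: (addrI (f 0)); rewrite -star_homD !addr0. Qed.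

Lemma star_homZ k : {morph f : a / k *: a}.
Proof. by move=> a; rewrite -[k *: a]addr0 (star_hom_linear hf) star_hom0 addr0. Qed.

Lemma star_homN : {morph f : a / - a}.
Proof. by move=> a; rewrite -scaleN1r star_homZ scaleN1r. Qed.

Lemma star_homB : {morph f : a b / a - b}.
Proof. by move=> a b; rewrite star_homD star_homN. Qed.

Lemma star_hom_sum I (r : seq I) (P : pred I) (F : I -> A) :
  f (\sum_(i <- r | P i) F i) = \sum_(i <- r | P i) f (F i).
Proof. by rewrite (big_morph f star_homD star_hom0). Qed.

Lemma star_hom_proj p : is_proj p -> is_proj (f p).
Proof.
by move=> [pp ps]; split; rewrite -?(star_hom_mul hf) -?(star_hom_star hf) ?pp ?ps.
Qed.

End StarHom.

Lemma star_hom_id (A : cstarType R) : star_hom (@id A).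
Proof. by split. Qed.

Lemma star_hom_comp (A B D : cstarType R) (f : A -> B) (g : B -> D) :
  star_hom f -> star_hom g -> star_hom (g \o f).
Proof.
move=> hf hg; split=> [k a b|a b|a] /=.
- by rewrite (star_hom_linear hf) (star_hom_linear hg).
- by rewrite (star_hom_mul hf) (star_hom_mul hg).
- by rewrite (star_hom_star hf) (star_hom_star hg).
Qed.

Record star_subalg (B : cstarType R) (K : set B) : Prop := StarSubalg {
  subalg0 : K 0;
  subalgD : forall a b, K a -> K b -> K (a + b);
  subalgZ : forall (k : C) a, K a -> K (k *: a);
  subalgM : forall a b, K a -> K b -> K (a · b);
  subalgS : forall a, K a -> K a^†;
}.

Section Subalg.
Variables (B : cstarType R) (K : set B) (hK : star_subalg K).

Lemma subalgN a : K a -> K (- a).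
Proof. by move=> Ka; rewrite -scaleN1r; apply: (subalgZ hK). Qed.

Lemma subalgB a b : K a -> K b -> K (a - b).
Proof. by move=> Ka Kb; apply: (subalgD hK) => //; apply: subalgN. Qed.

Lemma subalg_sum I (r : seq I) (P : pred I) (F : I -> B) :
  (forall i, P i -> K (F i)) -> K (\sum_(i <- r | P i) F i).
Proof.
move=> KF; elim/big_rec: _ => [|i x /KF]; first exact: (subalg0 hK).
exact: (subalgD hK).
Qed.

End Subalg.

Lemma star_subalg_closure (B : cstarType R) (K : set B) :
  star_subalg K -> star_subalg (closure K).
Proof.
move=> hK.
have cl x : closure K x -> exists2 u : nat -> B, (forall n, K (u n)) & tends u x.
  move/closure_nrmP => cx.
  have /choice[u hu] n : exists y, K y /\ nrm (x - y) < n.+1%:R^-1.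
    by have [|y] := cx n.+1%:R^-1; [rewrite invr_gt0|exists y].
  exists u => [n|]; first by case: (hu n).
  apply: (tends_bound (b := fun n => n.+1%:R^-1)) => [n|e e0].
    by rewrite nrm_distC ltW//; case: (hu n).
  exists (Num.truncn e^-1) => n en; rewrite invf_plt ?posrE//.
  by rewrite (lt_le_trans (Num.Theory.truncnS_gt _))// ler_nat.
have lc (u : nat -> B) x : (forall n, K (u n)) -> tends u x -> closure K x.
  move=> Ku ux; apply/closure_nrmP => e /ux[N hN].
  by exists (u N) => //; rewrite nrm_distC hN.
split.
- by apply: subset_closure; apply: (subalg0 hK).
- move=> a b /cl[u Ku ua] /cl[v Kv vb]; apply: (lc (fun n => u n + v n)).
    by move=> n; apply: (subalgD hK).
  exact: tendsD.
- move=> k a /cl[u Ku ua]; apply: (lc (fun n => k *: u n)).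
    by move=> n; apply: (subalgZ hK).
  exact: tendsZ.
- move=> a b /cl[u Ku ua] /cl[v Kv vb]; apply: (lc (fun n => u n · v n)).
    by move=> n; apply: (subalgM hK).
  exact: tends_cmul.
- move=> a /cl[u Ku ua]; apply: (lc (fun n => (u n)^†)).
    by move=> n; apply: (subalgS hK).
  exact: tends_cstar.
Qed.

End CStarBasics.

(** * Closed subalgebras and the complex numbers as C*-algebras *)

Section SubCStar.
Variables (R : realType) (B : cstarType R) (K : set B).
Variables (hK : star_subalg K) (cK : closed K).
Local Notation C := R[i].

(** The proofs that [K] is a closed subalgebra are parameters of the type, so that the C*-structure
    is inferred from the type alone. *)
Record csub (h : star_subalg K) (c : closed K) : Type :=
  CSub { csub_val : B; csub_prop : K csub_val }.

Local Notation D := (csub hK cK).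

Lemma csub_val_inj : injective (@csub_val hK cK).
Proof. by move=> [x Kx] [y Ky] /= xy; subst y; congr CSub; apply: Prop_irrelevance. Qed.

HB.instance Definition _ := gen_eqMixin D.
HB.instance Definition _ := gen_choiceMixin D.

Definition csub0 : D := @CSub hK cK _ (subalg0 hK).
Definition csub_add (a b : D) : D := @CSub hK cK _ (subalgD hK (csub_prop a) (csub_prop b)).
Definition csub_opp (a : D) : D := @CSub hK cK _ (subalgN hK (csub_prop a)).
Definition csub_scale (k : C) (a : D) : D := @CSub hK cK _ (subalgZ hK k (csub_prop a)).
Definition csub_mul (a b : D) : D := @CSub hK cK _ (subalgM hK (csub_prop a) (csub_prop b)).
Definition csub_star (a : D) : D := @CSub hK cK _ (subalgS hK (csub_prop a)).

Fact csub_addA : associative csub_add.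
Proof. by move=> a b c; apply: csub_val_inj; apply: addrA. Qed.
Fact csub_addC : commutative csub_add.
Proof. by move=> a b; apply: csub_val_inj; apply: addrC. Qed.
Fact csub_add0 : left_id csub0 csub_add.
Proof. by move=> a; apply: csub_val_inj; apply: add0r. Qed.
Fact csub_addN : left_inverse csub0 csub_opp csub_add.
Proof. by move=> a; apply: csub_val_inj; apply: addNr. Qed.

HB.instance Definition _ :=
  GRing.isZmodule.Build D csub_addA csub_addC csub_add0 csub_addN.

Fact csub_scaleA k l a : csub_scale k (csub_scale l a) = csub_scale (k * l) a.
Proof. by apply: csub_val_inj; apply: scalerA. Qed.
Fact csub_scale1 : left_id 1 csub_scale.
Proof. by move=> a; apply: csub_val_inj; apply: scale1r. Qed.
Fact csub_scaleDr : right_distributive csub_scale +%R.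
Proof. by move=> k a b; apply: csub_val_inj; apply: scalerDr. Qed.
Fact csub_scaleDl a : {morph csub_scale^~ a : k l / k + l}.
Proof. by move=> k l; apply: csub_val_inj; apply: scalerDl. Qed.

HB.instance Definition _ := GRing.Zmodule_isLmodule.Build C D
  csub_scaleA csub_scale1 csub_scaleDr csub_scaleDl.

Definition csub_norm (a : D) : C := `|csub_val a|.

Fact csub_normD a b : csub_norm (a + b) <= csub_norm a + csub_norm b.
Proof. exact: ler_normD. Qed.
Fact csub_normZ (k : C) a : csub_norm (k *: a) = `|k| * csub_norm a.
Proof. exact: normrZ. Qed.
Fact csub_norm0 a : csub_norm a = 0 -> a = 0.
Proof. by move=> /normr0_eq0 a0; apply: csub_val_inj. Qed.

HB.instance Definition _ := Lmodule_isNormed.Build C D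
  csub_normD csub_normZ csub_norm0.

Fact csub_complete (F : set_system D) : ProperFilter F -> cauchy F -> cvg F.
Proof.
move=> FF Fc; pose G := @csub_val hK cK @ F.
have cG : cauchy G.
  apply/cauchy_ballP => e e0; move/cauchy_ballP: Fc => /(_ e e0)[[P Q] [/= FP FQ] PQ].
  exists (@csub_val hK cK @` P, @csub_val hK cK @` Q) => /=.
    by split; [apply: filterS FP|apply: filterS FQ] => x Px; exists x.
  move=> [_ _] [/= [x Px <-] [y Qy <-]]; have := PQ (x, y) (conj Px Qy).
  by rewrite -!ball_normE.
have /cvg_ex[l Gl] : cvg G by apply/cauchy_cvgP.
have Kl : K l.
  apply: cK => A /Gl GA; have [x Ax] : exists x : D, A (csub_val x) .
    exact: (@filter_ex _ F _ (@csub_val hK cK @^-1` A) GA).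
  by exists (csub_val x); split=> //; apply: csub_prop.
apply/cvg_ex; exists (@CSub hK cK _ Kl); apply/cvgrPdist_lt => e e0.
by move/cvgrPdist_lt : Gl => /(_ e e0).
Qed.

HB.instance Definition _ := Uniform_isComplete.Build D csub_complete.

Fact csub_mulA : associative csub_mul.
Proof. by move=> a b c; apply: csub_val_inj; apply: cmulA. Qed.
Fact csub_mulDl a b c : csub_mul (a + b) c = csub_mul a c + csub_mul b c.
Proof. by apply: csub_val_inj; apply: cmulDl. Qed.
Fact csub_mulDr a b c : csub_mul a (b + c) = csub_mul a b + csub_mul a c.
Proof. by apply: csub_val_inj; apply: cmulDr. Qed.
Fact csub_mulZl (k : C) a b : csub_mul (k *: a) b = k *: csub_mul a b.
Proof. by apply: csub_val_inj; apply: cmulZl. Qed.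
Fact csub_mulZr (k : C) a b : csub_mul a (k *: b) = k *: csub_mul a b.
Proof. by apply: csub_val_inj; apply: cmulZr. Qed.
Fact csub_starK : involutive csub_star.
Proof. by move=> a; apply: csub_val_inj; apply: cstarK. Qed.
Fact csub_starD : {morph csub_star : a b / a + b}.
Proof. by move=> a b; apply: csub_val_inj; apply: cstarD. Qed.
Fact csub_starZ (k : C) a : csub_star (k *: a) = k^*%R *: csub_star a.
Proof. by apply: csub_val_inj; apply: cstarZ. Qed.
Fact csub_starM a b : csub_star (csub_mul a b) = csub_mul (csub_star b) (csub_star a).
Proof. by apply: csub_val_inj; apply: cstarM. Qed.
Fact csub_normM a b : `|csub_mul a b| <= `|a| * `|b|.
Proof. exact: cnormM. Qed.
Fact csub_norm_star a : `|csub_mul (csub_star a) a| = `|a| ^+ 2.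
Proof. exact: cnorm_cstar. Qed.

HB.instance Definition _ := isCStarAlgebra.Build R D csub_mulA csub_mulDl
  csub_mulDr csub_mulZl csub_mulZr csub_starK csub_starD csub_starZ csub_starM
  csub_normM csub_norm_star.

Lemma csub_val_star_hom : star_hom (@csub_val hK cK).
Proof. by split. Qed.

Lemma csub_mulE (a b : D) : csub_val (a · b) = csub_val a · csub_val b.
Proof. by []. Qed.

Lemma csub_starE (a : D) : csub_val a^† = (csub_val a)^†.
Proof. by []. Qed.

End SubCStar.

Section ComplexCStar.
Variable R : realType.
Local Notation C := R[i].

(** The complex numbers have two uses as an algebra: their embedding in some stage yields a nonzero
    projection, and their completeness makes complex lines closed. *)
Definition ccstar : Type := C^o.

HB.instance Definition _ := NormedModule.on ccstar.

Lemma re_le_nrm (z : C) : `|complex.Re z| <= nrm z.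
Proof.
rewrite /nrm normc_def /= -sqrtr_sqr ler_wsqrtr// lerDl sqr_ge0//.
Qed.

Lemma im_le_nrm (z : C) : `|complex.Im z| <= nrm z.
Proof.
rewrite /nrm normc_def /= -[leLHS]sqrtr_sqr ler_wsqrtr// lerDr sqr_ge0//.
Qed.

Lemma nrm_le_reim (z : C) : nrm z <= `|complex.Re z| + `|complex.Im z|.
Proof.
have -> : z = (complex.Re z)%:C + 'i%C * (complex.Im z)%:C by rewrite -complexE.
rewrite (le_trans (nrmD _ _))// nrmM !nrm_real raddfD/=.
rewrite [nrm 'i%C]/nrm normc_def/= expr0n/= add0r expr1n sqrtr1.
by rewrite !(mul0r, mul1r, subr0, addr0, add0r, mulr0).
Qed.

Fact ccstar_complete (F : set_system ccstar) : ProperFilter F -> cauchy F -> cvg F.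
Proof.
move=> FF Fc.
have ReB (x y : C) : complex.Re (x - y) = complex.Re x - complex.Re y.
  by case: x; case: y.
have ImB (x y : C) : complex.Im (x - y) = complex.Im x - complex.Im y.
  by case: x; case: y.
have part (p : C -> R) : {morph p : x y / x - y} ->
    (forall z, `|p z| <= nrm z) -> exists l : R, (p @ F) --> l.
  move=> pB ple; suff /cvg_ex : cvg (p @ F) by [].
  apply/cauchy_cvgP/cauchy_ballP => e e0.
  have ec0 : 0 < (e%:C : C) by rewrite ltcR.
  move/cauchy_ballP: Fc => /(_ _ ec0)[[P Q] [/= FP FQ] PQ].
  exists (p @` P, p @` Q) => /=.
    by split; [apply: filterS FP|apply: filterS FQ] => x Px; exists x.
  move=> [_ _] [/= [x Px <-] [y Qy <-]]; have := PQ (x, y) (conj Px Qy).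
  rewrite -!ball_normE /= -pB => h.
  by rewrite (le_lt_trans (ple _))// -nrm_norm_lt.
have [r Fr] := part (@complex.Re R) ReB re_le_nrm.
have [s Fs] := part (@complex.Im R) ImB im_le_nrm.
apply/cvg_ex; exists (r +i* s); apply/cvgrPdist_lt => e /gt0_complex[d d0 ->].
have d2 : 0 < d / 2 by rewrite divr_gt0.
move/cvgrPdist_lt : Fr => /(_ _ d2) Fr; move/cvgrPdist_lt : Fs => /(_ _ d2) Fs.
near=> z; rewrite nrm_norm_lt (le_lt_trans (nrm_le_reim _))// [d]splitr.
rewrite ltrD// ?ReB ?ImB; by near: z.
Unshelve. all: by end_near. Qed.

HB.instance Definition _ := Uniform_isComplete.Build ccstar ccstar_complete.

Definition ccstar_mul (a b : ccstar) : ccstar := (a : C) * b.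
Definition ccstar_star (a : ccstar) : ccstar := (a : C)^*%R.

Fact ccstar_mulA : associative ccstar_mul.
Proof. exact: mulrA. Qed.
Fact ccstar_mulDl a b c : ccstar_mul (a + b) c = ccstar_mul a c + ccstar_mul b c.
Proof. exact: mulrDl. Qed.
Fact ccstar_mulDr a b c : ccstar_mul a (b + c) = ccstar_mul a b + ccstar_mul a c.
Proof. exact: mulrDr. Qed.
Fact ccstar_mulZl (k : C) a b : ccstar_mul (k *: a) b = k *: ccstar_mul a b.
Proof. exact: esym (mulrA _ _ _). Qed.
Fact ccstar_mulZr (k : C) a b : ccstar_mul a (k *: b) = k *: ccstar_mul a b.
Proof. exact: mulrCA. Qed.
Fact ccstar_starK : involutive ccstar_star.
Proof. exact: conjCK. Qed.
Fact ccstar_starD : {morph ccstar_star : a b / a + b}.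
Proof. exact: rmorphD. Qed.
Fact ccstar_starZ (k : C) a : ccstar_star (k *: a) = k^*%R *: ccstar_star a.
Proof. exact: rmorphM. Qed.
Fact ccstar_starM a b : ccstar_star (ccstar_mul a b) = ccstar_mul (ccstar_star b) (ccstar_star a).
Proof. by rewrite /ccstar_star rmorphM /ccstar_mul mulrC. Qed.
Fact ccstar_normM a b : `|ccstar_mul a b| <= `|a| * `|b|.
Proof. by rewrite normrM. Qed.
Fact ccstar_norm_star a : `|ccstar_mul (ccstar_star a) a| = `|a| ^+ 2.
Proof. by rewrite [LHS]normrM norm_conjC expr2. Qed.

HB.instance Definition _ := isCStarAlgebra.Build R ccstar ccstar_mulA ccstar_mulDl
  ccstar_mulDr ccstar_mulZl ccstar_mulZr ccstar_starK ccstar_starD ccstar_starZ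
  ccstar_starM ccstar_normM ccstar_norm_star.

Lemma ccstar_fd : finite_dimensional ccstar.
Proof.
exists 1%N, (fun=> 1 : ccstar) => a; exists (fun=> a : C).
by rewrite big_ord1 [RHS]mulr1.
Qed.

End ComplexCStar.

(** Roots of order 2^n absorb the constant [K]; this stands in for the spectral radius formula. *)
Lemma pow2_le (R : realType) (x y K : R) : 0 <= x -> 0 <= y ->
  (forall n, x ^+ (2 ^ n) <= K * y ^+ (2 ^ n)) -> x <= y.
Proof.
move=> x0 y0 h; rewrite leNgt; apply/negP => yx.
have {}x0 : 0 < x by exact: le_lt_trans yx.
have q0 : 0 <= y / x by rewrite divr_ge0// ltW.
have q1 : y / x < 1 by rewrite ltr_pdivrMr// mul1r.
have K0 : 0 < `|K| + 1 by rewrite ltr_wpDl.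
have [N hN] := geom_lt q0 q1 (e := (`|K| + 1)^-1) ltac:(by rewrite invr_gt0).
have := hN (2 ^ N)%N (ltnW (ltn_expl N (ltnSn 1))).
rewrite expr_div_n ltr_pdivrMr ?exprn_gt0// mulrC ltr_pdivlMr// => hlt.
have := lt_le_trans hlt (h N); rewrite mulrC ltNge => /negP; apply.
rewrite ler_wpM2r ?exprn_ge0// (le_trans (ler_norm _))// lerDl//.
Qed.

(** * Homomorphisms are contractive *)

Section Contractive.
Variable R : realType.
Local Notation C := R[i].

Lemma conj_real (k : R) : (k%:C : C)^*%R = k%:C.
Proof. by apply/CrealP/complex_realP; exists k. Qed.

Lemma nrm_nat n : nrm (n%:R : C) = n%:R.
Proof. by rewrite -(rmorph_nat (real_complex R)) nrm_real ger0_norm. Qed.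

Lemma nrm_i : nrm ('i%R : C) = 1.
Proof. by rewrite /nrm normCi. Qed.

(** The power of exponent 2^n by repeated squaring, because the C*-identity gives the norm of the
    square of a selfadjoint element. *)
Definition sqn (B : cstarType R) (n : nat) (a : B) : B := iter n (fun x => x · x) a.

Lemma sqn_sa (B : cstarType R) n (a : B) : a^† = a -> (sqn n a)^† = sqn n a.
Proof. by move=> sa; elim: n => //= n IH; rewrite cstarM IH. Qed.

Lemma nrm_sqn (B : cstarType R) n (a : B) : a^† = a ->
  nrm (sqn n a) = nrm a ^+ (2 ^ n).
Proof.
move=> sa; elim: n => [|n IH] /=; first by rewrite expn0 expr1.
by rewrite -{1}(sqn_sa n sa) nrm_cstar_mul IH -exprM expnSr.
Qed.

(* The solution [d] of d = (a² + d²)/2, i.e. 1 - d is a square root of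
   1 - a². *)
Lemma sqrt_fixpoint (B : cstarType R) (a : B) : a^† = a -> nrm a <= 1 / 2 ->
  exists d, [/\ d^† = d, d · a = a · d & d + d = a · a + d · d].
Proof.
move=> sa a2; pose h : C := 2^-1.
have nh : nrm h = 2^-1.
  by rewrite /h -(rmorph_nat (real_complex R) 2) -fmorphV nrm_real ger0_norm// invr_ge0.
have hc : h^*%R = h by rewrite /h fmorphV rmorph_nat.
pose d n := iter n (fun x => h *: (a · a + x · x)) (0 : B).
have dS n : d n.+1 = h *: (a · a + d n · d n) by [].
have na : nrm (a · a) <= 1 / 4.
  by rewrite (le_trans (nrm_cmul _ _))//; have := nrm_ge0 a; nra.
(* Since |a²| is at most 1/4, the map x ↦ (a² + x²)/2 preserves the ball of radius 1/4, and it is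
   Lipschitz there with constant 1/4; the ratio 1/2 is ample. *)
have dn n : nrm (d n) <= 1 / 4.
  elim: n => [|n IH]; first by rewrite nrm0; lra.
  rewrite /= nrmZ nh; have := nrmD (a · a) (d n · d n).
  by have := nrm_cmul (d n) (d n); have := nrm_ge0 (d n); nra.
have ds n : (d n)^† = d n.
  by elim: n => [|n IH]; rewrite /= ?cstar0// cstarZ hc cstarD !cstarM sa IH.
have dc n : d n · a = a · d n.
  elim: n => [|n IH]; first by rewrite cmul0r cmulr0.
  by rewrite /= cmulZl cmulZr cmulDl cmulDr -!cmulA IH !cmulA IH.
have [l dl] : exists l, tends d l.
  apply: (geom_tends (K := 1) (q := 1 / 2)); [lra|lra|elim=> [|n IH]].
    rewrite expr0 mulr1 (le_trans (nrmD _ _))// nrmN.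
    by have := dn 1%N; have := dn 0%N; lra.
  rewrite (dS n.+1) [X in _ - X]dS.
  rewrite -scalerBr opprD addrACA subrr add0r nrmZ nh.
  have -> : d n.+1 · d n.+1 - d n · d n =
            d n.+1 · (d n.+1 - d n) + (d n.+1 - d n) · d n.
    by rewrite cmulBr cmulBl addrA subrK.
  move: IH; rewrite !mul1r exprS.
  have := nrmD (d n.+1 · (d n.+1 - d n)) ((d n.+1 - d n) · d n).
  have := nrm_cmul (d n.+1) (d n.+1 - d n); have := nrm_cmul (d n.+1 - d n) (d n).
  have := dn n; have := dn n.+1; have := nrm_ge0 (d n.+1 - d n).
  have := nrm_ge0 (d n); have := nrm_ge0 (d n.+1).
  set t := (1 / 2 : R) ^+ n; nra.
exists l; split.
- apply: tends_unique (tends_cstar dl) _.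
  exact: (tends_eventually (N := 0) dl (fun n _ => ds n)).
- apply: tends_unique (tends_cmul dl (tends_cst a)) _.
  exact: (tends_eventually (N := 0) (tends_cmul (tends_cst a) dl) (fun n _ => dc n)).
- have lE : l = h *: (a · a + l · l).
    apply: tends_unique (tendsZ h (tendsD (tends_cst (a · a)) (tends_cmul dl dl))).
    exact: (tends_subseq (s := S) _ dl).
  by rewrite {1 2}lE -scalerDl /h -[2^-1]mul1r -splitr scale1r.
Qed.

(* For a small selfadjoint [b] the element w = d + i b satisfies w^* w = w + w^*, i.e. 1 - w
   is unitary, which bounds the norm of f(w) without using a unit or the spectrum. The
   constant 4 so obtained is removed by the identity |b^(2^n)| = |b|^(2^n). *)
Lemma star_hom_contractive (A B : cstarType R) (f : A -> B) (a : A) :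
  star_hom f -> nrm (f a) <= nrm a.
Proof.
move=> hf.
have bd b : b^† = b -> nrm b <= 1 / 2 -> nrm (f b) <= 2.
  move=> sb b2; have [d [ds dc dd]] := sqrt_fixpoint sb b2.
  pose w := d + ('i%R : C) *: b.
  have ws : w^† = d - ('i%R : C) *: b by rewrite cstarD cstarZ ds sb conjCi scaleNr.
  have ww : w^† · w = w + w^†.
    rewrite ws addrACA subrr addr0 dd cmulBl !cmulDr !cmulZl !cmulZr dc scalerA.
    by rewrite -expr2 sqrCi opprD addrA addrK scaleN1r opprK addrC.
  have fw2 : nrm (f w) ^+ 2 <= nrm (f w) + nrm (f w).
    rewrite -nrm_cstar_mul -(star_hom_star hf) -(star_hom_mul hf) ww.
    by rewrite star_homD// (le_trans (nrmD _ _))// (star_hom_star hf) nrm_cstar.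
  have fw : nrm (f w) <= 2 by have := nrm_ge0 (f w); nra.
  have : nrm (f (w - w^†)) <= 4.
    rewrite star_homB// (le_trans (nrmD _ _))// nrmN (star_hom_star hf) nrm_cstar.
    by lra.
  have -> : w - w^† = ('i%R : C) *: b + ('i%R : C) *: b.
    by rewrite ws opprB [_ - d]addrC addrACA subrr add0r.
  rewrite -scalerDl (star_homZ hf) nrmZ.
  have -> : nrm ('i%R + 'i%R : C) = 2.
    by rewrite -mulr2n -(mulr_natl ('i%R : C)) nrmM nrm_nat nrm_i mulr1.
  lra.
have bd4 b : b^† = b -> nrm (f b) <= 4 * nrm b.
  move=> sb; have [->|b0] := eqVneq b 0; first by rewrite star_hom0// !nrm0 mulr0.
  have nb : 0 < nrm b by apply: nrm_gt0; apply/eqP.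
  (* [b] is rescaled to norm 1/2, which turns the bound 2 into the factor 4. *)
  pose k := (2 * nrm b)^-1; have k0 : 0 < k by rewrite invr_gt0 mulr_gt0.
  have kb : k * (2 * nrm b) = 1 by rewrite mulVf// gt_eqF// mulr_gt0.
  have := bd (k%:C *: b); rewrite cstarZ conj_real sb star_homZ// !nrmZ nrm_real.
  by rewrite ger0_norm ?(ltW k0)// => /(_ erefl ltac:(lra)); nra.
have hs n b : f (sqn n b) = sqn n (f b).
  by elim: n => //= n IH; rewrite (star_hom_mul hf) IH.
have sa b : b^† = b -> nrm (f b) <= nrm b.
  move=> sb; have sfb : (f b)^† = f b by rewrite -(star_hom_star hf) sb.
  apply: (pow2_le (K := 4)) => [||n]; rewrite ?nrm_ge0//.
  by rewrite -!nrm_sqn// -hs bd4// sqn_sa.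
rewrite -(ler_pXn2r (n := 2)) ?nnegrE ?nrm_ge0// -!nrm_cstar_mul.
by rewrite -(star_hom_star hf) -(star_hom_mul hf) sa// cstarM cstarK.
Qed.

Lemma tends_star_hom (A B : cstarType R) (f : A -> B) (u : nat -> A) l :
  star_hom f -> tends u l -> tends (f \o u) (f l).
Proof.
move=> hf ul; apply: (tends_dom (K := 1) ul) => n /=.
by rewrite -star_homB// mul1r star_hom_contractive.
Qed.

End Contractive.

Lemma exists_left_kernel (F : fieldType) m n (M : 'M[F]_(m, n)) : (n < m)%N ->
  exists2 c : 'rV[F]_m, c != 0 & c *m M = 0.
Proof.
move=> nm; have /rowV0Pn[c cK c0] : kermx M != 0.
  rewrite -mxrank_eq0 mxrank_ker subn_eq0 -ltnNge.
  exact: leq_ltn_trans (rank_leq_col M) nm.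
by exists c => //; apply/sub_kermxP.
Qed.

(** * Finite-dimensional *-algebras *)

Section Spectral.
Variables (R : realType) (B : cstarType R).
Local Notation C := R[i].
Implicit Types (a b x y : B) (p q : {poly C}).

(** The spanning vectors need not lie in [E], so the property passes to subsets. *)
Definition fdset (E : set B) : Prop :=
  exists (n : nat) (e : 'I_n -> B),
    forall a, E a -> exists k : 'I_n -> C, a = \sum_(i < n) k i *: e i.

Lemma fdset_dep (E : set B) : fdset E -> exists N, forall m (v : 'I_m -> B),
  (N < m)%N -> (forall i, E (v i)) ->
  exists2 c : 'I_m -> C, (exists i, c i != 0) & \sum_i c i *: v i = 0.
Proof.
move=> [N [e he]]; exists N => m v Nm Ev.
have /choice[k hk] i : exists k : 'I_N -> C, v i = \sum_j k j *: e j := he _ (Ev i).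
have [c c0 cM] := exists_left_kernel (\matrix_(i, j) k i j) Nm.
exists (c 0); first by apply/existsP; apply: contraNT c0 => /existsPn h;
  apply/eqP/rowP => j; rewrite mxE; apply/eqP; have := h j; rewrite negbK.
under eq_bigr do rewrite hk scaler_sumr.
rewrite exchange_big /= big1// => j _.
under eq_bigr do rewrite scalerA.
rewrite -scaler_suml; have /matrixP/(_ 0 j) := cM; rewrite !mxE.
by under eq_bigr do rewrite mxE; move=> ->; rewrite scale0r.
Qed.

(* p(a) x, for polynomials without reference to a unit of the algebra *)
Definition pact a p x : B := \sum_(i < size p) p`_i *: iter i (cmul a) x.

Lemma pactE a p x n : (size p <= n)%N ->
  pact a p x = \sum_(i < n) p`_i *: iter i (cmul a) x.
Proof.
move=> pn; rewrite /pact (big_ord_widen n (fun i => p`_i *: iter i (cmul a) x))//.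
rewrite big_mkcond; apply: eq_bigr => i _; case: ifPn => //.
by rewrite -leqNgt => /(nth_default 0) ->; rewrite scale0r.
Qed.

Lemma pactD a p q x : pact a (p + q) x = pact a p x + pact a q x.
Proof.
set n := maxn (size p) (size q).
rewrite (@pactE _ _ _ n) ?size_polyD// (@pactE _ p _ n) ?leq_maxl//.
rewrite (@pactE _ q _ n) ?leq_maxr// -big_split /=; apply: eq_bigr => i _.
by rewrite coefD scalerDl.
Qed.

Lemma pactZ a (k : C) p x : pact a (k *: p) x = k *: pact a p x.
Proof.
rewrite (@pactE _ _ _ (size p)) ?size_scale_leq// scaler_sumr.
by apply: eq_bigr => i _; rewrite coefZ scalerA.
Qed.

Lemma pact_sum a (I : finType) (P : I -> {poly C}) x :
  pact a (\sum_i P i) x = \sum_i pact a (P i) x.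
Proof.
elim/big_rec2: _ => [|i y q _ <-]; first by rewrite /pact size_poly0 big_ord0.
by rewrite pactD.
Qed.

Lemma pact1 a x : pact a 1 x = x.
Proof. by rewrite /pact size_poly1 big_ord1 coef1 /= scale1r. Qed.

Lemma pactXsubC a (l : C) p x :
  pact a (('X - l%:P) * p) x = a · pact a p x - l *: pact a p x.
Proof.
rewrite mulrBl pactD mul_polyC -scaleNr pactZ scaleNr; congr (_ - _).
rewrite (@pactE _ _ _ (size p).+1); last first.
  by rewrite (leq_trans (size_polyMleq _ _))// size_polyX.
rewrite big_ord_recl coefXM /= scale0r add0r /pact cmul_sumr.
by apply: eq_bigr => i _; rewrite coefXM /= cmulZr.
Qed.

Lemma pact_sub (E : set B) a p x : star_subalg E -> E a -> E x -> E (pact a p x).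
Proof.
move=> hE Ea Ex; apply: (subalg_sum hE) => i _; apply: (subalgZ hE).
by elim: (nat_of_ord i) => //= n; apply: (subalgM hE).
Qed.

Lemma pact_eigen a (z : B) (l : C) p : z · a = l *: z ->
  z · pact a p a = (l * p.[l]) *: z.
Proof.
move=> za; rewrite /pact cmul_sumr horner_coef mulr_sumr scaler_suml.
apply: eq_bigr => i _; rewrite cmulZr.
suff -> : z · iter i (cmul a) a = (l ^+ i.+1) *: z.
  by rewrite scalerA exprS mulrCA.
elim: (nat_of_ord i) => [|n IH] /=; first by rewrite za expr1.
by rewrite cmulA za cmulZl IH scalerA -exprS.
Qed.

(** Take [m] of least degree with m(a) a = 0; letting polynomials act on [a] avoids a unit. As [a]
    is selfadjoint, the roots of [m] are real and simple. The Lagrange polynomials at these roots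
    sum to 1, so [a] is the sum of the eigenvectors L_i(a) a, and dividing each by its root gives a
    projection. *)
Lemma spectral_decomposition (E : set B) a :
  star_subalg E -> fdset E -> E a -> a^† = a ->
  exists n (l : 'I_n -> R) (e : 'I_n -> B),
    [/\ forall i, [/\ E (e i), is_proj (e i), e i <> 0 & l i != 0],
        forall i j, i != j -> e i · e j = 0 &
        a = \sum_i (l i)%:C *: e i].
Proof.
move=> hE fE Ea sa.
have [->|a0] := eqVneq a 0.
  exists 0%N, (fun=> 0), (fun=> 0); split=> [[]|[]|] //.
  by rewrite big_ord0.
have [N hN] := fdset_dep fE.
have ann : exists p, p != 0 /\ pact a p a = 0.
  have [|c [i ci] c0] := hN N.+1 (fun i => iter i (cmul a) a) (ltnSn _).
    by move=> i; elim: (nat_of_ord i) => //= n; apply: (subalgM hE).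
  pose p : {poly C} := \poly_(j < N.+1) (if insub j is Some k then c k else 0).
  have pc (k : 'I_N.+1) : p`_k = c k by rewrite coef_poly ltn_ord valK.
  exists p; split; first by apply: contraNneq ci => p0; rewrite -pc p0 coef0.
  rewrite (@pactE _ _ _ N.+1) ?size_poly// -[RHS]c0.
  by apply: eq_bigr => k _; rewrite pc.
have [m [m0 ma mmin]] : exists m, [/\ m != 0, pact a m a = 0 &
    forall p, p != 0 -> (size p < size m)%N -> pact a p a <> 0].
  have /ex_minnP[s] : exists s, `[< exists p, [/\ size p = s, p != 0 & pact a p a = 0] >].
    by have [p [p0 pa]] := ann; exists (size p); apply/asboolP; exists p.
  move=> /asboolP[m [<- m0 ma]] smin; exists m; split=> // p p0 pm pa.
  have := smin (size p); rewrite leqNgt pm => /implyP; rewrite implybF => /negP; apply.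
  by apply/asboolP; exists p.
have fac l g : m = ('X - l%:P) * g -> g != 0 /\ (size g < size m)%N.
  move=> mE; have g0 : g != 0 by apply: contraNneq m0 => g0; rewrite mE g0 mulr0.
  by split=> //; rewrite mE size_mul ?polyXsubC_eq0// size_XsubC.
(* [b] is nonzero because [m] has least degree. Evaluating b† a b on both sides shows that the root
   [l] is real. *)
have eig l g : m = ('X - l%:P) * g ->
    [/\ pact a g a <> 0, a · pact a g a = l *: pact a g a & l^*%R = l].
  move=> mE; have [g0 gm] := fac _ _ mE; set b := pact a g a.
  have b0 : b <> 0 by exact: mmin.
  have ab : a · b = l *: b by apply/subr0_eq; rewrite -pactXsubC -mE.
  split=> //; apply/subr0_eq/eqP/negPn/negP => ll.
  apply: b0; apply: cstar_mul_eq0; apply: (scalerI ll).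
  rewrite scaler0 scalerBl -!cmulZl -cstarZ -ab cstarM sa cmulZl -cmulZr -ab.
  by rewrite cmulA subrr.
(* A double root would give b = (a - l) y, hence b† b = y† (a - l) b = 0. *)
have nodup l g : m = ('X - l%:P) * g -> ~~ root g l.
  move=> mE; apply/factor_theorem => -[h gE].
  have [b0 ab lr] := eig _ _ mE; apply: b0; apply: cstar_mul_eq0.
  rewrite {1}gE mulrC pactXsubC cstarB cstarM cstarZ lr sa cmulBl cmulZl.
  by rewrite -cmulA ab cmulZr subrr.
have [rs mrs] := closed_field_poly_normal m.
have lm0 : lead_coef m != 0 by rewrite lead_coef_eq0.
have urs : uniq rs.
  apply: count_mem_uniq => l; have [lr|lr] := boolP (l \in rs); last first.
    by apply/eqP; rewrite -leqn0 leqNgt -has_count has_pred1.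
  have /permP -> := perm_to_rem lr; rewrite /= eqxx.
  suff lnr : l \notin rem l rs.
    by congr (_.+1); apply/eqP; rewrite -leqn0 leqNgt -has_count has_pred1.
  have := nodup l (lead_coef m *: \prod_(z <- rem l rs) ('X - z%:P)).
  have -> : ('X - l%:P) * (lead_coef m *: \prod_(z <- rem l rs) ('X - z%:P)) = m.
    by rewrite -scalerAr [in RHS]mrs (big_rem _ lr).
  move=> /(_ erefl).
  by rewrite rootZ// root_prod_XsubC.
pose n := size rs; pose z (i : 'I_n) := rs`_i.
have z_inj i j : (z i == z j) = (i == j) by rewrite nth_uniq.
have mz : m = lead_coef m *: \prod_i ('X - (z i)%:P).
  by rewrite {1}mrs (big_nth 0) big_mkord.
pose k i := \prod_(j | j != i) (z i - z j).
have k0 i : k i != 0.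
  by apply/prodf_neq0 => j ji; rewrite subr_eq0 z_inj eq_sym.
(* Lagrange interpolation polynomials at the roots of [m]. *)
pose L i := (k i)^-1 *: \prod_(j | j != i) ('X - (z j)%:P).
have Lz i j : (L i).[z j] = (i == j)%:R.
  rewrite hornerZ horner_prod; have [<-|ij] := eqVneq i j.
    by under eq_bigr do rewrite hornerXsubC; rewrite mulVf.
  by rewrite (bigD1 j) 1?eq_sym//= hornerXsubC subrr mul0r mulr0.
have L0 i : L i != 0.
  by apply/eqP => /(congr1 (horner^~ (z i))); rewrite Lz eqxx horner0 => /eqP; rewrite oner_eq0.
have mL i : m = ('X - (z i)%:P) * (lead_coef m * k i *: L i).
  by rewrite /L -!scalerAr scalerA mulfK// -(bigD1 (P := predT) i)//= -mz.
have sz i : (size (L i) < size m)%N.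
  have [_] := fac _ _ (mL i); rewrite size_scale// mulf_neq0//.
pose y i := pact a (L i) a.
have y0 i : y i <> 0 by exact: mmin.
have lk i : lead_coef m * k i != 0 by rewrite mulf_neq0.
have ay i : a · y i = z i *: y i.
  have [_ + _] := eig _ _ (mL i); rewrite pactZ cmulZr => h.
  by apply: (scalerI (lk i)); rewrite h !scalerA [z i * _]mulrC.
have zr i : (z i)^*%R = z i by have [] := eig _ _ (mL i).
have sumL : \sum_i L i = 1.
  apply/subr0_eq/(@roots_geq_poly_eq0 _ _ rs) => //.
    apply/allP => _ /(nthP 0)[j jn <-]; apply/rootP.
    rewrite !hornerE horner_sum (bigD1 (Ordinal jn))//= (Lz _ (Ordinal jn)) eqxx.
    rewrite big1 ?addr0 ?subrr// => i ij.
    by rewrite (Lz _ (Ordinal jn)) (negbTE ij).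
  have szm : size m = n.+1 by rewrite mz size_scale// size_prod_XsubC /index_enum -enumT size_enum_ord.
  (* Without roots [m] is a constant, and m(a) a = 0 would force a = 0. *)
  case: (posnP n) => [n0|n0].
    have mE : m = lead_coef m *: 1 by rewrite {1}mrs (size0nil n0) big_nil.
    by have /eqP := ma; rewrite mE pactZ pact1 scaler_eq0 (negbTE lm0) (negbTE a0).
  rewrite (leq_trans (size_polyD _ _))// geq_max size_polyN size_poly1 n0 andbT.
  apply: (big_ind (fun p => (size p <= n)%N)) => [|p q pn qn|i _].
  - by rewrite size_poly0.
  - by rewrite (leq_trans (size_polyD _ _))// geq_max pn.
  - by rewrite -ltnS -szm.
have ya : a = \sum_i y i by rewrite -pact_sum sumL pact1.
have yy i j : (y i)^† · y j = (z i * (i == j)%:R) *: (y i)^†.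
  have ia : (y i)^† · a = z i *: (y i)^†.
    by rewrite -{1}sa -cstarM ay cstarZ zr.
  by rewrite (pact_eigen _ ia) Lz eq_sym.
have z0 i : z i != 0.
  apply/eqP => zi; apply: (y0 i); apply: cstar_mul_eq0.
  by rewrite yy zi mul0r scale0r.
(* After this scaling e_i† e_i = e_i†; the left side is selfadjoint, so [e i] is a projection. *)
pose e i := (z i)^-1 *: y i.
have ee i j : (e i)^† · e j = (i == j)%:R *: (e i)^†.
  rewrite /e cstarZ cmulZl cmulZr yy !scalerA fmorphV/= zr; congr (_ *: _).
  have [<-|_] := eqVneq i j; last by rewrite !mulr0 mul0r.
  by rewrite mulr1 mul1r divfK.
have es i : (e i)^† = e i.
  have := ee i i; rewrite eqxx scale1r => h.
  by rewrite -[RHS]cstarK -{2}h cstarM cstarK h.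
have rz i : ((complex.Re (z i))%:C = z i).
  by rewrite RRe_real//; apply/CrealP.
exists n, (fun i => complex.Re (z i)), e; split=> [i|i j ij|].
- split.
  + by apply: (subalgZ hE); apply: pact_sub.
  + by split=> //; rewrite -{1}es ee eqxx scale1r es.
  + move=> /(congr1 ( *:%R (z i))); rewrite /e scalerA divff// scale1r scaler0.
    exact: y0.
  + by apply: contraNneq (z0 i) => h; rewrite -rz h.
- by rewrite -(es i) ee (negbTE ij) scale0r.
- by rewrite {1}ya; apply: eq_bigr => i _; rewrite rz /e scalerA divff// scale1r.
Qed.
End Spectral.

(** * Maximal orthogonal families of projections *)

Section Structure.
Variables (R : realType) (B : cstarType R).
Local Notation C := R[i].
Implicit Types (E : set B) (x y z q : B).

Definition orthfam E (I : finType) (p : I -> B) : Prop :=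
  (forall i, [/\ E (p i), is_proj (p i) & p i <> 0]) /\
  (forall i j, i != j -> p i · p j = 0).

(** Minimality of [p i] is expressed by a one-dimensional corner; the sum of the [p i] is a unit for
    [E], not for [B]. *)
Record minfam E (I : finType) (p : I -> B) : Prop := MinFam {
  mf_in : forall i, E (p i);
  mf_proj : forall i, is_proj (p i);
  mf_neq0 : forall i, p i <> 0;
  mf_orth : forall i j, i != j -> p i · p j = 0;
  mf_corner : forall i x, E x -> exists k : C, p i · x · p i = k *: p i;
  mf_unit : forall x, E x -> (\sum_i p i) · x = x;
}.

(** Nonzero orthogonal projections are linearly independent: multiplying a relation by one of them
    isolates its coefficient. *)
Lemma orthfam_bound E : fdset E ->
  exists N, forall (I : finType) (p : I -> B), orthfam E p -> (#|I| <= N)%N.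
Proof.
move=> /fdset_dep[N hN]; exists N => I p [pE po]; rewrite leqNgt; apply/negP => NI.
have [i|c [i /eqP ci] c0] := hN _ (fun i : 'I_#|I| => p (enum_val i)) NI.
  by have [] := pE (enum_val i).
have := congr1 (cmul (p (enum_val i))) c0; rewrite cmulr0 cmul_sumr (bigD1 i)//=.
have [_ [pp _] /eqP p0] := pE (enum_val i).
rewrite cmulZr pp big1 ?addr0 => [/eqP|j ji].
  by rewrite scaler_eq0 (negbTE p0) orbF => /eqP.
by rewrite cmulZr po ?scaler0// (inj_eq enum_val_inj) eq_sym.
Qed.

Lemma orthfam_option E (I : finType) (p : I -> B) q :
  orthfam E p -> E q -> is_proj q -> q <> 0 -> (forall i, q · p i = 0) ->
  orthfam E (fun o : option I => oapp p q o).
Proof.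
move=> [pE po] Eq qq q0 qp; split=> [[i|]|[i|] [j|]] //= ij.
- by apply: po; apply: contraNneq ij => ->.
- by apply: proj_orthC => //; have [] := pE i.
Qed.

(** The equation [q = k *: (a · q)] makes every projection that fixes [a] fix [q] as well, and
    transfers annihilation of [a] to [q]. *)
Lemma spectral_proj E a : star_subalg E -> fdset E -> E a -> a^† = a -> a <> 0 ->
  exists q (k : C), [/\ E q, is_proj q, q <> 0, q = k *: (a · q) & a · q = q · a].
Proof.
move=> hE fE Ea sa a0; have [[|n] [l [e [le oe aE]]]] := spectral_decomposition hE fE Ea sa.
  by case: a0; rewrite aE big_ord0.
have [Ee ep e0 l0] := le ord0.
have ae : a · e ord0 = (l ord0)%:C *: e ord0.
  rewrite aE cmul_suml (bigD1 ord0)//= cmulZl ep.1 big1 ?addr0// => i i0.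
  by rewrite cmulZl oe// scaler0.
exists (e ord0), ((l ord0)%:C)^-1; split=> //.
  by rewrite ae scalerA mulVf ?scale1r// (inj_eq (@complexI R)).
rewrite ae; apply: cstar_inj; rewrite cstarM sa ep.2 ae cstarZ conj_real ep.2//.
Qed.

(** Splits x as ((x + x†) - i · i(x - x†))/2, a combination of two selfadjoint elements. *)
Lemma scale_corner E p : star_subalg E -> E p -> is_proj p ->
  (forall a, E a -> a^† = a -> exists k : C, p · a · p = k *: p) ->
  forall x, E x -> exists k : C, p · x · p = k *: p.
Proof.
move=> hE Ep pp sa x Ex; pose h : C := 2^-1.
have [k hk] := sa (x + x^†) (subalgD hE Ex (subalgS hE Ex))
  ltac:(by rewrite cstarD cstarK addrC).
have [l hl] := sa ('i%R *: (x - x^†)) (subalgZ hE _ (subalgB hE Ex (subalgS hE Ex)))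
  ltac:(by rewrite cstarZ cstarB cstarK conjCi scaleNr -scalerN opprB).
exists (h * (k - 'i%R * l)).
rewrite -scalerA scalerBl -scalerA -hk -hl cmulZr cmulZl scalerA -expr2 sqrCi scaleN1r.
rewrite opprK -cmulDl -cmulDr addrACA subrr addr0 cmulDr cmulDl -mulr2n -scaler_nat.
by rewrite scalerA mulVf ?scale1r// pnatr_eq0.
Qed.

(** An orthogonal family of maximal cardinality works. If the corner of [p i] were not scalar, a
    spectral projection [q] of one of its selfadjoint elements would split [p i] into [q] and
    [p i - q]. If the sum [u] were not a unit, a spectral projection of y y† with y = x - u x would
    be orthogonal to the whole family. *)
Lemma fd_minfam E : star_subalg E -> fdset E ->
  exists (I : finType) (p : I -> B), minfam E p.
Proof.
move=> hE fE; have [N hN] := orthfam_bound fE.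
pose Q m := `[< exists (I : finType) (p : I -> B), orthfam E p /\ #|I| = m >].
have Q0 : exists m, Q m.
  exists 0%N; apply/asboolP; exists 'I_0, (fun=> 0); split; last exact: card_ord.
  by split=> -[].
have Qb m : Q m -> (m <= N)%N by move=> /asboolP[I [p [/hN + <-]]].
case: (ex_maxnP Q0 Qb) => m /asboolP[I [p [fp Im]]] mmax.
have noext (p' : I -> B) q : orthfam E p' -> E q -> is_proj q -> q <> 0 ->
    ~ (forall i, q · p' i = 0).
  move=> fp' Eq qq q0 qp.
  have /mmax : Q m.+1.
    apply/asboolP; exists (option I), (fun o : option I => oapp p' q o).
    by split; [exact: orthfam_option|rewrite card_option Im].
  by rewrite ltnn.
have [pE po] := fp.
exists I, p; split=> [i|i|i|//|i|x Ex]; first by have [] := pE i.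
- by have [] := pE i.
- by have [] := pE i.
- have [Ep pp p0] := pE i; apply: (scale_corner hE) => // b Eb sb.
  pose a := p i · b · p i.
  have pa : p i · a = a by rewrite /a !cmulA pp.1.
  have ap : a · p i = a by rewrite /a -!cmulA pp.1.
  have Ea : E a by do 2?[apply: (subalgM hE) => //].
  have sa : a^† = a by rewrite /a !cstarM sb pp.2 cmulA.
  have [a0|/eqP a0] := eqVneq a 0; first by exists 0; rewrite scale0r.
  have [q [k [Eq qq q0 qE qa]]] := spectral_proj hE fE Ea sa a0.
  have pq : p i · q = q by rewrite qE cmulZr cmulA pa.
  have qp : q · p i = q by rewrite qE qa cmulZl -cmulA ap.
  suff qpi : q = p i.
    have k0 : k != 0.
      by apply/eqP => k0; apply: q0; rewrite qE k0 scale0r.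
    exists k^-1; rewrite -/a; move: qE; rewrite qpi ap => ->.
    by rewrite scalerA mulVf ?scale1r.
  apply/eqP/negPn/negP => /eqP qpi.
  pose p' j := if j == i then p i - q else p j.
  apply: (noext p' q) => //; last first.
    move=> j; rewrite /p'; case: eqVneq => [_|ji]; first by rewrite cmulBr qp qq.1 subrr.
    by rewrite -qp -cmulA po ?cmulr0// eq_sym.
  have d0 : p i - q <> 0 by move=> /subr0_eq /esym.
  split=> [j|j j'].
    rewrite /p'; case: eqVneq => [_|_]; last exact: pE.
    split=> //; first exact: (subalgB hE).
    split; last by rewrite cstarB pp.2 qq.2.
    by rewrite cmulBl !cmulBr pp.1 pq qp qq.1 subrr subr0.
  rewrite /p'; case: (eqVneq j i) => [->|ji]; case: (eqVneq j' i) => [_|ji'] //.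
  + by rewrite cmulBl -qp -cmulA !po ?cmulr0 ?subr0// eq_sym.
  + by rewrite cmulBr -pq cmulA !po ?cmul0r ?subr0.
  + exact: po.
- pose u := \sum_i p i; rewrite -/u.
  have uu : is_proj u by apply: is_proj_sum => [i _|i j _ _]; [have [] := pE i|exact: po].
  have Eu : E u by apply: (subalg_sum hE) => i _; have [] := pE i.
  pose y := x - u · x; have Ey : E y by apply: (subalgB hE) => //; apply: (subalgM hE).
  suff y0 : y = 0 by apply/esym/subr0_eq.
  apply: mul_cstar_eq0; set a := y · y^†.
  apply/eqP/negPn/negP => /eqP a0.
  have [] := @spectral_proj E a => //; first by apply: (subalgM hE) => //; apply: (subalgS hE).
    by rewrite cstarM cstarK.
  move=> q [k [Eq qq q0 qE qa]].
  have uy : u · y = 0 by rewrite /y cmulBr cmulA uu.1 subrr.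
  have uq : u · q = 0 by rewrite qE cmulZr /a !cmulA uy !cmul0r scaler0.
  apply: (noext p q) => // i; rewrite -[p i](_ : u · p i = _).
    by rewrite cmulA (proj_orthC uu) ?cmul0r.
  rewrite /u cmul_suml (bigD1 i)//= big1 ?addr0; first by have [_ [-> _]] := pE i.
  by move=> j ji; apply: po.
Qed.

End Structure.
Arguments mf_neq0 {R B E I p} _ i _.

(** * Comparison of minimal projections *)

Section Frames.
Variables (R : realType) (B : cstarType R).
Local Notation C := R[i].
Implicit Types (E : set B) (x y z q : B).

(* A decomposition of the projection [q] into pieces s_j s_j^* equivalent to the
   projections P (cl j). *)
Record frame E (Y : finType) (P : Y -> B) (J : finType) (cl : J -> Y) (s : J -> B)
    q : Prop := Frame {
  frame_in : forall j, E (s j);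
  frame_orth : forall i j, (s i)^† · s j = if i == j then P (cl j) else 0;
  frame_sum : q = \sum_j s j · (s j)^†;
}.

(* One minimal projection for each simple summand of the finite-dimensional algebra
   [E]; this replaces the structure theorem as a direct sum of matrix algebras. *)
Record bsys E (r : nat) (P : 'I_r -> B) : Prop := BSys {
  bs_sub : star_subalg E;
  bs_in : forall y : 'I_r, E (P y);
  bs_proj : forall y : 'I_r, is_proj (P y);
  bs_neq0 : forall y : 'I_r, P y <> 0;
  bs_corner : forall (y : 'I_r) x, E x -> exists k : C, P y · x · P y = k *: P y;
  bs_off : forall (y z : 'I_r) x, y != z -> E x -> P y · x · P z = 0;
  bs_frame : forall q, E q -> is_proj q ->
    exists n (cl : 'I_n -> 'I_r) (s : 'I_n -> B), frame E P cl s q;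
}.

Arguments bs_neq0 {E r P} _ y _.

Lemma scaleC_inj (k l : C) x : x <> 0 -> k *: x = l *: x -> k = l.
Proof.
move=> x0 kl; apply/subr0_eq/eqP.
have /eqP : (k - l) *: x = 0 by rewrite scalerBl kl subrr.
by rewrite scaler_eq0 => /orP[//|/eqP/x0].
Qed.

Section MinFam.
Variables (E : set B) (I : finType) (p : I -> B).
Hypotheses (hE : star_subalg E) (mp : minfam E p).

Lemma mf_unitr x : E x -> x · (\sum_i p i) = x.
Proof.
move=> Ex; apply: cstar_inj; rewrite cstarM cstar_sum.
under eq_bigr do rewrite (mf_proj mp _).2.
by rewrite (mf_unit mp)//; apply: (subalgS hE).
Qed.

(** This is positivity of z† z, obtained from the C*-identity. The corner makes z† z a real multiple
    r of [p i] with |r| = |z|². For i = j, [z] is a multiple of [p i] and r is a square modulus. For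
    i ≠ j and r < 0, y = z/|z| would give a selfadjoint w = y + y† with w² = -(p i + p j), which is
    impossible. *)
Lemma mf_piece i j x : E x ->
  let z := p j · x · p i in z^† · z = ((nrm z ^+ 2)%:C) *: p i.
Proof.
move=> Ex z; have [pi si] := mf_proj mp i; have [pj sj] := mf_proj mp j.
have zs : z^† = p i · x^† · p j by rewrite /z !cstarM si sj cmulA.
have [k zz] : exists k : C, z^† · z = k *: p i.
  have [k hk] := mf_corner mp i (subalgM hE (subalgM hE (subalgS hE Ex)
    (mf_in mp j)) Ex).
  exists k; rewrite -hk zs /z !cmulA.
  by rewrite -(cmulA (p i · x^†) (p j) (p j)) pj.
have kr : k^*%R = k.
  apply: (scaleC_inj (mf_neq0 mp i)).
  by rewrite -{1}si -cstarZ -zz cstarM cstarK.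
have [r kE] : exists r : R, k = r%:C by apply/complex_realP/CrealP.
have nr : `|r| = nrm z ^+ 2.
  rewrite -nrm_cstar_mul zz nrmZ kE nrm_real (nrm_proj (mf_proj mp i)) ?mulr1//.
  exact: (mf_neq0 mp).
rewrite zz kE; have [r0|r0] := leP 0 r; first by rewrite -nr ger0_norm.
have z0 : 0 < nrm z.
  rewrite lt_neqAle nrm_ge0 andbT eq_sym; apply/eqP => z0.
  by move: nr; rewrite z0 expr0n => /normr0_eq0 r0'; rewrite r0' ltxx in r0.
have [ij|ij] := eqVneq j i.
  have [m zE] : exists m : C, z = m *: p i.
    by rewrite /z ij; apply: (mf_corner mp).
  suff : 0 <= k by rewrite kE ler0c leNgt r0.
  have -> : k = m^*%R * m.
    apply: (scaleC_inj (mf_neq0 mp i)); rewrite -zz zE cstarZ cmulZl cmulZr si pi.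
    by rewrite scalerA.
  by rewrite mulrC mul_conjC_ge0.
exfalso.
pose y := ((nrm z)^-1)%:C *: z.
have ys : y^† = ((nrm z)^-1)%:C *: z^† by rewrite cstarZ conj_real.
have yy : y^† · y = - p i.
  rewrite ys cmulZl cmulZr zz kE !scalerA -!rmorphM/= -scaleN1r; congr (_ *: _).
  rewrite -(rmorph1 (real_complex R)) -rmorphN/=; congr (_%:C).
  rewrite -[r]opprK -(ltr0_norm r0) nr; field; exact: lt0r_neq0.
have zp : z · p i = z by rewrite /z -cmulA pi.
have pz : p j · z = z by rewrite /z !cmulA pj.
have yp : y · p i = y by rewrite /y cmulZl zp.
have py : p j · y = y by rewrite /y cmulZr pz.
have pij : p i · p j = 0 by apply: (mf_orth mp); rewrite eq_sym.
have pji : p j · p i = 0 by apply: (mf_orth mp).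
have y2 : y · y = 0 by rewrite -{1}yp -cmulA -{2}py (cmulA (p i)) pij cmul0r cmulr0.
have yys : y · y^† = - p j.
  have [m hm] : exists m : C, y · y^† = m *: p j.
    have [m hm] := mf_corner mp j (subalgM hE (subalgM hE Ex (mf_in mp i)) (subalgS hE Ex)).
    exists (((nrm z)^-1)%:C * ((nrm z)^-1)%:C * m).
    rewrite ys /y cmulZl cmulZr scalerA -[RHS]scalerA -hm zs /z !cmulA.
    by rewrite -(cmulA (p j · x) (p i) (p i)) pi.
  have y0 : y <> 0.
    by move=> y0; apply: (mf_neq0 mp i); apply: oppr_inj; rewrite -yy y0 cmulr0 oppr0.
  have : (y · y^†) · y = - y by rewrite -cmulA yy cmulrN yp.
  rewrite hm cmulZl py -scaleN1r => /(scaleC_inj y0) ->.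
  by rewrite scaleN1r.
pose g := p i + p j; pose w := y + y^†.
have gg : g · g = g by rewrite cmulDl !cmulDr pi pj pij pji addr0 add0r.
have gs : g^† = g by rewrite cstarD si sj.
have ws : w^† = w by rewrite cstarD cstarK addrC.
have piy : p i · y = 0 by rewrite -py cmulA pij cmul0r.
have ypj : y · p j = 0 by rewrite -yp -cmulA pij cmulr0.
have gw : g · w = w.
  have piys : p i · y^† = y^† by rewrite -{1}si -cstarM yp.
  have pjys : p j · y^† = 0 by rewrite -{1}sj -cstarM ypj cstar0.
  by rewrite cmulDl !cmulDr piy py piys pjys add0r addr0 addrC.
have wg : w · g = w by apply: cstar_inj; rewrite cstarM gs ws gw.
have ww : w · w = - g.
  rewrite cmulDl !cmulDr y2 yy yys add0r -cstarM y2 cstar0 addr0 -opprD addrC//.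
have h : (g - 'i%R *: w)^† = g + 'i%R *: w.
  by rewrite cstarB cstarZ gs ws conjCi scaleNr opprK.
(* (g - iw)†(g - iw) = g + w² = 0, so g = iw is at once selfadjoint and antiselfadjoint. *)
have gi : g = 'i%R *: w.
  apply/subr0_eq/cstar_mul_eq0; rewrite h cmulDl !cmulBr cmulZl !cmulZr cmulZl.
  by rewrite gg gw wg ww scalerA -expr2 sqrCi scaleN1r opprK addrA subrK subrr.
have : g = - g.
  by rewrite -{1}gs gi cstarZ ws conjCi scaleNr.
move/eqP; rewrite -subr_eq0 opprK -mulr2n -scaler_nat scaler_eq0 pnatr_eq0 /=.
move=> /eqP g0; apply: (mf_neq0 mp i).
by have : g · p i = p i; [rewrite cmulDl pi pji addr0|rewrite g0 cmul0r].
Qed.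

(** Inserting the unit [\sum_j p j] between x† and x writes the corner as a sum of pieces covered by
    [mf_piece]. *)
Lemma mf_diag_pos i x : E x ->
  exists2 t : R, 0 <= t & p i · x^† · x · p i = t%:C *: p i.
Proof.
move=> Ex; exists (\sum_j nrm (p j · x · p i) ^+ 2).
  by apply: sumr_ge0 => j _; rewrite sqr_ge0.
rewrite rmorph_sum/= scaler_suml.
have -> : p i · x^† · x = p i · x^† · ((\sum_j p j) · x) by rewrite (mf_unit mp Ex).
rewrite cmul_suml cmul_sumr cmul_suml; apply: eq_bigr => j _.
rewrite -mf_piece// !cstarM (mf_proj mp i).2 (mf_proj mp j).2 !cmulA.
by rewrite -(cmulA (p i · x^†) (p j) (p j)) (mf_proj mp j).1.
Qed.

(** A scalar polar decomposition: z† z and z z† are multiples of [q] and [p i], equal multiples by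
    associativity of z z† z and positive by [mf_diag_pos], so [z] divided by a square root is the
    partial isometry. *)
Lemma mf_iso i q x : E q -> is_proj q ->
  (forall a, E a -> exists k : C, q · a · q = k *: q) ->
  E x -> p i · x · q <> 0 ->
  exists w, [/\ E w, w^† · w = q & w · w^† = p i].
Proof.
move=> Eq [qq qs] mq Ex z0; set z := p i · x · q in z0 *.
have [pi si] := mf_proj mp i.
have zs : z^† = q · x^† · p i by rewrite /z !cstarM si qs cmulA.
have [t t0 zz] : exists2 t : R, 0 <= t & z · z^† = t%:C *: p i.
  have [t t0 ht] := mf_diag_pos i (subalgM hE Eq (subalgS hE Ex)).
  exists t => //; rewrite -ht cstarM cstarK qs zs /z !cmulA//.
have [k kz] : exists k : C, z^† · z = k *: q.
  have [k hk] := mq _ (subalgM hE (subalgM hE (subalgS hE Ex) (mf_in mp i)) Ex).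
  exists k; rewrite -hk zs /z !cmulA.
  by rewrite -(cmulA (q · x^†) (p i) (p i)) pi.
have kt : k = t%:C.
  have : z · z^† · z = z · (z^† · z) by rewrite cmulA.
  rewrite zz kz cmulZl cmulZr.
  have -> : p i · z = z by rewrite /z !cmulA pi.
  have -> : z · q = z by rewrite /z -!cmulA qq.
  by move/(scaleC_inj z0).
have {}t0 : 0 < t.
  rewrite lt_neqAle t0 andbT eq_sym; apply/eqP => t00.
  by apply: z0; apply: mul_cstar_eq0; rewrite zz t00 scale0r.
pose c := (Num.sqrt t)^-1.
have cc : (c%:C : C) * c%:C * t%:C = 1.
  rewrite -!rmorphM/= -(rmorph1 (real_complex R)); congr (_%:C).
  rewrite /c -invfM -expr2 sqr_sqrtr ?(ltW t0)// mulVf// gt_eqF//.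
exists (c%:C *: z); split.
- by apply: (subalgZ hE); do 2!apply: (subalgM hE) => //; apply: (mf_in mp).
- by rewrite cstarZ conj_real cmulZl cmulZr kz kt !scalerA cc scale1r.
- by rewrite cstarZ conj_real cmulZl cmulZr zz !scalerA cc scale1r.
Qed.

(** A minimal family of the corner q E q consists of projections that are minimal in [E]. Each of
    them meets some [p i], is equivalent to it by [mf_iso], and is carried on to [P (cl i)] by
    [v i]. *)
Lemma frame_of_minfam (fE : fdset E) (Y : finType) (P : Y -> B) (cl : I -> Y) (v : I -> B) q :
  (forall y : Y, is_proj (P y)) ->
  (forall i, [/\ E (v i), (v i)^† · v i = P (cl i) & v i · (v i)^† = p i]) ->
  E q -> is_proj q ->
  exists n (cl' : 'I_n -> Y) (s : 'I_n -> B), frame E P cl' s q.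
Proof.
move=> Pp hv Eq [qq qs].
pose F := [set x | [/\ E x, q · x = x & x · q = x]].
have hF : star_subalg F.
  split=> [|a b [Ea qa aq] [Eb qb bq]|k a [Ea qa aq]|a b [Ea qa aq] [Eb qb bq]|a [Ea qa aq]].
  - by split; rewrite ?cmul0r ?cmulr0//; apply: (subalg0 hE).
  - by split; rewrite ?cmulDl ?cmulDr ?qa ?qb ?aq ?bq//; apply: (subalgD hE).
  - by split; rewrite ?cmulZl ?cmulZr ?qa ?aq//; apply: (subalgZ hE).
  - by split; [apply: (subalgM hE)|rewrite cmulA qa|rewrite -cmulA bq].
  - by split; [apply: (subalgS hE)|rewrite -{1}qs -cstarM aq|rewrite -{1}qs -cstarM qa].
have fF : fdset F by have [n [e he]] := fE; exists n, e => a [/he].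
have [J [m mm]] := fd_minfam hF fF.
have Em j : E (m j) by have [] := mf_in mm j.
have qm j : q · m j = m j by have [] := mf_in mm j.
have mq j : m j · q = m j by have [] := mf_in mm j.
have qE : q = \sum_j m j.
  have := mf_unit mm (x := q); rewrite cmul_suml => /(_ ltac:(by split)) {1}<-.
  by apply: eq_bigr.
have /choice[f hf] j : exists iw : I * B,
    [/\ E iw.2, iw.2^† · iw.2 = m j & iw.2 · iw.2^† = p iw.1].
  have [i pm] : exists i, p i · m j <> 0.
    apply: contrapT => h; apply: (mf_neq0 mm j).
    rewrite -(mf_unit mp (Em j)) cmul_suml big1// => i _.
    by apply: contrapT => pm; apply: h; exists i.
  have cm a : E a -> exists k : C, m j · a · m j = k *: m j.
    move=> Ea; have Fa : F (q · a · q).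
      split; first by do 2!apply: (subalgM hE) => //.
        by rewrite !cmulA qq.
      by rewrite -!cmulA qq.
    have [k hk] := mf_corner mm j Fa; exists k; rewrite -hk !cmulA mq.
    by rewrite -(cmulA (m j · a)) qm.
  have pm2 : p i · m j · m j <> 0 by rewrite -cmulA (mf_proj mm j).1.
  have [w [Ew wm wp]] := mf_iso (Em j) (mf_proj mm j) cm (Em j) pm2.
  by exists (i, w).
pose s j := (f j).2^† · v (f j).1.
pose g := fun j : 'I_#|J| => enum_val j.
have ws j : (f j).2 · m j = (f j).2.
  by have [_ h _] := hf j; apply: piso_mul_source h (mf_proj mm j).
have sj j : s j = m j · s j.
  rewrite /s cmulA; congr (_ · _); apply: cstar_inj.
  by rewrite cstarM !cstarK (mf_proj mm j).2 ws.
exists #|J|, (cl \o (fst \o (f \o g))), (s \o g); split=> [j|i j|] /=.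
- by have [Ew _ _] := hf (g j); have [Ev _ _] := hv (f (g j)).1; apply: (subalgM hE) => //; apply: (subalgS hE).
- have [->|ij] := eqVneq i j; last first.
    rewrite sj (sj (g j)) cstarM (mf_proj mm _).2 cmulA -(cmulA (s _)^†).
    by rewrite (mf_orth mm) ?cmulr0 ?cmul0r// (inj_eq enum_val_inj).
  rewrite /s cstarM cstarK cmulA -(cmulA (v _)^†); have [_ _ ->] := hf (g j).
  have [_ vP <-] := hv (f (g j)).1.
  by rewrite cmulA -(cmulA _ (v _)^†) vP (Pp _).1.
- rewrite qE [RHS](reindex_onto enum_rank (fun j : 'I_#|J| => enum_val j))/=; last first.
    by move=> j _; rewrite enum_valK.
  apply: eq_big => [j|j _]; first by rewrite enum_rankK eqxx.
  rewrite /g enum_rankK /s cstarM cstarK cmulA -(cmulA _ (v _)).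
  have [_ _ ->] := hv (f j).1; have [_ wm <-] := hf j.
  by rewrite cmulA -(cmulA _ _^† (f j).2) wm (mf_proj mm _).1.
Qed.

End MinFam.
End Frames.
Arguments bs_neq0 {R B E r P} _ y _.

Section FdBsys.
Variables (R : realType) (B : cstarType R).
Local Notation C := R[i].
Implicit Types (E : set B) (x q : B).

Lemma fd_unit E : star_subalg E -> fdset E -> exists u,
  [/\ E u, is_proj u & forall x, E x -> u · x = x /\ x · u = x].
Proof.
move=> hE fE; have [I [p mp]] := fd_minfam hE fE; exists (\sum_i p i); split.
- by apply: (subalg_sum hE) => i _; apply: (mf_in mp).
- apply: is_proj_sum => [i _|i j _ _]; [exact: (mf_proj mp)|exact: (mf_orth mp)].
- by move=> x Ex; rewrite (mf_unit mp)// (mf_unitr hE mp).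
Qed.

(** The sign of [l k] is read in the corner of a minimal projection [p i] that does not annihilate
    [e k]: compressing e_k x† x e_k and e_k there gives scalars t ≥ 0 and t' > 0 with t = l_k t'. *)
Lemma pos_spectral E x : star_subalg E -> fdset E -> E x ->
  exists n (l : 'I_n -> R) (e : 'I_n -> B),
    [/\ forall i, [/\ E (e i), is_proj (e i), e i <> 0 & 0 < l i],
        forall i j, i != j -> e i · e j = 0 &
        x^† · x = \sum_i (l i)%:C *: e i].
Proof.
move=> hE fE Ex.
have [||n [l [e [le oe xE]]]] := @spectral_decomposition _ _ E (x^† · x) hE fE.
- by apply: (subalgM hE) => //; apply: (subalgS hE).
- by rewrite cstarM cstarK.
exists n, l, e; split=> // k; have [Ee [ee es] e0 l0] := le k; split=> //.
rewrite lt_neqAle eq_sym l0 /=.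
have [I [p mp]] := fd_minfam hE fE.
have [i ei] : exists i, e k · p i <> 0.
  apply: contrapT => h; apply: e0.
  rewrite -(mf_unitr hE mp Ee) cmul_sumr big1// => i _.
  by apply: contrapT => pm; apply: h; exists i.
have [t t0 ht] := mf_diag_pos hE mp i (subalgM hE Ex Ee).
have [t' t'0 ht'] := mf_diag_pos hE mp i Ee.
have xe : e k · x^† · x · e k = (l k)%:C *: e k.
  rewrite -(cmulA (e k)) xE cmul_sumr cmul_suml (bigD1 k)//= cmulZr cmulZl !ee.
  by rewrite big1 ?addr0// => j jk; rewrite cmulZr oe ?scaler0 ?cmul0r// eq_sym.
have tl : t = l k * t'.
  apply: complexI; apply: (scaleC_inj (mf_neq0 mp i)); rewrite -ht rmorphM/= -scalerA -ht'.
  have xee : (x · e k)^† · (x · e k) = (l k)%:C *: ((e k)^† · e k).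
    by rewrite cstarM es !cmulA xe ee.
  by rewrite -!(cmulA (p i)) !(cmulA (p i)) -(cmulA (p i) _^†) xee -(cmulA (p i) _^†) cmulZr cmulZl.
have {}t'0 : 0 < t'.
  rewrite lt_neqAle t'0 andbT eq_sym; apply/eqP => t'00; apply: ei.
  apply: cstar_mul_eq0; rewrite cstarM (mf_proj mp i).2 !cmulA ht' t'00 scale0r//.
by move: t0; rewrite tl pmulr_lge0.
Qed.

(** Two minimal projections are related when some element of [E] links them, which by [mf_iso] is
    Murray-von Neumann equivalence; [P] keeps one projection from each class. *)
Lemma fd_bsys E : star_subalg E -> fdset E -> exists r (P : 'I_r -> B), bsys E P.
Proof.
move=> hE fE; have [I [p mp]] := fd_minfam hE fE.
pose e i j := `[< exists x, E x /\ p i · x · p j <> 0 >].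
have pp i : p i · p i = p i by have [] := mf_proj mp i.
have ps i : (p i)^† = p i by have [] := mf_proj mp i.
have iso i j : e i j -> exists w, [/\ E w, w^† · w = p j & w · w^† = p i].
  move=> /asboolP[x [Ex x0]].
  by apply: (mf_iso hE mp (mf_in mp j) (mf_proj mp j) _ Ex) => //; apply: (mf_corner mp).
have isoe i j w : E w -> w^† · w = p j -> w · w^† = p i -> e i j.
  move=> Ew wj wi; apply/asboolP; exists w; split=> //.
  rewrite -wi -wj !cmulA -(cmulA (w · w^†)) -(cmulA w) -(cmulA w).
  have ww : w · w^† · w = w by rewrite -cmulA wj (piso_mul_source wj (mf_proj mp j)).
  rewrite !cmulA ww -cmulA wj (piso_mul_source wj (mf_proj mp j)) => w0.
  by apply: (mf_neq0 mp j); rewrite -wj w0 cmulr0.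
have e_refl i : e i i.
  by apply/asboolP; exists (p i); rewrite !pp; split; [apply: (mf_in mp)|apply: (mf_neq0 mp i)].
have e_sym i j : e i j -> e j i.
  move=> /iso[w [Ew wj wi]]; apply: (isoe _ _ w^†); rewrite ?cstarK//.
  exact: (subalgS hE).
have e_trans i j k : e i j -> e j k -> e i k.
  move=> /iso[w [Ew wj wi]] /iso[v [Ev vk vj]]; apply: (isoe _ _ (w · v)).
  - exact: (subalgM hE).
  - rewrite cstarM cmulA -(cmulA v^†) wj -vj !cmulA vk.
    by rewrite -(cmulA (p k)) vk pp.
  - rewrite cstarM cmulA -(cmulA w) vj -wj !cmulA wi.
    by rewrite -(cmulA (p i)) wi pp.
(* The chosen representative depends only on the class. The default is never taken, as the relation
   is reflexive. *)
pose c i := odflt i [pick j | e i j].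
have ec i : e i (c i) by rewrite /c; case: pickP => [j|] //= /(_ i); rewrite e_refl.
have c_eq i j : e i j -> c i = c j.
  move=> eij; rewrite /c; have /eq_pick -> : e i =1 e j.
    by move=> k; apply/idP/idP; apply: e_trans => //; apply: e_sym.
  by case: pickP => //= /(_ j); rewrite e_refl.
have cc i : c (c i) == c i by rewrite eq_sym; apply/eqP/c_eq/ec.
pose Y := {i : I | c i == i}.
pose cl i : 'I_#|{: Y}| := enum_rank (exist (fun i => c i == i) (c i) (cc i) : Y).
pose P (y : 'I_#|{: Y}|) := p (val (enum_val y)).
have Pcl i : P (cl i) = p (c i) by rewrite /P /cl enum_rankK.
have /choice[v hv] i : exists v, [/\ E v, v^† · v = P (cl i) & v · v^† = p i].
  by rewrite Pcl; apply: iso.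
exists #|{: Y}|, P; split=> //.
- by move=> y; apply: (mf_in mp).
- by move=> y; apply: (mf_proj mp).
- by move=> y; apply: (mf_neq0 mp).
- by move=> y x; apply: (mf_corner mp).
- move=> y z x yz Ex; apply: contrapT => x0.
  have /c_eq : e (val (enum_val y)) (val (enum_val z)) by apply/asboolP; exists x.
  rewrite (eqP (valP (enum_val y))) (eqP (valP (enum_val z))) => /val_inj/enum_val_inj.
  by move/eqP; apply/negP.
- by move=> q Eq qq; apply: (frame_of_minfam hE mp fE _ hv) => // y; apply: (mf_proj mp).
Qed.

End FdBsys.

(** * Ranks of projections *)

Section Rank.
Variable R : realType.
Local Notation C := R[i].

Definition cnt (r : nat) (J : finType) (cl : J -> 'I_r) : 'cV[nat]_r :=
  \col_y \sum_j (cl j == y : nat).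

Lemma cntE (r : nat) (J : finType) (cl : J -> 'I_r) y : cnt cl y ord0 = #|[pred j | cl j == y]|.
Proof. by rewrite mxE -sum1_card [RHS]big_mkcond. Qed.

Section OneAlgebra.
Variables (B : cstarType R) (E : set B) (r : nat) (P : 'I_r -> B).
Hypothesis bs : bsys E P.
Let hE := bs_sub bs.
Implicit Types (x q : B).

(** A relation with an arbitrary finite index type, so that disjoint unions and dependent sums of
    frames are frames at once; uniqueness of the rank is [hasrk_unique]. *)
Definition hasrk q (v : 'cV[nat]_r) : Prop :=
  exists (J : finType) (cl : J -> 'I_r) (s : J -> B), frame E P cl s q /\ cnt cl = v.

Lemma hasrk_exists q : E q -> is_proj q -> exists v, hasrk q v.
Proof.
move=> Eq qq; have [n [cl [s fs]]] := bs_frame bs Eq qq.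
by exists (cnt cl), 'I_n, cl, s.
Qed.

Lemma frame_source (J : finType) (cl : J -> 'I_r) (s : J -> B) q j :
  frame E P cl s q -> s j · P (cl j) = s j.
Proof.
move=> fs; apply: piso_mul_source (bs_proj bs _).
by rewrite (frame_orth fs) eqxx.
Qed.

Lemma frame_mul (J : finType) (cl : J -> 'I_r) (s : J -> B) q j :
  frame E P cl s q -> q · s j = s j.
Proof.
move=> fs; rewrite (frame_sum fs) cmul_suml (bigD1 j)//= big1 ?addr0.
  by rewrite -cmulA (frame_orth fs) eqxx (frame_source j fs).
by move=> i ij; rewrite -cmulA (frame_orth fs) (negbTE ij) cmulr0.
Qed.

Lemma hasrk_in q v : hasrk q v -> E q.
Proof.
move=> [J [cl [s [fs _]]]]; rewrite (frame_sum fs); apply: (subalg_sum hE) => j _.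
by apply: (subalgM hE); [|apply: (subalgS hE)]; apply: (frame_in fs).
Qed.

Lemma hasrk_proj q v : hasrk q v -> is_proj q.
Proof.
move=> [J [cl [s [fs _]]]]; split.
  rewrite {2}(frame_sum fs) cmul_sumr [RHS](frame_sum fs); apply: eq_bigr => j _.
  by rewrite cmulA (frame_mul j fs).
by rewrite (frame_sum fs) cstar_sum; apply: eq_bigr => j _; rewrite cstarM cstarK.
Qed.

(* If v y > v' y, a dimension count gives a nonzero z with q z = z and q' x^* z = 0, so
   that q - x q' x^* fixes z. *)
Lemma hasrk_le q v q' v' x : hasrk q v -> hasrk q' v' -> E x ->
  nrm (q - x · q' · x^†) < 1 -> vle v v'.
Proof.
move=> [J [cl [s [fs <-]]]] [K [cl' [t [ft <-]]]] Ex lt1 y; rewrite !cntE leqNgt.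
apply/negP => lt; set a := #|_| in lt; set b := #|_| in lt.
pose jn (i : 'I_b) : J := enum_val i; pose kn (i : 'I_a) : K := enum_val i.
have jy i : cl (jn i) = y by apply/eqP; have := enum_valP i; rewrite inE.
have ky i : cl' (kn i) = y by apply/eqP; have := enum_valP i; rewrite inE.
have Es j : E (s j) := frame_in fs j; have Et k : E (t k) := frame_in ft k.
have mid j k : (t k)^† · x^† · s j = P (cl' k) · ((t k)^† · x^† · s j) · P (cl j).
  rewrite !cmulA -(cmulA _ (s j)) (frame_source j fs); congr (_ · _ · _).
  by rewrite -{1}(frame_source k ft) cstarM (bs_proj bs _).2.
have Em j k : E ((t k)^† · x^† · s j).
  by apply: (subalgM hE) => //; apply: (subalgM hE); apply: (subalgS hE).
have /choice[m hm] i : exists m : 'I_a -> C, forall k, (t (kn k))^† · x^† · s (jn i) = m k *: P y.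
  have /choice[m hm] k : exists c : C, (t (kn k))^† · x^† · s (jn i) = c *: P y.
    by rewrite mid jy ky; apply: (bs_corner bs).
  by exists m.
(* The matrix has more rows (pieces of [q] of class [y]) than columns (pieces of [q'] of class
   [y]). *)
have [c c0 cM] := exists_left_kernel (\matrix_(i, k) m i k) lt.
pose z := \sum_i c 0 i *: s (jn i).
have z0 : z <> 0.
  move=> z0; move/eqP: c0; apply; apply/rowP => i; rewrite mxE.
  have : (s (jn i))^† · z = c 0 i *: P y.
    rewrite cmul_sumr (bigD1 i)//= cmulZr (frame_orth fs) eqxx jy big1 ?addr0// => i' ii'.
    rewrite cmulZr (frame_orth fs) ifN ?scaler0// (inj_eq enum_val_inj) eq_sym//.
  rewrite z0 cmulr0 => /esym/eqP; rewrite scaler_eq0 => /orP[/eqP//|/eqP].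
  by have /= := bs_neq0 bs y.
have qz : q · z = z.
  by rewrite cmul_sumr; apply: eq_bigr => i _; rewrite cmulZr (frame_mul _ fs).
have q'z : q' · x^† · z = 0.
  rewrite (frame_sum ft) !cmul_suml big1// => k _.
  (* Pieces of [q'] of another class are killed by [bs_off], those of class [y] by the choice of
     [c]. *)
  rewrite cmul_sumr; have [ky'|ky'] := eqVneq (cl' k) y; last first.
    rewrite big1// => i _; rewrite cmulZr -!cmulA (cmulA _^† x^†) mid jy.
    by rewrite (bs_off bs)// cmulr0 scaler0.
  have kin : k \in [pred k | cl' k == y] by rewrite inE ky'.
  pose k1 := enum_rank_in kin k; have kE : kn k1 = k by rewrite /kn enum_rankK_in.
  rewrite (eq_bigr (fun i => (c 0 i * m i k1) *: (t k · P y))) => [|i _]; last first.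
    by rewrite cmulZr -!cmulA (cmulA _^† x^†) -kE hm cmulZr scalerA.
  rewrite -scaler_suml; have /matrixP/(_ 0 k1) := cM; rewrite !mxE.
  by under eq_bigr do rewrite mxE; move=> ->; rewrite scale0r.
have : (q - x · q' · x^†) · z = z.
  by rewrite cmulBl qz -!cmulA (cmulA q') q'z cmulr0 subr0.
move/(congr1 (@nrm R B)) => zz; have := nrm_cmul (q - x · q' · x^†) z.
by rewrite zz; have := nrm_gt0 z0; nra.
Qed.

Lemma hasrk_unique q v v' : hasrk q v -> hasrk q v' -> v = v'.
Proof.
move=> qv qv'; have [qq qs] := hasrk_proj qv; have Eq := hasrk_in qv.
have d : nrm (q - q · q · q^†) < 1 by rewrite qs !qq subrr nrm0.
by apply: vle_anti; [exact: hasrk_le qv qv' Eq d|exact: hasrk_le qv' qv Eq d].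
Qed.

Lemma hasrk_near q v q' v' : hasrk q v -> hasrk q' v' -> nrm (q - q') < 1 -> v = v'.
Proof.
move=> qv qv' d.
have h q1 q2 v1 v2 : hasrk q1 v1 -> hasrk q2 v2 -> nrm (q1 - q2) < 1 -> vle v1 v2.
  move=> h1 h2 d12; have [qq qs] := hasrk_proj h2.
  by apply: (hasrk_le (x := q2) h1 h2); [exact: hasrk_in h2|rewrite qs !qq].
by apply: vle_anti; [apply: h qv qv' d|apply: h qv' qv _; rewrite nrm_distC].
Qed.

Lemma hasrkD q v q' v' : hasrk q v -> hasrk q' v' -> q · q' = 0 ->
  hasrk (q + q') (v + v').
Proof.
move=> hq hq' qq'0; have q'q0 := proj_orthC (hasrk_proj hq) (hasrk_proj hq') qq'0.
have [J [cl [s [fs <-]]]] := hq; have [K [cl' [t [ft <-]]]] := hq'.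
exists (J + K)%type, (fun u => match u with inl j => cl j | inr k => cl' k end),
  (fun u => match u with inl j => s j | inr k => t k end); split.
  split=> [[j|k]|[j|k] [j'|k']|].
  - exact: (frame_in fs).
  - exact: (frame_in ft).
  - exact: (frame_orth fs).
  - rewrite -(frame_mul j fs) -(frame_mul k' ft) cstarM (hasrk_proj hq).2.
    by rewrite -cmulA (cmulA q) qq'0 cmul0r cmulr0.
  - rewrite -(frame_mul k ft) -(frame_mul j' fs) cstarM (hasrk_proj hq').2.
    by rewrite -cmulA (cmulA q') q'q0 cmul0r cmulr0.
  - exact: (frame_orth ft).
  - by rewrite big_sumType /= -(frame_sum fs) -(frame_sum ft).
by apply/colP => y; rewrite !mxE big_sumType.
Qed.

Lemma hasrk0 : hasrk 0 0.
Proof.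
exists void, (fun v : void => match v with end), (fun v : void => match v with end); split.
  by split=> [[]|[]|]; rewrite (big_pred0_eq, big_pred0)// => -[].
by apply/colP => y; rewrite !mxE big_pred0// => -[].
Qed.

(** The rank inequality allows an injection from the pieces of [q] to those of [q'] that preserves
    classes; composing matched pieces gives [x]. *)
Lemma hasrk_sub q v q' v' : hasrk q v -> hasrk q' v' -> vle v v' ->
  exists2 x, E x & q = x · q' · x^†.
Proof.
move=> hq hq' vv'; have [J [cl [s [fs vE]]]] := hq; have [K [cl' [t [ft v'E]]]] := hq'.
have card y : (#|[pred j | cl j == y]| <= #|[pred k | cl' k == y]|)%N.
  by rewrite -!cntE vE v'E.
have [f f_inj fcl] : exists2 f : J -> K, injective f & forall j, cl' (f j) = cl j.
  (* Position of [j] within its class; [f] sends [j] to the piece of [q'] at the same position in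
     that class. *)
  pose ix j := index j (enum [pred j' | cl j' == cl j]).
  have ixlt j : (ix j < #|[pred k | cl' k == cl j]|)%N.
    by apply: leq_trans (card _); rewrite cardE index_mem mem_enum inE.
  pose f j : K := enum_val (Ordinal (ixlt j)).
  have fcl j : cl' (f j) = cl j by apply/eqP; have := enum_valP (Ordinal (ixlt j)); rewrite inE.
  exists f => // i j ij; have cij : cl i = cl j by rewrite -!fcl ij.
  have [k0 _] : exists k0 : K, True by exists (f i).
  move: ij; rewrite /f !(enum_val_nth k0) /= -cij => /eqP.
  rewrite nth_uniq ?enum_uniq// -?cardE ?ixlt//; last by rewrite cij ixlt.
  rewrite /ix -cij => /eqP ij.
  have iin : i \in enum [pred j' | cl j' == cl i] by rewrite mem_enum inE.
  have jin : j \in enum [pred j' | cl j' == cl i] by rewrite mem_enum inE cij.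
  by rewrite -(nth_index i iin) ij nth_index.
exists (\sum_j s j · (t (f j))^†).
  apply: (subalg_sum hE) => j _; apply: (subalgM hE); first exact: (frame_in fs).
  by apply: (subalgS hE); apply: (frame_in ft).
have tq' j : (t (f j))^† · q' = (t (f j))^†.
  by apply: cstar_inj; rewrite cstarM cstarK (hasrk_proj hq').2 (frame_mul _ ft).
rewrite cstar_sum !cmul_suml {1}(frame_sum fs); apply: eq_bigr => j _.
rewrite -(cmulA (s j)) tq' cmul_sumr (bigD1 j)//= big1 ?addr0 => [|i ij].
  rewrite cstarM cstarK cmulA -(cmulA (s j)) (frame_orth ft) eqxx fcl.
  by rewrite (frame_source j fs).
rewrite cstarM cstarK cmulA -(cmulA (s j)) (frame_orth ft) ifN ?cmulr0 ?cmul0r//.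
by rewrite (inj_eq f_inj) eq_sym.
Qed.

End OneAlgebra.

(** Each piece of [q] becomes a copy of some [f (P y)], which is cut further along a frame of
    [f (P y)]; counting the resulting pairs by class is the matrix product. *)
Lemma hasrk_hom (B B' : cstarType R) (E : set B) (E' : set B') r r'
    (P : 'I_r -> B) (P' : 'I_r' -> B') (f : B -> B') (M : 'M[nat]_(r', r)) q v :
  bsys E P -> bsys E' P' -> star_hom f -> (forall x, E x -> E' (f x)) ->
  (forall y, hasrk E' P' (f (P y)) (col y M)) ->
  hasrk E P q v -> hasrk E' P' (f q) (M *m v).
Proof.
move=> bs bs' hf fE hM [J [cl [s [fs <-]]]].
have /choice[K hK] y : exists K : finType, exists (cl' : K -> 'I_r') (t : K -> B'),
    frame E' P' cl' t (f (P y)) /\ cnt cl' = col y M.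
  by have [K [cl' [t h]]] := hM y; exists K, cl', t.
have {}hK y : exists c : (K y -> 'I_r') * (K y -> B'),
    frame E' P' c.1 c.2 (f (P y)) /\ cnt c.1 = col y M.
  by have [cl' [t h]] := hK y; exists (cl', t).
pose c y := projT1 (cid (hK y)).
have fc y : frame E' P' (c y).1 (c y).2 (f (P y)) := (projT2 (cid (hK y))).1.
have cM y : cnt (c y).1 = col y M := (projT2 (cid (hK y))).2.
pose J' : finType := {j : J & K (cl j)}.
pose cl' (u : J') := (c (cl (tag u))).1 (tagged u).
pose s' (u : J') := f (s (tag u)) · (c (cl (tag u))).2 (tagged u).
exists J', cl', s'; split; last first.
  apply/colP => y; rewrite !mxE /cl'.
  rewrite -(sig_big_dep xpredT (fun=> xpredT)
    (fun j k => ((c (cl j)).1 k == y : nat))) //=.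
  transitivity (\sum_j M y (cl j)).
    by apply: eq_bigr => j _; have /colP/(_ y) := cM (cl j); rewrite !mxE.
  under [RHS]eq_bigr => y' _ do rewrite mxE big_distrr /=.
  rewrite exchange_big /=; apply: eq_bigr => j _.
  rewrite (bigD1 (cl j))//= eqxx [_ * _]muln1 big1 ?addr0// => y' yj.
  by rewrite eq_sym (negbTE yj) [LHS]muln0.
have fss i j : (f (s i))^† · f (s j) = if i == j then f (P (cl j)) else 0.
  rewrite -(star_hom_star hf) -(star_hom_mul hf) (frame_orth fs).
  by case: ifP => // _; rewrite star_hom0.
split=> [u|[i a] [j b]|].
- by apply: (subalgM (bs_sub bs')); [apply/fE/(frame_in fs)|apply: (frame_in (fc _))].
- rewrite /s' /cl' cstarM cmulA -(cmulA _^† (f _)^†) /= fss.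
  have [ij|ij] := eqVneq i j; last first.
    by rewrite ifN ?cmulr0 ?cmul0r//; apply: contraNneq ij => /(congr1 tag)/= ->.
  subst j; rewrite -cmulA (frame_mul bs' _ (fc _)) (frame_orth (fc _)).
  by rewrite -tag_eqE /tag_eq /= eqxx tagged_asE.
- rewrite (frame_sum fs) star_hom_sum// /s'.
  rewrite -(sig_big_dep xpredT (fun=> xpredT)
    (fun j k => f (s j) · (c (cl j)).2 k · (f (s j) · (c (cl j)).2 k)^†)) //=.
  apply: eq_bigr => j _; rewrite (star_hom_mul hf) (star_hom_star hf).
  rewrite -{1}(frame_source bs j fs) (star_hom_mul hf) (frame_sum (fc (cl j))).
  rewrite cmul_sumr cmul_suml; apply: eq_bigr => k _.
  by rewrite cstarM !cmulA.
Qed.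

End Rank.

(** * Inductive limits and stabilizations *)

Section Limit.
Variables (R : realType) (An : nat -> cstarType R) (f : forall i j, An i -> An j).
Variables (A : cstarType R) (g : forall i, An i -> A).
Hypothesis f_li : forall i j, (i <= j)%N -> left_invertible (@f i j).
Hypothesis f_id : forall i, @f i i = id.
Hypothesis f_comp : forall i j k, (i <= j)%N -> (j <= k)%N -> @f j k \o @f i j = @f i k.
Hypothesis g_lim : is_star_limit f g.

Lemma limit_hom i : star_hom (@g i).
Proof. by have [[]] := g_lim. Qed.

Lemma limit_comp i j x : (i <= j)%N -> g (@f i j x) = g x.
Proof. by move=> ij; have [[_ h] _] := g_lim; have /(congr1 (@^~ x)) := h i j ij. Qed.

Lemma fE i j k x : (i <= j)%N -> (j <= k)%N -> @f j k (@f i j x) = @f i k x.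
Proof. by move=> ij jk; rewrite -(f_comp ij jk). Qed.

(** The left inverses of the connecting maps compose to a cocone into [An i] that is the identity at
    stage [i]. *)
Lemma limit_inj i : injective (@g i).
Proof.
have hp0 k : exists p : An k.+1 -> An k, star_hom p /\ p \o @f k k.+1 = id.
  by have [_ [p hp pf]] := f_li (leqnSn k); exists p.
pose p k := projT1 (cid (hp0 k)).
have hp k : star_hom (p k) /\ p k \o @f k k.+1 = id := projT2 (cid (hp0 k)).
pose D := fix D k : An (k + i)%N -> An i :=
  if k is k'.+1 then D k' \o p (k' + i)%N else id.
have hD k : star_hom (D k).
  elim: k => [|k IH]; first exact: star_hom_id.
  by apply: star_hom_comp IH; have [] := hp (k + i)%N.
have Df j k x : (j <= k)%N -> D k (@f (j + i)%N (k + i)%N x) = D j x.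
  move=> jk; rewrite -(subnK jk); elim: (k - j)%N => [|m IH].
    by rewrite !add0n f_id.
  rewrite -IH addSn /= -(@fE _ (m + j + i)%N) ?leq_add2r ?leq_addl//; congr (D _ _).
  by have [_ /(congr1 (@^~ (@f (j + i)%N (m + j + i)%N x)))] := hp (m + j + i)%N.
pose h j := D j \o @f j (j + i)%N.
have hc : star_cocone f h.
  split=> [j|j k jk].
    by apply: star_hom_comp (hD j); have [] := f_li (leq_addr i j).
  apply/funext => x; rewrite /h /= fE ?leq_addr// -(Df j k)//.
  by rewrite fE ?leq_addr// leq_add2r.
have [_ /(_ _ _ hc)[u [[hu ug] _]]] := g_lim.
have hi x : u (g x) = x.
  have /(congr1 (@^~ x)) /= -> := ug i.
  by have := Df 0%N i x (leq0n i).
exact: can_inj hi.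
Qed.

(** The closure of the union of the images is a C*-algebra receiving the cocone. By uniqueness the
    induced map followed by the inclusion is the identity, so this closure is all of [A]. *)
Lemma limit_dense (a : A) (e : R) : 0 < e -> exists n (x : An n), nrm (a - g x) < e.
Proof.
pose K := [set a | exists n (x : An n), a = g x].
have join2 b c : K b -> K c -> exists n (x y : An n), b = g x /\ c = g y.
  move=> [n [x ->]] [m [y ->]]; exists (maxn n m), (f _ x), (f _ y).
  by rewrite !limit_comp// ?leq_maxl ?leq_maxr.
have hK : star_subalg K.
  split=> [|b c Kb Kc|k b [n [x ->]]|b c Kb Kc|b [n [x ->]]].
  - by exists 0%N, 0; rewrite (star_hom0 (limit_hom _)).
  - have [n [x [y [-> ->]]]] := join2 _ _ Kb Kc.
    by exists n, (x + y); rewrite (star_homD (limit_hom _)).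
  - by exists n, (k *: x); rewrite (star_homZ (limit_hom _)).
  - have [n [x [y [-> ->]]]] := join2 _ _ Kb Kc.
    by exists n, (x · y); rewrite (star_hom_mul (limit_hom _)).
  - by exists n, (x^†); rewrite (star_hom_star (limit_hom _)).
have hcK := star_subalg_closure hK.
pose D := csub hcK (@closed_closure _ K).
have gK n x : closure K (@g n x) by apply: subset_closure; exists n, x.
pose h n (x : An n) : D := @CSub _ _ _ hcK (@closed_closure _ K) _ (gK n x).
have hc : star_cocone f h.
  split=> [n|i j ij].
    split=> [k x y|x y|x]; apply: csub_val_inj => /=.
    - exact: (star_hom_linear (limit_hom n)).
    - exact: (star_hom_mul (limit_hom n)).
    - exact: (star_hom_star (limit_hom n)).
  by apply/funext => x; apply: csub_val_inj; apply: limit_comp.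
have [gc guniv] := g_lim; have [u [[hu ug] _]] := guniv _ _ hc.
have [v [_ vuniq]] := guniv _ _ gc.
pose w := @csub_val _ _ _ hcK (@closed_closure _ K) \o u.
have wE : v = w.
  apply: vuniq; split; first exact: star_hom_comp hu (csub_val_star_hom _ _).
  by move=> n; apply/funext => x /=; rewrite /w /=; have /(congr1 (@^~ x)) /= -> := ug n.
have idE : v = id by apply: vuniq; split; [exact: star_hom_id|].
move=> e0; have : closure K a.
  have -> : a = w a by rewrite -wE idE.
  exact: csub_prop.
by move/closure_nrmP => /(_ _ e0)[_ [n [x ->]] ax]; exists n, x.
Qed.

End Limit.

Section Stabilization.
Variables (R : realType) (A B : cstarType R) (e : nat -> nat -> A -> B).
Hypothesis he : is_stabilization e.
Local Notation C := R[i].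

Lemma stabD i j : {morph e i j : a b / a + b}.
Proof. by move=> a b; rewrite -[a]scale1r (stab_linear he) !scale1r. Qed.

Lemma stab0 i j : e i j 0 = 0.
Proof. by apply: (addrI (e i j 0)); rewrite -stabD !addr0. Qed.

Lemma stabZ i j (k : C) a : e i j (k *: a) = k *: e i j a.
Proof. by rewrite -[k *: a]addr0 (stab_linear he) stab0 addr0. Qed.

Lemma stabB i j a b : e i j (a - b) = e i j a - e i j b.
Proof. by rewrite stabD -scaleN1r stabZ scaleN1r. Qed.

Lemma stab_sum i j I (r : seq I) (P : pred I) (F : I -> A) :
  e i j (\sum_(k <- r | P k) F k) = \sum_(k <- r | P k) e i j (F k).
Proof. by rewrite (big_morph (e i j) (@stabD i j) (stab0 i j)). Qed.

Lemma stab_mulE i j k l a b :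
  e i j a · e k l b = if j == k then e i l (a · b) else 0.
Proof. exact: (stab_mul he). Qed.

Lemma stab_mul_eq i j l a b : e i j a · e j l b = e i l (a · b).
Proof. by rewrite stab_mulE eqxx. Qed.

Lemma stab_mul_neq i j k l a b : j != k -> e i j a · e k l b = 0.
Proof. by move=> jk; rewrite stab_mulE (negbTE jk). Qed.

Lemma stab_diag_hom i : star_hom (e i i).
Proof.
split; [exact: (stab_linear he)|by move=> a b; rewrite stab_mul_eq|].
by move=> a; rewrite (stab_star he).
Qed.

(** The C*-identity reduces to the diagonal entry [e j j], a homomorphism and so contractive. *)
Lemma nrm_stab i j a : nrm (e i j a) <= nrm a.
Proof.
rewrite -(ler_pXn2r (n := 2)) ?nnegrE ?nrm_ge0// -!nrm_cstar_mul.
by rewrite (stab_star he) stab_mul_eq; apply: star_hom_contractive (stab_diag_hom j).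
Qed.

(** Entries are indexed by all natural numbers, so that matrices of different sizes are compared by
    padding with zeros. *)
Definition mxe (k : nat) (a : nat -> nat -> A) : B :=
  \sum_(i < k) \sum_(j < k) e i j (a i j).

Lemma mxeD k a b : mxe k (fun i j => a i j + b i j) = mxe k a + mxe k b.
Proof.
rewrite -big_split /=; apply: eq_bigr => i _; rewrite -big_split /=.
by apply: eq_bigr => j _; rewrite stabD.
Qed.

Lemma mxeZ k (c : C) a : mxe k (fun i j => c *: a i j) = c *: mxe k a.
Proof.
rewrite scaler_sumr; apply: eq_bigr => i _; rewrite scaler_sumr.
by apply: eq_bigr => j _; rewrite stabZ.
Qed.

Lemma mxe_star k a : (mxe k a)^† = mxe k (fun i j => (a j i)^†).
Proof.
rewrite cstar_sum; under eq_bigr do rewrite cstar_sum.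
rewrite exchange_big /=; apply: eq_bigr => i _; apply: eq_bigr => j _.
by rewrite (stab_star he).
Qed.

Lemma mxe_mul k a b :
  mxe k a · mxe k b = mxe k (fun i l => \sum_(j < k) a i j · b j l).
Proof.
rewrite /mxe cmul_suml; apply: eq_bigr => i _; rewrite cmul_suml.
under [RHS]eq_bigr do rewrite stab_sum.
rewrite [RHS]exchange_big /=; apply: eq_bigr => j _.
rewrite cmul_sumr (bigD1 j)//= [X in _ + X]big1 ?addr0 => [|m mj].
  by rewrite cmul_sumr; apply: eq_bigr => l _; rewrite stab_mul_eq.
rewrite cmul_sumr big1// => l _; rewrite stab_mul_neq// eq_sym.
by rewrite -val_eqE in mj.
Qed.

Lemma mxe_widen k m a : (k <= m)%N ->
  mxe k a = mxe m (fun i j => if (i < k)%N && (j < k)%N then a i j else 0).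
Proof.
move=> km; rewrite /mxe.
rewrite (big_ord_widen m (fun i => \sum_(j < k) e i j (a i j)) km) big_mkcond /=.
apply: eq_bigr => i _; case: ifPn => ik; last by rewrite big1// => j _; rewrite stab0.
rewrite (big_ord_widen m (fun j => e i j (a i j)) km) big_mkcond /=.
by apply: eq_bigr => j _; case: ifP => //; rewrite stab0.
Qed.

Lemma mxe_unit k i j a : (i < k)%N -> (j < k)%N ->
  e i j a = mxe k (fun i' j' => if (i' == i) && (j' == j) then a else 0).
Proof.
move=> ik jk; rewrite /mxe (bigD1 (Ordinal ik))//= (bigD1 (Ordinal jk))//= !eqxx /=.
rewrite big1 ?addr0 => [|j' j'j]; last first.
  by rewrite -val_eqE /= in j'j; rewrite (negbTE j'j) stab0.
rewrite big1 ?addr0// => i' i'i; rewrite -val_eqE /= in i'i.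
by rewrite big1// => j' _; rewrite (negbTE i'i) stab0.
Qed.

Lemma stab_mul_mxe k l i a b : (i < k)%N ->
  e l i a · mxe k b = \sum_(j < k) e l j (a · b i j).
Proof.
move=> ik; rewrite cmul_sumr (bigD1 (Ordinal ik))//= [X in _ + X]big1 ?addr0 => [|i' i'i].
  by rewrite cmul_sumr; apply: eq_bigr => j _; rewrite stab_mul_eq.
rewrite -val_eqE /= in i'i.
by rewrite cmul_sumr big1// => j _; rewrite stab_mul_neq// eq_sym.
Qed.

Lemma stab_mxe_stab k l l' i j a b c : (i < k)%N -> (j < k)%N ->
  e l i a · mxe k b · e j l' c = e l l' (a · b i j · c).
Proof.
move=> ik jk; rewrite stab_mul_mxe// cmul_suml (bigD1 (Ordinal jk))//= big1 ?addr0.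
  by rewrite stab_mul_eq.
by move=> j' j'j; rewrite -val_eqE /= in j'j; rewrite stab_mul_neq.
Qed.

Definition mxsub k (D : set A) : set B :=
  [set b | exists2 a, (forall i j, D (a i j)) & b = mxe k a].

Lemma mxsubI k (D : set A) a : (forall i j, D (a i j)) -> mxsub k D (mxe k a).
Proof. by move=> Da; exists a. Qed.

Lemma mxsub_widen k m (D : set A) b : star_subalg D -> (k <= m)%N ->
  mxsub k D b -> mxsub m D b.
Proof.
move=> hD km [a Da ->]; rewrite (mxe_widen _ km); apply: mxsubI.
by move=> i j; case: ifP => // _; apply: (subalg0 hD).
Qed.

Lemma mxsub_unit k (D : set A) i j a : star_subalg D -> D a -> (i < k)%N -> (j < k)%N ->
  mxsub k D (e i j a).
Proof.
move=> hD Da ik jk; rewrite (mxe_unit _ ik jk); apply: mxsubI.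
by move=> i' j'; case: ifP => // _; apply: (subalg0 hD).
Qed.

Lemma mxsub_subalg k (D : set A) : star_subalg D -> star_subalg (mxsub k D).
Proof.
move=> hD; split.
- exists (fun _ _ => 0) => [i j|]; first exact: (subalg0 hD).
  by rewrite /mxe big1// => i _; rewrite big1// => j _; rewrite stab0.
- move=> _ _ [a Da ->] [b Db ->]; exists (fun i j => a i j + b i j); last by rewrite mxeD.
  by move=> i j; apply: (subalgD hD).
- move=> c _ [a Da ->]; exists (fun i j => c *: a i j); last by rewrite mxeZ.
  by move=> i j; apply: (subalgZ hD).
- move=> _ _ [a Da ->] [b Db ->]; rewrite mxe_mul; apply: mxsubI.
  by move=> i l; apply: (subalg_sum hD) => j _; apply: (subalgM hD).
- move=> _ [a Da ->]; rewrite mxe_star; apply: mxsubI.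
  by move=> i j; apply: (subalgS hD).
Qed.

Lemma mxsub_fd k (D : set A) : fdset D -> fdset (mxsub k D).
Proof.
move=> [n [v hv]].
pose T : finType := ('I_k * 'I_k * 'I_n)%type.
exists #|{: T}|, (fun t : 'I_#|{: T}| => let: (i, j, m) := enum_val t in e i j (v m)).
move=> _ [a Da ->].
have /choice[c hc] (u : ('I_k * 'I_k)%type) : exists c : 'I_n -> C, a u.1 u.2 = \sum_m c m *: v m.
  by apply: hv.
exists (fun t => let: (i, j, m) := enum_val t in c (i, j) m).
rewrite [RHS](reindex_onto enum_rank (fun t : 'I_#|{: T}| => enum_val t))/=; last first.
  by move=> t _; rewrite enum_valK.
rewrite (eq_big xpredT (fun u : T => c u.1 u.2 *: e u.1.1 u.1.2 (v u.2))); last 2 first.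
- by move=> u; rewrite enum_rankK eqxx.
- by move=> [[i j] m] _; rewrite enum_rankK.
rewrite -(pair_big xpredT xpredT (fun (p : ('I_k * 'I_k)%type) m => c p m *: e p.1 p.2 (v m)))/=.
rewrite /mxe (pair_bigA _ (fun i j : 'I_k => e i j (a i j)))/=.
apply: eq_bigr => u _.
by rewrite hc stab_sum; apply: eq_bigr => m _; rewrite stabZ.
Qed.

Definition mxfin (D : set A) : set B := [set b | exists k, mxsub k D b].

Lemma mxfin2 (D : set A) b c : star_subalg D -> mxfin D b -> mxfin D c ->
  exists2 k, mxsub k D b & mxsub k D c.
Proof.
move=> hD [k hb] [m hc]; exists (maxn k m).
  exact: mxsub_widen hD (leq_maxl _ _) hb.
exact: mxsub_widen hD (leq_maxr _ _) hc.
Qed.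

Lemma mxfin_subalg (D : set A) : star_subalg D -> star_subalg (mxfin D).
Proof.
move=> hD; split.
- by exists 0%N; apply: (subalg0 (mxsub_subalg _ hD)).
- move=> b c /mxfin2 h /(h _ hD)[k hb hc]; exists k.
  exact: (subalgD (mxsub_subalg _ hD)).
- by move=> z b [k hb]; exists k; apply: (subalgZ (mxsub_subalg _ hD)).
- move=> b c /mxfin2 h /(h _ hD)[k hb hc]; exists k.
  exact: (subalgM (mxsub_subalg _ hD)).
- by move=> b [k hb]; exists k; apply: (subalgS (mxsub_subalg _ hD)).
Qed.

Lemma mxfin_unit (D : set A) i j a : star_subalg D -> D a -> mxfin D (e i j a).
Proof.
move=> hD Da; exists (maxn i j).+1; apply: mxsub_unit => //; rewrite ltnS.
  exact: leq_maxl.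
exact: leq_maxr.
Qed.

(** Injectivity is given at (0, 0) only; there the image of (a† a)² factors through [e i i a]. *)
Lemma stab_diag_inj i a : e i i a = 0 -> a = 0.
Proof.
move=> h; apply: cstar_mul_eq0; apply: (stab_inj he); rewrite stab0.
apply: cstar_mul_eq0; rewrite (stab_star he) stab_mul_eq cstarM cstarK.
have -> : a^† · a · (a^† · a) = a^† · (a · a^†) · a by rewrite !cmulA.
by rewrite -(stab_mul_eq 0 i 0) -(stab_mul_eq 0 i i) -(stab_mul_eq i i i) h !(cmul0r, cmulr0).
Qed.

(** The finite matrices are only an increasing union of finite-dimensional algebras, so each
    projection is treated at a fixed size. A frame of the unit of [D], repeated along the diagonal,
    is a minimal family there. *)
Lemma mxfin_bsys (D : set A) r (P : 'I_r -> A) : fdset D -> bsys D P ->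
  bsys (mxfin D) (fun y => e 0%N 0%N (P y)).
Proof.
move=> fD bD; have hD := bs_sub bD.
have corner y z b : mxfin D b -> exists2 a, D a &
    e 0%N 0%N (P y) · b · e 0%N 0%N (P z) = e 0%N 0%N (P y · a · P z).
  move=> [k /(mxsub_widen hD (leqnSn k))[a Da ->]].
  by exists (a 0%N 0%N) => //; rewrite stab_mxe_stab.
split.
- exact: mxfin_subalg.
- by move=> y; apply: mxfin_unit => //; apply: (bs_in bD).
- by move=> y; apply: (star_hom_proj (stab_diag_hom 0)); apply: (bs_proj bD).
- by move=> y /stab_diag_inj; apply: (bs_neq0 bD).
- move=> y b /(corner y y)[a Da ->]; have [k ->] := bs_corner bD y Da.
  by exists k; rewrite stabZ.
- move=> y z b yz /(corner y z)[a Da ->]; rewrite (bs_off bD)// stab0//.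
(* The size [k.+1] ensures that slot 0, which carries the reference projections, is present. *)
- move=> q [k /(mxsub_widen hD (leqnSn k)) Eq] qq.
  have [u [Du uu ux]] := fd_unit hD fD.
  have [n [cl [s fs]]] := bs_frame bD Du uu.
  have ss j : s j · P (cl j) = s j := frame_source bD j fs.
  have Ds j : D (s j) := frame_in fs j.
  have sso i j : i != j -> (s i)^† · s j = 0.
    by move=> ij; rewrite (frame_orth fs) (negbTE ij).
  have sse j : (s j)^† · s j = P (cl j) by rewrite (frame_orth fs) eqxx.
  pose I : finType := ('I_k.+1 * 'I_n)%type.
  pose p (t : I) := e t.1 t.1 (s t.2 · (s t.2)^†).
  pose v (t : I) := e t.1 0%N (s t.2).
  have hk := mxsub_subalg k.+1 hD.
  have Dss j : D (s j · (s j)^†) by apply: (subalgM hD) => //; apply: (subalgS hD).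
  have vp t : [/\ mxsub k.+1 D (v t), (v t)^† · v t = e 0%N 0%N (P (cl t.2)) &
                  v t · (v t)^† = p t].
    split; first exact: mxsub_unit.
      by rewrite (stab_star he) stab_mul_eq sse.
    by rewrite (stab_star he) stab_mul_eq.
  have mp : minfam (mxsub k.+1 D) p.
    split.
    - by move=> t; apply: mxsub_unit.
    - by move=> t; apply: (star_hom_proj (stab_diag_hom _));
        apply: piso_range (sse _) (bs_proj bD _).
    - move=> t /stab_diag_inj pt0; apply: (bs_neq0 bD (cl t.2)).
      by rewrite -sse (mul_cstar_eq0 pt0) cmulr0.
    - move=> [i j] [i' j'] ij; rewrite /p stab_mulE; case: eqP => //= ii'.
      rewrite cmulA -(cmulA (s j)) sso ?cmulr0 ?cmul0r ?stab0//.
      by apply: contraNneq ij => ->; apply/eqP; congr (_, _); apply: val_inj.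
    - move=> [i j] _ [a Da ->]; rewrite /p stab_mxe_stab//=.
      have [c hc] : exists c : C, (s j)^† · a i i · s j = c *: P (cl j).
        have [c hc] := bs_corner bD (cl j) (subalgM hD (subalgM hD (subalgS hD (Ds j)) (Da i i)) (Ds j)).
        exists c; rewrite -hc -{2}(ss j) -{1}(ss j) cstarM (bs_proj bD _).2 !cmulA.
        by [].
      exists c; rewrite -stabZ; congr (e _ _ _).
      by rewrite !cmulA -(cmulA (s j)) -(cmulA (s j)) hc cmulZr cmulZl ss.
    - move=> _ [a Da ->]; rewrite cmul_suml /mxe.
      rewrite -(pair_big xpredT xpredT (fun (i : 'I_k.+1) j =>
         e i i (s j · (s j)^†) · mxe k.+1 a)) /=.
      apply: eq_bigr => i _; rewrite -cmul_suml -stab_sum -(frame_sum fs).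
      by rewrite stab_mul_mxe//; apply: eq_bigr => j _; rewrite (ux _ (Da i j)).1.
  have Pp y : is_proj (e 0%N 0%N (P y)).
    by apply: (star_hom_proj (stab_diag_hom _)); apply: (bs_proj bD).
  have [m [cl' [t [tin to tq]]]] :=
    frame_of_minfam hk mp (mxsub_fd _ fD) Pp vp Eq qq.
  by exists m, cl', t; split=> // j; exists k.+1.
Qed.

End Stabilization.

Section Levels.
Variable R : realType.
Local Notation C := R[i].

Lemma fdset_full (D : cstarType R) : finite_dimensional D -> fdset [set: D].
Proof. by move=> [n [e he]]; exists n, e => a _. Qed.

Lemma full_subalg (D : cstarType R) : star_subalg [set: D].
Proof. by []. Qed.

Lemma range_subalg (D D' : cstarType R) (f : D -> D') : star_hom f -> star_subalg (range f).
Proof.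
move=> hf; split=> [|_ _ [a _ <-] [b _ <-]|k _ [a _ <-]|_ _ [a _ <-] [b _ <-]|_ [a _ <-]].
- by exists 0 => //; rewrite star_hom0.
- by exists (a + b) => //; rewrite star_homD.
- by exists (k *: a) => //; rewrite star_homZ.
- by exists (a · b) => //; rewrite (star_hom_mul hf).
- by exists a^† => //; rewrite (star_hom_star hf).
Qed.

Lemma range_fd (D D' : cstarType R) (f : D -> D') : star_hom f -> fdset [set: D] ->
  fdset (range f).
Proof.
move=> hf [n [e he]]; exists n, (f \o e) => _ [a _ <-].
have [k ->] := he a I; exists k; rewrite star_hom_sum//.
by apply: eq_bigr => i _; rewrite star_homZ.
Qed.

Lemma frame_hom (D D' : cstarType R) (f : D -> D') (E : set D) (E' : set D') (Y J : finType)
    (P : Y -> D) (cl : J -> Y) s q :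
  star_hom f -> (forall x, E x -> E' (f x)) ->
  frame E P cl s q -> frame E' (f \o P) cl (f \o s) (f q).
Proof.
move=> hf fE fs; split=> [j|i j|] /=.
- exact/fE/(frame_in fs).
- rewrite -(star_hom_star hf) -(star_hom_mul hf) (frame_orth fs).
  by case: ifP => // _; rewrite star_hom0.
- rewrite (frame_sum fs) star_hom_sum//; apply: eq_bigr => j _.
  by rewrite (star_hom_mul hf) (star_hom_star hf).
Qed.

Lemma bsys_image (D D' : cstarType R) (f : D -> D') r (P : 'I_r -> D) :
  star_hom f -> injective f -> bsys [set: D] P -> bsys (range f) (f \o P).
Proof.
move=> hf fi bs; split.
- exact: range_subalg.
- by move=> y; exists (P y).
- by move=> y; apply: star_hom_proj => //; apply: (bs_proj bs).
- by move=> y /=; rewrite -(star_hom0 hf) => /fi; apply: (bs_neq0 bs).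
- move=> y _ [a _ <-] /=; have [k hk] := @bs_corner _ _ _ _ _ bs y a I.
  by exists k; rewrite -!(star_hom_mul hf) hk star_homZ.
- move=> y z _ yz [a _ <-] /=.
  by rewrite -!(star_hom_mul hf) (bs_off bs)// star_hom0.
- move=> _ [q _ <-] [fqq fqs].
  have qq : is_proj q.
    by split; apply: fi; rewrite ?(star_hom_mul hf) ?(star_hom_star hf).
  have [n [cl [s fs]]] := bs_frame bs (q := q) I qq.
  by exists n, cl, (f \o s); apply: frame_hom hf _ fs => x _; exists x.
Qed.

Lemma hasrk_P (D : cstarType R) (E : set D) r (P : 'I_r -> D) y :
  bsys E P -> hasrk E P (P y) (col y 1%:M).
Proof.
move=> bs; exists unit, (fun=> y), (fun=> P y); split; last first.
  by apply/colP => z; rewrite !mxE (big_pred1 tt) => [|[]//]; rewrite eq_sym; case: (z == y).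
have [PP Ps] := bs_proj bs y.
split=> [_|[] []|]; first exact: (bs_in bs).
  by rewrite eqxx Ps.
by rewrite (big_pred1 tt) => [|[]//]; rewrite Ps PP.
Qed.

Lemma hasrk_transport (B B' : cstarType R) (E : set B) (E' : set B') r
    (P : 'I_r -> B) (f : B -> B') q v :
  bsys E P -> bsys E' (f \o P) -> star_hom f -> (forall x, E x -> E' (f x)) ->
  hasrk E P q v -> hasrk E' (f \o P) (f q) v.
Proof.
move=> bs bs' hf fE hv; rewrite -[v]mul1mx.
by apply: (hasrk_hom bs bs') => // y; apply: (hasrk_P y bs').
Qed.

(** The left inverse [p] maps a frame of [f (P i)] to pieces of [P i]; by minimality exactly one
    piece [j0] survives, and it is all of [P i]. Its class is the row sought: a second piece of this
    class in [f (P i)] would survive too, and one in [f (P l)] would make [P l] equivalent to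
    [P i]. *)
Lemma left_invertible_row (D D' : cstarType R) (f : D -> D') (Y : finType) r'
    (P : Y -> D) (P' : 'I_r' -> D') (i : Y) :
  left_invertible f -> (forall y, is_proj (P y)) -> (forall y, P y <> 0) ->
  (forall y x, exists k : C, P y · x · P y = k *: P y) ->
  (forall y z x, y != z -> P y · x · P z = 0) -> bsys [set: D'] P' ->
  exists k, forall j v, hasrk [set: D'] P' (f (P j)) v -> v k ord0 = ((i == j) : nat).
Proof.
move=> [hf [p hp pf]] Ppr P0 Pc Po bs'.
have hM y : exists v, hasrk [set: D'] P' (f (P y)) v.
  by apply: (hasrk_exists bs') => //; apply: star_hom_proj.
have pfE x : p (f x) = x by have /(congr1 (@^~ x)) := pf.
have pframe y (J : finType) (cl : J -> 'I_r') (s : J -> D') : frame setT P' cl s (f (P y)) ->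
    frame setT (p \o P') cl (p \o s) (P y) /\ forall j, P y · p (s j) = p (s j).
  move=> fs; split.
    by rewrite -(pfE (P y)); apply: frame_hom hp _ fs.
  by move=> j; rewrite -{1}(pfE (P y)) -(star_hom_mul hp) (frame_mul bs' _ fs).
have pp z : is_proj (p (P' z)) by apply: star_hom_proj => //; apply: (bs_proj bs').
have [_ [J [cl [s [fs _]]]]] := hM i.
have [ps Pps] := pframe _ _ _ _ fs; pose a j := p (s j).
have aa j : (a j)^† · a j = p (P' (cl j)) by have := frame_orth ps j j; rewrite eqxx.
have [j0 a0] : exists j, a j <> 0.
  apply: contrapT => h; apply: (P0 i); rewrite (frame_sum ps) big1// => j _.
  have -> : (p \o s) j = 0 by apply: contrapT => aj; apply: h; exists j.
  by rewrite cmul0r.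
have aP : a j0 · (a j0)^† = P i.
  have pr : is_proj (a j0 · (a j0)^†) := piso_range (aa j0) (pp _).
  have [k hk] := Pc i (a j0 · (a j0)^†).
  have {}hk : a j0 · (a j0)^† = k *: P i.
    rewrite -hk cmulA Pps -cmulA; congr (_ · _); apply: cstar_inj.
    by rewrite cstarM cstarK (Ppr i).2 Pps.
  have kk : k * k = k.
    apply: (scaleC_inj (P0 i)); rewrite -[RHS]hk -pr.1 hk cmulZl cmulZr.
    by rewrite scalerA (Ppr i).1.
  have k0 : k != 0.
    by apply/eqP => k0; apply: a0; apply: mul_cstar_eq0; rewrite hk k0 scale0r.
  by rewrite hk (_ : k = 1) ?scale1r//; apply: (mulfI k0); rewrite kk mulr1.
have auniq j : j != j0 -> a j = 0.
  move=> jj0; apply: cstar_inj; rewrite cstar0.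
  have -> : (a j)^† = (a j)^† · P i.
    by apply: cstar_inj; rewrite cstarM !cstarK (Ppr i).2 Pps.
  rewrite -aP cmulA; have := frame_orth ps j j0; rewrite (negbTE jj0) /= => ->.
  by rewrite cmul0r.
have hi : hasrk [set: D'] P' (f (P i)) (cnt cl) by exists J, cl, s.
exists (cl j0) => l w hw; have [li|il] := eqVneq i l.
  subst l; rewrite (hasrk_unique bs' hw hi) mxE.
  rewrite (bigD1 j0)//= eqxx big1 ?addn0// => j jj0; case: eqP => // cjj.
  by exfalso; apply: a0; apply: cstar_mul_eq0; rewrite aa -cjj -aa (auniq _ jj0) cmulr0.
have [K [cl' [t [ft <-]]]] := hw; rewrite mxE big1// => k _.
case: eqP => // ckj; exfalso; apply: a0.
have [pt Ppt] := pframe _ _ _ _ ft; pose b := p (t k).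
have bb : b^† · b = (a j0)^† · a j0.
  by have := frame_orth pt k k; rewrite eqxx /= ckj aa.
have aPi : P i · a j0 = a j0 := Pps j0; have bPl : P l · b = b := Ppt k.
have c0 : a j0 · b^† = 0.
  by rewrite -aPi -bPl cstarM (Ppr l).2 !cmulA -(cmulA (P i)) Po.
by rewrite -aPi -aP -cmulA -bb cmulA c0 cmul0r.
Qed.

Lemma hasrk_mvn (D : cstarType R) (E : set D) r (P : 'I_r -> D) w v :
  bsys E P -> E w -> hasrk E P (w^† · w) v -> hasrk E P (w · w^†) v.
Proof.
move=> bs Ew hv; have pw := hasrk_proj bs hv; have [J [cl [s [fs <-]]]] := hv.
have ws j : w^† · w · s j = s j := frame_mul bs j fs.
exists J, cl, (fun j => w · s j); split=> //; split=> [j|i j|].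
- by apply: (subalgM (bs_sub bs)) => //; apply: (frame_in fs).
- by rewrite cstarM cmulA -(cmulA _^† w^†) -cmulA ws (frame_orth fs).
- rewrite -{1}(piso_mul_source (a := w) erefl pw) {1}(frame_sum fs).
  rewrite cmul_sumr cmul_suml; apply: eq_bigr => j _.
  by rewrite cstarM !cmulA.
Qed.

Lemma hasrk_sum (D : cstarType R) (E : set D) r (P : 'I_r -> D) (I : finType)
    (Q : pred I) (F : I -> D) (v : I -> 'cV[nat]_r) :
  bsys E P -> (forall i, Q i -> hasrk E P (F i) (v i)) ->
  (forall i j, Q i -> Q j -> i != j -> F i · F j = 0) ->
  hasrk E P (\sum_(i | Q i) F i) (\sum_(i | Q i) v i).
Proof.
move=> bs hF oF.
have : uniq (index_enum I) := index_enum_uniq I.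
elim: (index_enum I) => [|i s IH]; first by rewrite !big_nil => _; apply: hasrk0.
move=> /= /andP[si us]; rewrite !big_cons; case: ifP => Qi; last exact: IH.
apply: hasrkD => //; [exact: hF|exact: IH|].
rewrite cmul_sumr big_seq_cond big1// => j /andP[js Qj]; apply: oF => //.
by apply: contraNneq si => ->.
Qed.

Lemma closed_line (B : cstarType R) (p : B) : is_proj p ->
  closed [set x : B | exists k : C, x = k *: p].
Proof.
move=> pp; have [->|/eqP p0] := eqVneq p 0.
  move=> x /closure_nrmP cx; exists 0; rewrite scale0r.
  by apply: nrm_small_eq0 => d /cx[_ [k ->]]; rewrite scaler0 subr0.
move=> x /closure_nrmP cx.
have /choice[k hk] n : exists k : C, nrm (x - k *: p) < (1 / 2) ^+ n.
  by have [|_ [k ->] h] := cx ((1 / 2) ^+ n); [rewrite exprn_gt0//; lra|exists k].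
have dk m n : nrm (k m - k n) <= nrm (x - k m *: p) + nrm (x - k n *: p).
  have -> : nrm (k m - k n) = nrm ((k m - k n) *: p).
    by rewrite nrmZ (nrm_proj pp p0) mulr1.
  by rewrite scalerBl (le_trans (nrm_distD x _ _))// (nrm_distC _ x).
have [|||l kl] := geom_tends (V := ccstar R) (u := k) (K := 2) (q := 1 / 2).
- lra.
- lra.
- move=> n; rewrite (le_trans (dk _ _))//; have := hk n; have := hk n.+1; rewrite exprS.
  have := exprn_gt0 n (x := 1 / 2 : R) ltac:(lra); set t := _ ^+ n; nra.
exists l; apply: (tends_unique (u := fun n => k n *: p)); last first.
  by apply: (tends_dom (K := 1) kl) => n; rewrite -scalerBl nrmZ (nrm_proj pp p0) mulr1 mul1r.
apply: (tends_bound (b := fun n => (1 / 2) ^+ n)) => [n|e e0].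
  by rewrite nrm_distC ltW.
by apply: geom_lt => //; lra.
Qed.

(** A limit [x] satisfies x = u x u for the unit [u] of [E]. Cutting [u] along a frame reduces to
    the elements s_i† x s_j, which are limits in complex lines, and lines are closed. *)
Lemma fd_closed (B : cstarType R) (E : set B) : star_subalg E -> fdset E -> closed E.
Proof.
move=> hE fE; have [r [P bs]] := fd_bsys hE fE; have [u [Eu uu ux]] := fd_unit hE fE.
have [n [cl [s fs]]] := bs_frame bs Eu uu.
have Es j : E (s j) := frame_in fs j.
move=> x /closure_nrmP cx.
have lip y z (a b : B) : nrm (y · a · z - y · b · z) <= nrm y * nrm z * nrm (a - b).
  rewrite -cmulBl -cmulBr (le_trans (nrm_cmul _ _))//.
  have := nrm_cmul y (a - b); have := nrm_ge0 z; nra.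
have approx y z (F : set B) : closed F -> (forall a, E a -> F (y · a · z)) -> F (y · x · z).
  move=> cF EF; apply: cF; apply/closure_nrmP => d d0.
  have K0 : 0 < nrm y * nrm z + 1 by rewrite ltr_wpDl// mulr_ge0 ?nrm_ge0.
  have [a Ea xa] := cx _ (divr_gt0 d0 K0).
  exists (y · a · z); first exact: EF.
  rewrite (le_lt_trans (lip _ _ _ _))//; move: xa; rewrite ltr_pdivlMr//.
  by have := nrm_ge0 (x - a); nra.
have xE : x = u · x · u.
  apply/esym/subr0_eq/nrm_small_eq0 => d d0.
  have K0 : 0 < nrm u * nrm u + 1 by rewrite ltr_wpDl// mulr_ge0 ?nrm_ge0.
  have [a Ea xa] := cx _ (divr_gt0 d0 K0).
  rewrite (le_lt_trans (nrm_distD a _ _))//.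
  have [ua au] := ux a Ea; have := lip u u x a; rewrite ua au (nrm_distC a).
  by move: xa; rewrite ltr_pdivlMr//; have := nrm_ge0 (x - a); nra.
rewrite xE (frame_sum fs) !cmul_suml; apply: (subalg_sum hE) => i _.
rewrite cmul_sumr; apply: (subalg_sum hE) => j _.
have -> : s i · (s i)^† · x · (s j · (s j)^†) = s i · ((s i)^† · x · s j) · (s j)^†.
  by rewrite !cmulA.
apply: (subalgM hE); last exact: (subalgS hE).
apply: (subalgM hE) => //.
have [k ->] : exists k : C, (s i)^† · x · s j = k *: P (cl i).
  apply: (approx _ _ [set y | exists k : C, y = k *: P (cl i)]).
    exact: closed_line (bs_proj bs _).
  move=> a Ea; have [ij|ij] := eqVneq (cl i) (cl j).
    have [k hk] := bs_corner bs (cl i) (subalgM hE (subalgM hE (subalgS hE (Es i)) Ea) (Es j)).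
    exists k; rewrite -hk -(frame_source bs i fs) cstarM (bs_proj bs _).2 !cmulA.
    rewrite (bs_proj bs _).1 -(cmulA _ (s j)) ij (frame_source bs j fs)//.
  exists 0; rewrite scale0r -(frame_source bs i fs) -(frame_source bs j fs) cstarM.
  rewrite (bs_proj bs _).2 !cmulA -(cmulA (P _)) -(cmulA (P _)) (bs_off bs)//.
  by apply: (subalgM hE) => //; apply: (subalgM hE) => //; apply: (subalgS hE).
by apply: (subalgZ hE); apply: (bs_in bs).
Qed.

End Levels.

(** * Cuntz comparison of projections *)

Section Cuntz.
Variables (R : realType) (B : cstarType R).
Local Notation C := R[i].
Implicit Types (a b c p q x y z : B).

Lemma cuntz_subP a b : cuntz_sub a b <->
  forall d : R, 0 < d -> exists z, nrm (z · b · z^† - a) < d.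
Proof.
split=> [[z /tends_cvg za] d /za[N hN]|h]; first by exists (z N); apply: hN.
have /choice[z hz] n : exists z, nrm (z · b · z^† - a) < (1 / 2) ^+ n.
  by apply: h; rewrite exprn_gt0//; lra.
exists z; apply/tends_cvg; apply: (tends_bound (b := fun n => (1 / 2) ^+ n)) => [n|d d0].
  exact: ltW.
by apply: geom_lt => //; lra.
Qed.

Lemma cuntz_sub_exact z b : cuntz_sub (z · b · z^†) b.
Proof. by apply/cuntz_subP => d d0; exists z; rewrite subrr nrm0. Qed.

Lemma cuntz_sub_closed a b :
  (forall d : R, 0 < d -> exists2 a', nrm (a - a') < d & cuntz_sub a' b) -> cuntz_sub a b.
Proof.
move=> h; apply/cuntz_subP => d d0; have d2 : 0 < d / 2 by rewrite divr_gt0.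
have [a' aa' /cuntz_subP/(_ _ d2)[z hz]] := h _ d2; exists z.
by rewrite (le_lt_trans (nrm_distD a' _ _))// [d]splitr ltrD// nrm_distC.
Qed.

Lemma cuntz_sub_trans b a c : cuntz_sub a b -> cuntz_sub b c -> cuntz_sub a c.
Proof.
move=> /cuntz_subP ab /cuntz_subP bc; apply/cuntz_subP => d d0.
have d2 : 0 < d / 2 by rewrite divr_gt0.
have [z hz] := ab _ d2; have K0 : 0 < nrm z ^+ 2 + 1 by rewrite ltr_wpDl// sqr_ge0.
have [w hw] := bc _ (divr_gt0 d2 K0); exists (z · w).
rewrite (le_lt_trans (nrm_distD (z · b · z^†) _ _))// [ltRHS]splitr ltrD//.
have -> : z · w · c · (z · w)^† - z · b · z^† = z · (w · c · w^† - b) · z^†.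
  by rewrite cmulBr cmulBl cstarM !cmulA.
move: hw; rewrite ltr_pdivlMr// => hw; rewrite (le_lt_trans (nrm_conjugate _ _))//.
by have := nrm_ge0 (w · c · w^† - b); have := sqr_ge0 (nrm z); nra.
Qed.

(* Newton-Schulz iteration: for t = 1 + (q - y)/2 the distance of t y t to q is
   at most the square of the distance of y to q. *)
Lemma proj_near_sub q y : is_proj q -> y^† = y -> q · y = y -> nrm (q - y) < 1 ->
  cuntz_sub q y.
Proof.
move=> [qq qs] ys qy d1.
have step x : x^† = x -> q · x = x -> exists t, [/\ (t · x · t^†)^† = t · x · t^†,
    q · (t · x · t^†) = t · x · t^† & nrm (q - t · x · t^†) <= nrm (q - x) ^+ 2 * (3 / 4 + 1 / 4 * nrm (q - x))].
  move=> xs qx; pose h : C := 2^-1; pose w := q - x; pose t := q + h *: w.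
  have xq : x · q = x by rewrite -{1}xs -{1}qs -cstarM qx xs.
  have hc : h^*%R = h by rewrite /h fmorphV rmorph_nat.
  have wq : w · q = w by rewrite cmulBl qq xq.
  have qw : q · w = w by rewrite cmulBr qq qx.
  have ws : w^† = w by rewrite cstarB qs xs.
  have ts : t^† = t by rewrite cstarD cstarZ hc qs ws.
  have qt : q · t = t by rewrite cmulDr cmulZr qq qw.
  have xE : x = q - w by rewrite /w opprB addrC subrK.
  exists t; split.
  - by rewrite !cstarM cstarK xs cmulA.
  - by rewrite !cmulA qt.
  - have wE : w = h *: w + h *: w by rewrite -scalerDl /h -[2^-1]mul1r -splitr scale1r.
    have tq : t · q = t by rewrite cmulDl cmulZl qq wq.
    have tx : t · x = q - h *: w - h *: (w · w).
      rewrite {1}xE cmulBr tq /t cmulDl cmulZl qw {2}wE.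
      by rewrite [- (_ + _ + _)]opprD addrA [- (_ + _)]opprD addrA addrK.
    have qt' : (q - h *: w) · t = q - h *: (h *: (w · w)).
      rewrite cmulDr cmulBl qq cmulZl wq cmulZr cmulBl qw cmulZl.
      by rewrite [h *: (w - _)]scalerBr addrA subrK.
    (* In terms of w = q - x this is 3/4 w² + 1/4 w³, the origin of the constants. *)
    have -> : q - t · x · t^† = h *: (h *: (w · w)) + h *: (w · w · t).
      by rewrite ts tx cmulBl qt' cmulZl -addrA -opprD opprB addrC subrK.
    have wwt : w · w · t = w · w + h *: (w · w · w) by rewrite cmulDr -(cmulA w w q) wq cmulZr.
    have nh : nrm h = 2^-1.
      by rewrite /h -(rmorph_nat (real_complex R) 2) -fmorphV nrm_real ger0_norm// invr_ge0.
    have n2 : nrm (w · w) <= nrm w ^+ 2 by rewrite expr2 nrm_cmul.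
    have n3 : nrm (w · w · w) <= nrm w ^+ 2 * nrm w.
      by rewrite (le_trans (nrm_cmul _ _))// ler_wpM2r ?nrm_ge0.
    have n4 : nrm (w · w · t) <= nrm w ^+ 2 + 2^-1 * (nrm w ^+ 2 * nrm w).
      rewrite wwt (le_trans (nrmD _ _))// nrmZ nh; lra.
    rewrite (le_trans (nrmD _ _))// !nrmZ nh -/w; move: n2 n4.
    by set d := nrm w ^+ 2; set v := nrm w; nra.
have d0 := nrm_ge0 (q - y).
have iter_step n : exists t, [/\ (t · y · t^†)^† = t · y · t^†,
    q · (t · y · t^†) = t · y · t^† & nrm (q - t · y · t^†) <= nrm (q - y) ^+ n.+1].
  have yq : y · q = y by rewrite -{1}ys -{1}qs -cstarM qy ys.
  elim: n => [|n [t [ts qt td]]]; first by exists q; rewrite qs qy yq ys qy expr1.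
  have [t' [ts' qt' td']] := step _ ts qt; exists (t' · t).
  have -> : t' · t · y · (t' · t)^† = t' · (t · y · t^†) · t'^† by rewrite cstarM !cmulA.
  split=> //; rewrite (le_trans td')// exprS.
  have v0 := nrm_ge0 (q - t · y · t^†).
  have vd : nrm (q - t · y · t^†) <= nrm (q - y).
    by rewrite (le_trans td)// exprS ler_piMr// exprn_ile1// ltW.
  have h1 : nrm (q - t · y · t^†) ^+ 2 <= nrm (q - y) * nrm (q - y) ^+ n.+1.
    by rewrite expr2 ler_pM.
  rewrite -[leRHS]mulr1 ler_pM ?sqr_ge0//; lra.
apply/cuntz_subP => d dp; have [N hN] := geom_lt d0 d1 dp.
have [t [_ _ tN]] := iter_step N; exists t; rewrite nrm_distC (le_lt_trans tN)//.
by apply: hN; apply: leqnSn.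
Qed.

(** Compressing z b z† by [q] places it under [q] without increasing the distance to [q]. *)
Lemma proj_sub_of_near q b z : is_proj q -> b^† = b ->
  nrm (q - z · b · z^†) < 1 -> cuntz_sub q b.
Proof.
move=> pq bs d1; have [qq qs] := pq.
have E : q · (z · b · z^†) · q = (q · z) · b · (q · z)^† by rewrite cstarM qs !cmulA.
apply: (cuntz_sub_trans (b := (q · z) · b · (q · z)^†)); last exact: cuntz_sub_exact.
rewrite -E; apply: proj_near_sub => //.
- by rewrite !cstarM cstarK qs bs !cmulA.
- by rewrite !cmulA qq.
have -> : q - q · (z · b · z^†) · q = q · (q - z · b · z^†) · q^†.
  by rewrite qs cmulBr cmulBl !qq.
apply: le_lt_trans d1; rewrite (le_trans (nrm_conjugate _ _))//.
by rewrite ler_piMl ?nrm_ge0// exprn_ile1 ?nrm_ge0 ?nrm_proj_le1.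
Qed.

(** Projections are compact for Cuntz comparison: |q - z x z†| < 1 is an open condition on [x], and
    it implies comparison. *)
Lemma proj_sub_approx q x (u : nat -> B) : is_proj q -> cuntz_sub q x ->
  tends u x -> (forall n, (u n)^† = u n) ->
  exists N, forall n, (N <= n)%N -> cuntz_sub q (u n).
Proof.
move=> pq /cuntz_subP/(_ (1 / 2) ltac:(lra))[z hz] ux us.
have K0 : 0 < 2 * (nrm z ^+ 2 + 1) by rewrite mulr_gt0// ltr_wpDl// sqr_ge0.
have [N hN] := ux (2 * (nrm z ^+ 2 + 1))^-1 ltac:(by rewrite invr_gt0).
exists N => n /hN h; apply: (proj_sub_of_near (z := z)) => //.
rewrite (le_lt_trans (nrm_distD (z · x · z^†) _ _))// nrm_distC.
have -> : z · x · z^† - z · u n · z^† = z · (x - u n) · z^† by rewrite cmulBr cmulBl.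
have := nrm_conjugate z (x - u n); rewrite (nrm_distC x).
move: h; rewrite -[_^-1]mul1r ltr_pdivlMr//; have := nrm_ge0 (u n - x).
have := sqr_ge0 (nrm z); nra.
Qed.

(** The triangle inequality for the power 2^m costs a factor [n], which [pow2_le] removes. *)
Lemma nrm_orth_sum n (l : 'I_n -> R) (p : 'I_n -> B) (Q : pred 'I_n) (K : R) :
  (forall i, is_proj (p i)) -> (forall i j, i != j -> p i · p j = 0) -> 0 <= K ->
  (forall i, Q i -> `|l i| <= K) -> nrm (\sum_(i | Q i) (l i)%:C *: p i) <= K.
Proof.
move=> pp po K0 lK; set a := \sum_(i | Q i) _.
have sa : a^† = a.
  by rewrite cstar_sum; apply: eq_bigr => i _; rewrite cstarZ conj_real (pp i).2.
have pow m : sqn m a = \sum_(i | Q i) (l i ^+ (2 ^ m))%:C *: p i.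
  elim: m => [|m IH] /=; first by apply: eq_bigr => i _; rewrite expr1.
  rewrite IH cmul_suml; apply: eq_bigr => i Qi; rewrite cmul_sumr (bigD1 i)//=.
  rewrite big1 ?addr0 => [|j /andP[_ ji]]; last first.
    by rewrite cmulZl cmulZr po ?scaler0// eq_sym.
  by rewrite cmulZl cmulZr (pp i).1 scalerA -rmorphM/= -exprD addnn -mul2n -expnS.
apply: (pow2_le (K := n%:R)) => [||m]; rewrite ?nrm_ge0//.
rewrite -nrm_sqn// pow (le_trans (nrm_sum _ _ _))//.
rewrite (@le_trans _ _ (\sum_(i < n) K ^+ (2 ^ m)))//; last first.
  by rewrite sumr_const card_ord mulr_natl.
rewrite big_mkcond; apply: ler_sum => i _; case: ifPn => Qi; last exact: exprn_ge0.
rewrite nrmZ nrm_real normrX -[leRHS]mulr1 ler_pM ?nrm_ge0 ?exprn_ge0//.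
  by apply: lerXn2r; rewrite ?nnegrE// lK.
exact: nrm_proj_le1.
Qed.

End Cuntz.

(** * Positive elements as limits of projections *)

Section Canonical.
Variables (R : realType) (B : cstarType R) (lv : nat -> set B).
Local Notation C := R[i].
Hypothesis lv_sub : forall n, star_subalg (lv n).
Hypothesis lv_mono : forall n m x, (n <= m)%N -> lv n x -> lv m x.
Hypothesis lv_dense : forall (b : B) (d : R), 0 < d -> exists n x, lv n x /\ nrm (b - x) < d.
Hypothesis lv_loc : forall n b, lv n b ->
  exists E, [/\ star_subalg E, fdset E, E b & forall x, E x -> lv n x].

Definition lproj (q : B) : Prop := exists2 n, lv n q & is_proj q.

Lemma diag_mul n (p : 'I_n -> B) (c d : 'I_n -> R) (Q Q' : pred 'I_n) :
  (forall i, is_proj (p i)) -> (forall i j, i != j -> p i · p j = 0) ->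
  (\sum_(i | Q i) (c i)%:C *: p i) · (\sum_(i | Q' i) (d i)%:C *: p i) =
  \sum_(i | Q i && Q' i) (c i * d i)%:C *: p i.
Proof.
move=> pp po; rewrite cmul_suml big_mkcondr; apply: eq_bigr => i _.
rewrite cmul_sumr; case: ifPn => Qi.
  rewrite (bigD1 i)//= big1 ?addr0 => [|j /andP[_ ji]].
    by rewrite cmulZl cmulZr (pp i).1 scalerA rmorphM.
  by rewrite cmulZl cmulZr po ?scaler0// eq_sym.
rewrite big1// => j Qj; have ij : i != j by apply: contraNneq Qi => ->.
by rewrite cmulZl cmulZr po ?scaler0.
Qed.

(** [x] is within [d] of a positive [a] in a finite-dimensional algebra; [q] is the spectral
    projection of [a] for eigenvalues at least 2d, and x' the corresponding part of [a]. Since q = h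
    a h† with |h|² at most 1/(2d), q - h x h† has norm at most 1/2, so [q] lies below [x]. The total
    error is less than d + 2d. *)
Lemma canonical_step (x : B) (d : R) : positive x -> 0 < d ->
  exists x' q, [/\ x'^† = x', nrm (x - x') < 4 * d, lproj q, cuntz_sub q x & cuntz_sub x' q].
Proof.
(* [K] bounds |b| + |b'| as soon as |b - b'| < 1, and the product of this sum with |b - b'| bounds
   |x - a|. *)
move=> [b xE] d0; pose K := 2 * nrm b + 1.
have K0 : 0 < K by rewrite ltr_wpDl// mulr_ge0// nrm_ge0.
have m0 : 0 < Num.min 1 (d / K) by rewrite lt_min ltr01 divr_gt0.
have [n [b' [b'n]]] := lv_dense b m0; rewrite lt_min ltr_pdivlMr// => /andP[bb1 bbK].
have [E [hE fE Eb' EF]] := lv_loc b'n.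
have [m [l [p [lp po aE]]]] := pos_spectral hE fE Eb'.
set a := b'^† · b' in aE.
have pp i : is_proj (p i) by have [] := lp i.
have l0 i : 0 < l i by have [] := lp i.
have xa : nrm (x - a) < d.
  have -> : x - a = b^† · (b - b') + (b - b')^† · b'.
    by rewrite cmulBr cstarB cmulBl addrA subrK xE.
  rewrite (le_lt_trans (nrmD _ _))//.
  have := nrm_cmul b^† (b - b'); have := nrm_cmul (b - b')^† b'; rewrite !nrm_cstar.
  have := nrm_le_dist b' b; rewrite nrm_distC; have := nrm_ge0 (b - b').
  by move: bbK; rewrite /K; have := nrm_ge0 b; have := nrm_ge0 b'; nra.
pose Q i := 2 * d <= l i.
have as_ : a^† = a by rewrite cstarM cstarK.
pose x' := \sum_(i | Q i) (l i)%:C *: p i.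
pose q := \sum_(i | Q i) (1 : R)%:C *: p i.
pose h := \sum_(i | Q i) ((Num.sqrt (l i))^-1)%:C *: p i.
pose h' := \sum_(i | Q i) (Num.sqrt (l i))%:C *: p i.
have diag_sa (c : 'I_m -> R) : (\sum_(i | Q i) (c i)%:C *: p i)^† = \sum_(i | Q i) (c i)%:C *: p i.
  by rewrite cstar_sum; apply: eq_bigr => i _; rewrite cstarZ conj_real (pp i).2.
have andQQ i : Q i && Q i = Q i by rewrite andbb.
have x'E : x' = h' · q · h'^†.
  rewrite diag_sa !diag_mul//; apply: eq_big => [i|i Qi]; first by rewrite !andQQ.
  by rewrite mulr1 -expr2 sqr_sqrtr// ltW.
have qproj : is_proj q.
  split; last exact: diag_sa.
  by rewrite diag_mul//; apply: eq_big => [i|i _]; rewrite ?andQQ// mulr1.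
have qE : q = h · a · h^†.
  rewrite diag_sa aE (diag_mul _ _ _ predT)// diag_mul//.
  apply: eq_big => [i|i Qi]; first by rewrite andbT andQQ.
  rewrite mulrAC -invfM -expr2 sqr_sqrtr ?ltW// mulVf// gt_eqF//.
have nh : nrm h ^+ 2 <= (2 * d)^-1.
  have d20 : 0 < 2 * d by rewrite mulr_gt0.
  have <- : Num.sqrt (2 * d)^-1 ^+ 2 = (2 * d)^-1 by rewrite sqr_sqrtr// invr_ge0 ltW.
  rewrite lerXn2r ?nnegrE ?nrm_ge0 ?sqrtr_ge0//.
  apply: nrm_orth_sum; rewrite ?sqrtr_ge0// => i Qi.
  rewrite ger0_norm ?invr_ge0 ?sqrtr_ge0// sqrtrV; last exact: ltW.
  by rewrite ler_pV2 ?inE ?unitf_gt0 ?sqrtr_gt0//= ler_wsqrtr.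
exists x', q; split.
- exact: diag_sa.
- rewrite (le_lt_trans (nrm_distD a _ _))//.
  suff : nrm (a - x') <= 2 * d by lra.
  have -> : a - x' = \sum_(i | ~~ Q i) (l i)%:C *: p i.
    by rewrite aE (bigID Q)/= -/x' [LHS]addrC addKr.
  apply: nrm_orth_sum => //; first lra.
  by move=> i; rewrite -ltNge => /ltW; rewrite gtr0_norm.
- exists n => //; apply: EF; apply: (subalg_sum hE) => i _; apply: (subalgZ hE).
  by have [] := lp i.
- apply: (proj_sub_of_near (z := h)) => //; first by rewrite xE cstarM cstarK.
  rewrite {1}qE -cmulBl -cmulBr (le_lt_trans (nrm_conjugate _ _))//.
  rewrite nrm_distC; move: nh; rewrite -[leRHS]mul1r ler_pdivlMr ?mulr_gt0//.
  have := nrm_ge0 (x - a); have := sqr_ge0 (nrm h); nra.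
- by rewrite x'E; apply: cuntz_sub_exact.
Qed.

(** It presents [x] as the supremum of the projections [qs] for Cuntz comparison: [xs] tends to [x]
    and is dominated by [qs] term by term. *)
Record canonical (x : B) (xs qs : nat -> B) : Prop := Canonical_ {
  can_tends : tends xs x;
  can_sa : forall k, (xs k)^† = xs k;
  can_proj : forall k, lproj (qs k);
  can_le : forall k, cuntz_sub (qs k) x;
  can_sub : forall k, cuntz_sub (xs k) (qs k);
  can_mono : forall k, cuntz_sub (qs k) (qs k.+1);
}.

Lemma canonical_cofinal x xs qs p : canonical x xs qs -> is_proj p -> cuntz_sub p x ->
  exists N, forall n, (N <= n)%N -> cuntz_sub p (qs n).
Proof.
move=> cx pp px; have [N hN] := proj_sub_approx pp px (can_tends cx) (can_sa cx).
by exists N => n /hN /cuntz_sub_trans; apply; apply: (can_sub cx).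
Qed.

Lemma canonical_sub x xs qs y : canonical x xs qs ->
  (forall k, cuntz_sub (qs k) y) -> cuntz_sub x y.
Proof.
move=> cx qy; apply: cuntz_sub_closed => d /(can_tends cx)[N hN].
exists (xs N); first by rewrite nrm_distC hN.
exact: cuntz_sub_trans (can_sub cx N) (qy N).
Qed.

Lemma canonical_exists (x : B) : positive x -> exists xs qs, canonical x xs qs.
Proof.
move=> px.
have /choice[u hu] k : exists u : B * B, [/\ u.1^† = u.1, nrm (x - u.1) < 4 * (1 / 2) ^+ k,
    lproj u.2, cuntz_sub u.2 x & cuntz_sub u.1 u.2].
  have d0 : 0 < (1 / 2 : R) ^+ k by rewrite exprn_gt0//; lra.
  by have [x' [q h]] := canonical_step px d0; exists (x', q).
have ut : tends (fun k => (u k).1) x.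
  apply: (tends_bound (b := fun k => 4 * (1 / 2) ^+ k)) => [k|d d0].
    by rewrite nrm_distC ltW//; case: (hu k).
  have [|||N hN] := geom_lt (q := 1 / 2) (e := d / 4); [lra|lra|lra|].
  by exists N => n /hN; lra.
have us k : (u k).1^† = (u k).1 by case: (hu k).
have /choice[N hN] k : exists N, forall n, (N <= n)%N -> cuntz_sub (u k).2 (u n).2.
  have [_ _ [n _ pk] qx _] := hu k.
  have [N hN] := proj_sub_approx pk qx ut us; exists N => m /hN /cuntz_sub_trans; apply.
  by case: (hu m).
(* Each index is taken beyond the threshold after which all later projections dominate the current
   one. *)
pose s := fix s k := if k is k'.+1 then maxn (N (s k')) (s k').+1 else 0%N.
have sk k : (k <= s k)%N.
  by elim: k => //= k IH; apply: leq_trans (leq_maxr _ _).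
exists (fun k => (u (s k)).1), (fun k => (u (s k)).2); split=> [|k|k|k|k|k].
- exact: (tends_subseq sk ut).
- exact: us.
- by case: (hu (s k)).
- by case: (hu (s k)).
- by case: (hu (s k)).
- by apply: hN => /=; apply: leq_maxl.
Qed.

End Canonical.

Lemma big_option (V : nmodType) (T : finType) (F : option T -> V) :
  \sum_o F o = F None + \sum_t F (Some t).
Proof.
rewrite (bigD1 None)//=; congr (_ + _).
rewrite (reindex_omap Some id) => [|[]//].
by apply: eq_bigl => t; rewrite eqxx.
Qed.

(** * The stabilized AF-algebra *)

Section AF.
Variables (R : realType) (An : nat -> cstarType R) (f : forall i j, An i -> An j).
Variables (A : cstarType R) (g : forall i, An i -> A).
Hypothesis An_fd : forall i, finite_dimensional (An i).
Hypothesis f_li : forall i j, (i <= j)%N -> left_invertible (@f i j).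
Hypothesis f_id : forall i, @f i i = id.
Hypothesis f_comp : forall i j k, (i <= j)%N -> (j <= k)%N -> @f j k \o @f i j = @f i k.
Hypothesis g_lim : is_star_limit f g.
Variables (B : cstarType R) (e : nat -> nat -> A -> B).
Hypothesis he : is_stabilization e.
Variables (r : nat -> nat) (P : forall n, 'I_(r n) -> An n).
Hypothesis bsP : forall n, bsys [set: An n] (@P n).
Local Notation C := R[i].

Let g_hom i : star_hom (@g i) := limit_hom g_lim i.
Let g_inj i : injective (@g i) := limit_inj f_li f_id f_comp g_lim (i := i).
Let Ds n : star_subalg (range (@g n)) := range_subalg (g_hom n).
Let Dfd n : fdset (range (@g n)) := range_fd (g_hom n) (fdset_full (An_fd n)).

Definition lev (n : nat) : set B := mxfin e (range (@g n)).

Definition levP (n : nat) (y : 'I_(r n)) : B := e 0%N 0%N (g (P y)).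

Local Notation rk n := (hasrk (lev n) (@levP n)).

Lemma bs_lev n : bsys (lev n) (@levP n).
Proof. exact: (mxfin_bsys he (Dfd n) (bsys_image (g_hom n) (@g_inj n) (bsP n))). Qed.

Lemma lev_mono n m x : (n <= m)%N -> lev n x -> lev m x.
Proof.
move=> nm [k [a Da ->]]; exists k, a => // i j; have [x0 _ <-] := Da i j.
by exists (@f n m x0) => //; rewrite (limit_comp g_lim).
Qed.

Lemma lev_dense (b : B) (d : R) : 0 < d -> exists n x, lev n x /\ nrm (b - x) < d.
Proof.
move=> d0; have d2 : 0 < d / 2 by rewrite divr_gt0.
have : closure [set x | exists (n : nat) (a : 'I_n -> 'I_n -> A),
      x = \sum_(i < n) \sum_(j < n) e i j (a i j)] b by rewrite (stab_dense he).
move/closure_nrmP => /(_ _ d2)[_ [n [a ->]] ba].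
(* There are n² entries to approximate; the successor keeps [K] positive and the final inequality
   strict. *)
pose K := (n * n).+1%:R : R; have K0 : 0 < K by rewrite ltr0n.
have /choice[m hm] (u : ('I_n * 'I_n)%type) :
    exists m, exists x : An m, nrm (a u.1 u.2 - g x) < d / 2 / K.
  by apply: (limit_dense g_lim); rewrite divr_gt0.
pose M := (\max_u m u)%N.
have /choice[x hx] u : exists x : An M, nrm (a u.1 u.2 - g x) < d / 2 / K.
  have [x hx] := hm u; exists (@f (m u) M x).
  by rewrite (limit_comp g_lim)//; apply: (leq_bigmax u).
exists M, (\sum_(i < n) \sum_(j < n) e i j (g (x (i, j)))); split.
  exists n; exists (fun i j => g (if (insub i, insub j) is (Some i', Some j') then x (i', j') else 0)).
    by move=> i j; eexists.
  by apply: eq_bigr => i _; apply: eq_bigr => j _; rewrite !valK.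
rewrite (le_lt_trans (nrm_distD (\sum_(i < n) \sum_(j < n) e i j (a i j)) _ _))//.
rewrite [d]splitr ltrD//.
rewrite -sumrB; under eq_bigr do rewrite -sumrB.
rewrite pair_bigA /=; have bound u : nrm (e (u.1 : 'I_n) (u.2 : 'I_n) (a u.1 u.2) - e u.1 u.2 (g (x (u.1, u.2)))) <= d / 2 / K.
  by rewrite -(stabB he) (le_trans (nrm_stab he _ _ _))// ltW// -surjective_pairing; apply: hx.
rewrite (le_lt_trans (nrm_sum _ _ _))// (le_lt_trans (ler_sum _ (fun u _ => bound u)))//.
rewrite sumr_const card_prod card_ord -[_ *+ _]mulr_natr mulrAC ltr_pdivrMr//.
by rewrite ltr_pM2l// ltr_nat.
Qed.

Lemma phi_exists n m : exists M : 'M[nat]_(r m, r n),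
  (n <= m)%N -> forall y, rk m (levP y) (col y M).
Proof.
have [nm|nm] := boolP (n <= m)%N; last by exists 0.
have /choice[v hv] (y : 'I_(r n)) : exists v, rk m (levP y) v.
  apply: (hasrk_exists (bs_lev m)); last exact: (bs_proj (bs_lev n)).
  exact: lev_mono nm (bs_in (bs_lev n) _).
exists (\matrix_(k, y) v y k ord0) => _ y.
by rewrite (_ : col y _ = v y)//; apply/colP => k; rewrite !mxE.
Qed.

(** The Bratteli multiplicity matrix from stage [n] to stage [m], read off inside [B]. *)
Definition phi n m : 'M[nat]_(r m, r n) := projT1 (cid (phi_exists n m)).

Lemma phiP n m y : (n <= m)%N -> rk m (@levP n y) (col y (phi n m)).
Proof. by move=> nm; apply: (projT2 (cid (phi_exists n m)) nm). Qed.

Lemma rk_up n m q v : (n <= m)%N -> rk n q v -> rk m q (phi n m *m v).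
Proof.
move=> nm; apply: (hasrk_hom (f := id) (bs_lev n) (bs_lev m) (star_hom_id B)).
  by move=> x; apply: lev_mono.
by move=> y; apply: phiP.
Qed.

Lemma eq_col_mx (a b : nat) (M N : 'M[nat]_(a, b)) : (forall y, col y M = col y N) -> M = N.
Proof. by move=> h; apply/matrixP => k y; have /colP/(_ k) := h y; rewrite !mxE. Qed.

Lemma phi_id n : phi n n = 1%:M.
Proof.
apply: eq_col_mx => y; apply: (hasrk_unique (bs_lev n) (phiP y (leqnn n))).
exact: hasrk_P (bs_lev n).
Qed.

Lemma phi_comp n m k : (n <= m)%N -> (m <= k)%N -> phi m k *m phi n m = phi n k.
Proof.
move=> nm mk; apply: eq_col_mx => y; have h := rk_up mk (phiP y nm).
rewrite (_ : col y _ = phi m k *m col y (phi n m)); last first.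
  by apply/colP => i; rewrite !mxE; apply: eq_bigr => j _; rewrite mxE.
exact: (hasrk_unique (bs_lev k) h (phiP y (leq_trans nm mk))).
Qed.

Lemma rk_emb n q v : hasrk [set: An n] (@P n) q v -> rk n (e 0%N 0%N (g q)) v.
Proof.
apply: (hasrk_transport (f := e 0%N 0%N \o @g n) (bsP n) (bs_lev n)).
  exact: star_hom_comp (g_hom n) (stab_diag_hom he 0).
by move=> x _; apply: (mxfin_unit he _ _ (Ds n)); exists x.
Qed.

Lemma phi_retr n m : (n <= m)%N -> retr (phi n m).
Proof.
move=> nm i.
have [||||k hk] := left_invertible_row (P := @P n) i (f_li nm) _ _ _ _ (bsP m).
- exact: (bs_proj (bsP n)).
- exact: (bs_neq0 (bsP n)).
- by move=> y x; apply: (bs_corner (bsP n)).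
- by move=> y z x yz; apply: (bs_off (bsP n)).
exists k => j; have [v hv] : exists v, hasrk [set: An m] (@P m) (@f n m (P j)) v.
  apply: (hasrk_exists (bsP m)) => //.
  by apply: star_hom_proj (bs_proj (bsP n) j); have [] := f_li nm.
rewrite -(hk _ _ hv); have := rk_emb hv; rewrite (limit_comp g_lim)// => hv'.
by rewrite -(hasrk_unique (bs_lev m) (phiP j nm) hv') mxE.
Qed.

(** * Realizing a retractable matrix by a finite-dimensional algebra *)

Section Extension.
Variables (n s : nat) (M : 'M[nat]_(s, r n)) (p0 : A).
Hypotheses (p0_proj : is_proj p0) (p0_neq0 : p0 <> 0).
Variables (J : finType) (cl : J -> 'I_(r n)) (sx : J -> An n) (u : An n).
Hypotheses (fs : frame [set: An n] (@P n) cl sx u) (hu : forall x, u · x = x /\ x · u = x).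

Lemma coef_exists x x' (a : An n) : exists k : C, (sx x)^† · a · sx x' = k *: P (cl x).
Proof.
have xs z : sx z · P (cl z) = sx z := frame_source (bsP n) z fs.
have Pr z : P (cl z) · (sx z)^† = (sx z)^†.
  by rewrite -{2}(xs z) cstarM (bs_proj (bsP n) _).2.
have E : (sx x)^† · a · sx x' = P (cl x) · ((sx x)^† · a · sx x') · P (cl x').
  by rewrite !cmulA Pr -(cmulA _ (sx x')) xs.
have [ee|ne] := eqVneq (cl x) (cl x').
  by rewrite E -ee; apply: (bs_corner (bsP n)).
by exists 0; rewrite E (bs_off (bsP n))// scale0r.
Qed.

(** The matrix coefficients of [a] along the frame [sx] of the unit of A_n. *)
Definition coef x x' (a : An n) : C := projT1 (cid (coef_exists x x' a)).

Lemma coefP x x' a : (sx x)^† · a · sx x' = coef x x' a *: P (cl x).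
Proof. exact: (projT2 (cid (coef_exists x x' a))). Qed.

Lemma coef_eq x x' a k : (sx x)^† · a · sx x' = k *: P (cl x) -> coef x x' a = k.
Proof. by rewrite coefP; apply: scaleC_inj; apply: (bs_neq0 (bsP n)). Qed.

Lemma coef_off x x' a : cl x != cl x' -> coef x x' a = 0.
Proof.
move=> ne; apply: coef_eq; rewrite scale0r.
rewrite -(frame_source (bsP n) x fs) -(frame_source (bsP n) x' fs) cstarM.
rewrite (bs_proj (bsP n) _).2 -!cmulA (cmulA a) (cmulA _^†) (cmulA (P _)).
by rewrite (bs_off (bsP n)).
Qed.

Lemma coef_linear x x' k a b : coef x x' (k *: a + b) = k * coef x x' a + coef x x' b.
Proof.
by apply: coef_eq; rewrite scalerDl -scalerA -!coefP cmulDr cmulDl cmulZr cmulZl.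
Qed.

Lemma coef_mul x x' a b : coef x x' (a · b) = \sum_z coef x z a * coef z x' b.
Proof.
apply: coef_eq; rewrite -{1}(hu b).1 (frame_sum fs) scaler_suml.
rewrite cmul_suml !cmul_sumr cmul_suml; apply: eq_bigr => z _.
have -> : (sx x)^† · (a · (sx z · (sx z)^† · b)) · sx x' =
    (sx x)^† · a · sx z · ((sx z)^† · b · sx x') by rewrite !cmulA.
rewrite !coefP cmulZl cmulZr scalerA.
have [ee|ne] := eqVneq (cl x) (cl z); first by rewrite ee (bs_proj (bsP n) _).1.
by rewrite coef_off// mul0r !scale0r.
Qed.

Lemma coef_star x x' a : coef x x' a^† = (coef x' x a)^*%R.
Proof.
have [ee|ne] := eqVneq (cl x') (cl x); last first.
  by rewrite !coef_off ?conjC0// eq_sym.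
apply: coef_eq; apply: cstar_inj; rewrite !cstarM !cstarK cstarZ conjCK.
by rewrite cmulA coefP ee (bs_proj (bsP n) _).2.
Qed.

Lemma coef_frame x x' z : coef x x' (sx z · (sx z)^†) = ((x == z) && (x' == z))%:R.
Proof.
apply: coef_eq; rewrite !cmulA -cmulA !(frame_orth fs).
case: eqVneq => [->|_]; last by rewrite cmul0r scale0r.
rewrite eq_sym; case: eqVneq => [->|_]; last by rewrite cmulr0 scale0r.
by rewrite (bs_proj (bsP n) _).1 scale1r.
Qed.

(** A bound for all entries of [M], so that one index set serves for every block. *)
Let N := (\sum_k \sum_y M k y)%N.

Lemma M_le k y : (M k y <= N)%N.
Proof.
rewrite /N (bigD1 k)//= (bigD1 y)//= -!addnA; exact: leq_addr.
Qed.

(* [None] is an extra row and column in each of the [s] matrix blocks: it keeps them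
   nonzero, and provides minimal projections of the blocks outside of the image of A_n. *)
Let Z : finType := option (J * 'I_N)%type.

(** The successor avoids slot 0, which holds A_n. *)
Definition slot (k : 'I_s) (o : Z) : nat := (enum_rank (k, o)).+1.

Lemma slot_eq k o k' o' : (slot k o == slot k' o') = (k == k') && (o == o').
Proof. by rewrite eqSS (inj_eq val_inj) (inj_eq enum_rank_inj). Qed.

Definition unt k o o' : B := e (slot k o) (slot k o') p0.

Lemma unt_mul k o o' k' q q' :
  unt k o o' · unt k' q q' = if (k == k') && (o' == q) then unt k o q' else 0.
Proof.
rewrite /unt (stab_mulE he) slot_eq; case: eqP => //= <-.
by case: eqP => //= _; rewrite p0_proj.1.
Qed.

Lemma unt_star k o o' : (unt k o o')^† = unt k o' o.
Proof. by rewrite /unt (stab_star he) p0_proj.2. Qed.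

Lemma unt_corner k o o' x : e 0%N 0%N x · unt k o o' = 0.
Proof. by rewrite (stab_mul_neq he). Qed.

Lemma corner_unt k o o' x : unt k o o' · e 0%N 0%N x = 0.
Proof. by rewrite (stab_mul_neq he). Qed.

(* The algebra A_n + M_Z(C)^s, realized inside the stabilization by putting A_n in the
   corner (0, 0) and the matrix units of the blocks on disjoint slots, with the projection
   [p0] of [A] as coefficient. *)
Definition ext (a : An n) (c : 'I_s -> Z -> Z -> C) : B :=
  e 0%N 0%N (g a) + \sum_k \sum_o \sum_o' c k o o' *: unt k o o'.

Lemma extD a b c d : ext (a + b) (fun k o o' => c k o o' + d k o o') = ext a c + ext b d.
Proof.
rewrite /ext (star_homD (g_hom n)) (stabD he) addrACA -big_split /=; congr (_ + _).
apply: eq_bigr => k _; rewrite -big_split /=; apply: eq_bigr => o _.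
by rewrite -big_split /=; apply: eq_bigr => o' _; rewrite scalerDl.
Qed.

Lemma extZ (l : C) a c : ext (l *: a) (fun k o o' => l * c k o o') = l *: ext a c.
Proof.
rewrite /ext (star_homZ (g_hom n)) (stabZ he) scalerDr scaler_sumr; congr (_ + _).
apply: eq_bigr => k _; rewrite scaler_sumr; apply: eq_bigr => o _.
by rewrite scaler_sumr; apply: eq_bigr => o' _; rewrite scalerA.
Qed.

Lemma ext_star a c : (ext a c)^† = ext a^† (fun k o o' => (c k o' o)^*%R).
Proof.
rewrite /ext cstarD (stab_star he) -(star_hom_star (g_hom n)); congr (_ + _).
rewrite cstar_sum; apply: eq_bigr => k _; rewrite cstar_sum.
under eq_bigr do rewrite cstar_sum.
rewrite exchange_big /=; apply: eq_bigr => o _; apply: eq_bigr => o' _.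
by rewrite cstarZ unt_star.
Qed.

Lemma unt_sum_mul k o o' c :
  unt k o o' · (\sum_l \sum_q \sum_q' c l q q' *: unt l q q') =
  \sum_q' c k o' q' *: unt k o q'.
Proof.
rewrite cmul_sumr (bigD1 k)//= [X in _ + X]big1 ?addr0 => [|l lk].
  rewrite cmul_sumr (bigD1 o')//= [X in _ + X]big1 ?addr0 => [|q qo].
    by rewrite cmul_sumr; apply: eq_bigr => q' _; rewrite cmulZr unt_mul !eqxx.
  rewrite cmul_sumr big1// => q' _.
  by rewrite cmulZr unt_mul [_ == q]eq_sym (negbTE qo) andbF scaler0.
rewrite cmul_sumr big1// => q _; rewrite cmul_sumr big1// => q' _.
by rewrite cmulZr unt_mul [k == l]eq_sym (negbTE lk) scaler0.
Qed.

Lemma ext_mul a b c d : ext a c · ext b d =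
  ext (a · b) (fun k o o' => \sum_q c k o q * d k q o').
Proof.
rewrite /ext cmulDl !cmulDr (stab_mul_eq he) -(star_hom_mul (g_hom n)) -!addrA.
congr (_ + _); rewrite cmul_sumr big1 ?add0r => [|k _]; last first.
  rewrite cmul_sumr big1// => o _; rewrite cmul_sumr big1// => o' _.
  by rewrite cmulZr unt_corner scaler0.
rewrite cmul_suml big1 ?add0r => [|k _]; last first.
  rewrite cmul_suml big1// => o _; rewrite cmul_suml big1// => o' _.
  by rewrite cmulZl corner_unt scaler0.
rewrite cmul_suml; apply: eq_bigr => k _; rewrite cmul_suml; apply: eq_bigr => o _.
rewrite cmul_suml; under eq_bigr => q _ do rewrite cmulZl unt_sum_mul scaler_sumr.
rewrite exchange_big /=; apply: eq_bigr => o' _.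
by rewrite scaler_suml; apply: eq_bigr => q _; rewrite scalerA.
Qed.

Definition extset : set B := [set b | exists a c, b = ext a c].

Lemma extset_subalg : star_subalg extset.
Proof.
split=> [|_ _ [a [c ->]] [b [d ->]]|l _ [a [c ->]]|_ _ [a [c ->]] [b [d ->]]|_ [a [c ->]]].
- exists 0, (fun _ _ _ => 0); rewrite /ext (star_hom0 (g_hom n)) (stab0 he) add0r.
  by rewrite big1// => k _; rewrite big1// => o _; rewrite big1// => o' _; rewrite scale0r.
- by rewrite -extD; do 2 eexists.
- by rewrite -extZ; do 2 eexists.
- by rewrite ext_mul; do 2 eexists.
- by rewrite ext_star; do 2 eexists.
Qed.

Definition edelta (k : 'I_s) (o o' : Z) (l : 'I_s) (q q' : Z) : C :=
  ((l == k) && (q == o) && (q' == o'))%:R.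

Lemma ext_delta k o o' : ext 0 (edelta k o o') = unt k o o'.
Proof.
rewrite /ext (star_hom0 (g_hom n)) (stab0 he) add0r /edelta.
rewrite (bigD1 k)//= [X in _ + X]big1 ?addr0 => [|l lk]; last first.
  by rewrite big1// => q _; rewrite big1// => q' _; rewrite (negbTE lk) scale0r.
rewrite (bigD1 o)//= [X in _ + X]big1 ?addr0 => [|q qo]; last first.
  by rewrite big1// => q' _; rewrite (negbTE qo) andbF scale0r.
rewrite (bigD1 o')//= [X in _ + X]big1 ?addr0 => [|q' qo]; last first.
  by rewrite (negbTE qo) andbF scale0r.
by rewrite !eqxx scale1r.
Qed.

Lemma ext_diag a : ext a (fun _ _ _ => 0) = e 0%N 0%N (g a).
Proof.
rewrite /ext big1 ?addr0// => k _; rewrite big1// => o _; rewrite big1// => o' _.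
by rewrite scale0r.
Qed.

Lemma extset_span : exists m (v : 'I_m -> B), (forall i, extset (v i)) /\
  forall x, extset x -> exists k : 'I_m -> C, x = \sum_i k i *: v i.
Proof.
have [m [v hv]] := fdset_full (An_fd n).
pose T : finType := ('I_m + 'I_s * Z * Z)%type.
pose b (t : T) : B := match t with
  | inl i => e 0%N 0%N (g (v i)) | inr (k, o, o') => unt k o o' end.
exists #|{: T}|, (fun t => b (enum_val t)); split=> [t|_ [a [c ->]]].
  case: (enum_val t) => [i|[[k o] o']] /=; first by rewrite -ext_diag; do 2 eexists.
  by rewrite -ext_delta; do 2 eexists.
have [w wE] := hv a I.
pose d (t : T) : C := match t with inl i => w i | inr (k, o, o') => c k o o' end.
exists (fun t => d (enum_val t)).
rewrite [RHS](reindex_onto enum_rank (fun t : 'I_#|{: T}| => enum_val t))/=; last first.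
  by move=> t _; rewrite enum_valK.
rewrite (eq_big xpredT (fun t : T => d t *: b t)); last 2 first.
- by move=> t; rewrite enum_rankK eqxx.
- by move=> t _; rewrite enum_rankK.
rewrite big_sumType /= /ext; congr (_ + _).
  rewrite wE (star_hom_sum (g_hom n)) (stab_sum he); apply: eq_bigr => i _.
  by rewrite (star_homZ (g_hom n)) (stabZ he).
by rewrite !pair_bigA /=; apply: eq_bigr => -[[k o] o'] _.
Qed.

Lemma extset_fd : fdset extset.
Proof. by have [m [v [_ h]]] := extset_span; exists m, v. Qed.

Lemma ext_inj a c b d : ext a c = ext b d -> a = b.
Proof.
move=> h; apply: g_inj; apply/subr0_eq; apply: cstar_mul_eq0; apply: (stab_inj he).
have h' z : e 0%N 0%N (z · g a) = e 0%N 0%N (z · g b).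
  have ez a' c' : e 0%N 0%N z · ext a' c' = e 0%N 0%N (z · g a').
    rewrite cmulDr (stab_mul_eq he) cmul_sumr big1 ?addr0// => k _.
    rewrite cmul_sumr big1// => o _; rewrite cmul_sumr big1// => o' _.
    by rewrite cmulZr unt_corner scaler0.
  by rewrite -(ez a c) h ez.
by rewrite cmulBr (stabB he) h' subrr (stab0 he).
Qed.

Let D : cstarType R := csub extset_subalg (fd_closed extset_subalg extset_fd).

Definition mkext a c : D := @CSub _ _ _ extset_subalg (fd_closed extset_subalg extset_fd)
  (ext a c) (ex_intro _ a (ex_intro _ c erefl)).

(* In the block [k], M k y copies of the summand [y] of A_n. *)
Definition gam_coef (a : An n) (k : 'I_s) (o o' : Z) : C :=
  match o, o' with
  | Some (x, t), Some (x', t') =>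
      if (t == t') && (t < M k (cl x))%N then coef x x' a else 0
  | _, _ => 0
  end.

Definition gam (a : An n) : D := mkext a (gam_coef a).

Lemma gam_star_hom : star_hom gam.
Proof.
split=> [l a b|a b|a]; apply: csub_val_inj => /=.
- rewrite -extZ -extD; congr ext; apply/funext => k; apply/funext => o; apply/funext => o'.
  case: o => [[x t]|] /=; last by rewrite mulr0 addr0.
  case: o' => [[x' t']|] /=; last by rewrite mulr0 addr0.
  by case: ifP => _; rewrite ?coef_linear// mulr0 addr0.
- rewrite ext_mul; congr ext; apply/funext => k; apply/funext => o; apply/funext => o'.
  case: o => [[x t]|] /=; last by rewrite big1// => q _; rewrite mul0r.
  rewrite big_option; case: o' => [[x' t']|] /=; last first.
    by rewrite mulr0 add0r big1// => -[z t''] _; rewrite mulr0.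
  rewrite mul0r add0r [RHS](_ : _ = \sum_z \sum_t''
    (if (t == t'') && (t < M k (cl x))%N then coef x z a else 0) *
    (if (t'' == t') && (t'' < M k (cl z))%N then coef z x' b else 0)); last first.
    by rewrite pair_bigA /=; apply: eq_bigr => -[z t''] _.
  case: ifP => [/andP[/eqP <- tM]|tt'].
    rewrite coef_mul; apply: eq_bigr => z _; rewrite (bigD1 t)//= eqxx tM /=.
    rewrite [X in _ + X]big1 ?addr0 => [|t'' t''t]; last first.
      by rewrite eq_sym (negbTE t''t) mul0r.
    (* [coef x z a] vanishes unless [x] and [z] have the same class, in which case the two cutoffs
       agree. *)
    have [<-|ne] := eqVneq (cl x) (cl z); first by rewrite tM.
    by rewrite coef_off// !mul0r.
  rewrite big1// => z _; rewrite big1// => t'' _.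
  case: ifP => [/andP[/eqP <- tM]|_]; last by rewrite mul0r.
  by case: ifP => [/andP[/eqP te _]|_]; [rewrite te eqxx -te tM in tt'|rewrite mulr0].
- rewrite ext_star; congr ext; apply/funext => k; apply/funext => o; apply/funext => o'.
  case: o => [[x t]|] /=; case: o' => [[x' t']|] /=; rewrite ?conjC0//.
  rewrite [t' == t]eq_sym; case: eqVneq => [->|_] /=; last by rewrite conjC0.
  have [ee|ne] := eqVneq (cl x) (cl x').
    by rewrite -ee; case: ifP; rewrite ?conjC0// coef_star.
  have ne' : cl x' != cl x by rewrite eq_sym.
  by rewrite (coef_off _ ne) (coef_off _ ne') !if_same conjC0.
Qed.

(** The left inverse forgets the blocks; [ext_inj] makes the component in A_n well defined. *)
Lemma gam_left_invertible : left_invertible gam.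
Proof.
split; first exact: gam_star_hom.
have hpi (d : D) : exists a, exists c, csub_val d = ext a c by exact: (csub_prop d).
pose pi d := projT1 (cid (hpi d)).
have piP d a c : csub_val d = ext a c -> pi d = a.
  move=> dE; have [c' h] := projT2 (cid (hpi d)); rewrite -/(pi d) in h.
  by rewrite dE in h; rewrite (ext_inj h).
exists pi; last by apply/funext => a /=; apply: (piP _ _ (gam_coef a)).
have hD d : exists c, csub_val d = ext (pi d) c by exact: (projT2 (cid (hpi d))).
split=> [l d d'|d d'|d].
- have [c hc] := hD d; have [c' hc'] := hD d'.
  apply: (piP _ _ (fun k o o' => l * c k o o' + c' k o o')).
  by rewrite extD extZ -hc -hc'.
- have [c hc] := hD d; have [c' hc'] := hD d'.
  by apply: piP; rewrite csub_mulE hc hc' ext_mul.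
- by have [c hc] := hD d; apply: piP; rewrite csub_starE hc ext_star.
Qed.

Let dA (a : An n) : D := mkext a (fun _ _ _ => 0).
Let dU k o o' : D := mkext 0 (edelta k o o').

Let dA_val a : csub_val (dA a) = e 0%N 0%N (g a). Proof. exact: ext_diag. Qed.
Let dU_val k o o' : csub_val (dU k o o') = unt k o o'. Proof. exact: ext_delta. Qed.

Let dAM a b : dA a · dA b = dA (a · b).
Proof.
apply: csub_val_inj; rewrite csub_mulE !dA_val (stab_mul_eq he).
by rewrite (star_hom_mul (g_hom n)).
Qed.

Let dAS a : (dA a)^† = dA a^†.
Proof.
by apply: csub_val_inj; rewrite csub_starE !dA_val (stab_star he) (star_hom_star (g_hom n)).
Qed.

Let dUM k o o' l q q' :
  dU k o o' · dU l q q' = if (k == l) && (o' == q) then dU k o q' else 0.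
Proof.
by apply: csub_val_inj; rewrite csub_mulE !dU_val unt_mul; case: ifP.
Qed.

Let dUS k o o' : (dU k o o')^† = dU k o' o.
Proof. by apply: csub_val_inj; rewrite csub_starE !dU_val unt_star. Qed.

Let dAU a k o o' : dA a · dU k o o' = 0.
Proof. by apply: csub_val_inj; rewrite csub_mulE dA_val dU_val unt_corner. Qed.

Let dUA a k o o' : dU k o o' · dA a = 0.
Proof. by apply: csub_val_inj; rewrite csub_mulE dA_val dU_val corner_unt. Qed.

Lemma ext_finite_dimensional : finite_dimensional D.
Proof.
have [m [v [Ev hv]]] := extset_span.
exists m, (fun i => @CSub _ _ _ extset_subalg (fd_closed extset_subalg extset_fd) _ (Ev i)) => x.
have [k hk] := hv _ (csub_prop x); exists k; apply: csub_val_inj.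
rewrite hk (star_hom_sum (csub_val_star_hom _ _)); apply: eq_bigr => i _.
by rewrite (star_homZ (csub_val_star_hom _ _)).
Qed.

Lemma gam_frame x : gam (sx x · (sx x)^†) = dA (sx x · (sx x)^†) +
  \sum_(p : 'I_s * 'I_N | (p.2 < M p.1 (cl x))%N) dU p.1 (Some (x, p.2)) (Some (x, p.2)).
Proof.
apply: csub_val_inj; rewrite (star_homD (csub_val_star_hom _ _)).
rewrite (star_hom_sum (csub_val_star_hom _ _)) dA_val /= /ext; congr (_ + _).
rewrite -(pair_big_dep xpredT (fun (k : 'I_s) (t : 'I_N) => (t < M k (cl x))%N)
  (fun k t => csub_val (dU k (Some (x, t)) (Some (x, t))))) /=.
apply: eq_bigr => k _; under [RHS]eq_bigr do rewrite ext_delta.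
rewrite big_option /= [X in X + _]big1 ?add0r => [|o' _]; last by rewrite scale0r.
rewrite [LHS](_ : _ = \sum_z \sum_t \sum_o'
    gam_coef (sx x · (sx x)^†) k (Some (z, t)) o' *: unt k (Some (z, t)) o'); last first.
  by rewrite [RHS]pair_bigA; apply: eq_bigr => -[z t] _.
rewrite (bigD1 x)//= [X in _ + X]big1 ?addr0 => [|z zx]; last first.
  rewrite big1// => t _; rewrite big_option /= scale0r add0r big1// => -[z' t'] _.
  by rewrite coef_frame (negbTE zx) if_same scale0r.
rewrite [RHS]big_mkcond; apply: eq_bigr => t _.
rewrite big_option /= scale0r add0r (bigD1 (x, t))//= eqxx coef_frame eqxx /=.
rewrite [X in _ + X]big1 ?addr0 => [|[z' t'] ne]; last first.
  rewrite coef_frame eqxx; have [tt|_] /= := eqVneq t t'; last by rewrite scale0r.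
  have [zx|_] := eqVneq z' x; last by rewrite if_same scale0r.
  by move: ne; rewrite zx -tt eqxx.
by case: ifP => _; rewrite ?scale1r ?scale0r.
Qed.

(** [PD] has one minimal projection for each summand of A_n and one for each block. The ranks of
    their images under [dl] form a retractable matrix (L1 L2). Counting the pieces of [gam (P y)]
    gives ranks L1 + L2 M for [dl \o gam], and closeness to the connecting map identifies this with
    [phi n m]. *)
Lemma extension_rank m (dl : D -> An m) : (n <= m)%N -> left_invertible dl ->
  (forall a, nrm a <= 1 -> nrm (dl (gam a) - @f n m a) < 1) -> retr M ->
  exists2 L : 'M[nat]_(r m, s), retr L & L *m M = phi n m.
Proof.
move=> nm dli near rM; have [hdl _] := dli.
pose Q : finType := ('I_(r n) + 'I_s)%type.
pose PD (t : Q) : D := match t with inl y => dA (P y) | inr k => dU k None None end.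
have PDproj t : is_proj (PD t).
  case: t => [y|k]; split; rewrite /= ?dAM ?dAS ?dUM ?dUS ?eqxx//.
    by rewrite (bs_proj (bsP n) y).1.
  by rewrite (bs_proj (bsP n) y).2.
have PD0 t : PD t <> 0.
  move/(congr1 (@csub_val _ _ _ _ _)); case: t => [y|k] /=.
    rewrite ext_diag => /(stab_diag_inj he) gy; apply: (bs_neq0 (bsP n) y).
    by apply: g_inj; rewrite gy (star_hom0 (g_hom n)).
  by rewrite ext_delta => /(stab_diag_inj he).
have Dval (x : D) : exists a c, x = dA a + \sum_k \sum_o \sum_o' c k o o' *: dU k o o'.
  have [a [c xE]] := csub_prop x; exists a, c; apply: csub_val_inj.
  rewrite xE (star_homD (csub_val_star_hom _ _)) dA_val /ext; congr (_ + _).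
  rewrite (star_hom_sum (csub_val_star_hom _ _)); apply: eq_bigr => k _.
  rewrite (star_hom_sum (csub_val_star_hom _ _)); apply: eq_bigr => o _.
  rewrite (star_hom_sum (csub_val_star_hom _ _)); apply: eq_bigr => o' _.
  by rewrite (star_homZ (csub_val_star_hom _ _)) dU_val.
have dAx y z x : exists a, dA y · x · dA z = dA (y · a · z).
  have [a [c ->]] := Dval x; exists a; rewrite cmulDr cmulDl !dAM.
  rewrite cmul_sumr cmul_suml big1 ?addr0// => k _.
  rewrite cmul_sumr cmul_suml big1// => o _; rewrite cmul_sumr cmul_suml big1// => o' _.
  by rewrite cmulZr dAU scaler0 cmul0r.
have dAxU y k x : dA y · x · dU k None None = 0.
  have [a [c ->]] := Dval x; rewrite cmulDr cmulDl !dAM dAU add0r.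
  rewrite cmul_sumr cmul_suml big1// => l _.
  rewrite cmul_sumr cmul_suml big1// => o _; rewrite cmul_sumr cmul_suml big1// => o' _.
  by rewrite cmulZr dAU scaler0 cmul0r.
have dUx k l x : exists c : C, dU k None None · x · dU l None None =
    if k == l then c *: dU k None None else 0.
  have [a [c ->]] := Dval x; exists (c k None None).
  rewrite cmulDr cmulDl dUA cmul0r add0r cmul_sumr cmul_suml.
  rewrite (bigD1 k)//= [X in _ + X]big1 ?addr0 => [|k' k'k]; last first.
    rewrite cmul_sumr cmul_suml big1// => o _; rewrite cmul_sumr cmul_suml big1// => o' _.
    by rewrite cmulZr dUM eq_sym (negbTE k'k) scaler0 cmul0r.
  rewrite cmul_sumr cmul_suml (bigD1 None)//= [X in _ + X]big1 ?addr0 => [|o o0]; last first.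
    rewrite cmul_sumr cmul_suml big1// => o' _.
    by rewrite cmulZr dUM [None == o]eq_sym (negbTE o0) andbF scaler0 cmul0r.
  rewrite cmul_sumr cmul_suml (bigD1 None)//= [X in _ + X]big1 ?addr0 => [|o o0]; last first.
    by rewrite cmulZr dUM !eqxx cmulZl dUM (negbTE o0) andbF scaler0.
  by rewrite cmulZr dUM !eqxx cmulZl dUM eqxx andbT; case: ifP; rewrite ?scaler0.
have PDc t x : exists k : C, PD t · x · PD t = k *: PD t.
  case: t => [y|k] /=.
    have [a ->] := dAx (P y) (P y) x.
    have [c hc] := @bs_corner _ _ _ _ _ (bsP n) y a I; exists c; rewrite hc.
    by apply: csub_val_inj; rewrite (star_homZ (csub_val_star_hom _ _)) !dA_val
      (star_homZ (g_hom n)) (stabZ he).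
  by have [c] := dUx k k x; rewrite eqxx; exists c.
have dA0 : dA 0 = 0.
  by apply: csub_val_inj; rewrite dA_val (star_hom0 (g_hom n)) (stab0 he).
have PDo t t' x : t != t' -> PD t · x · PD t' = 0.
  case: t t' => [y|k] [y'|k'] //= ne.
  - by have [a ->] := dAx (P y) (P y') x; rewrite (bs_off (bsP n)).
  - apply: cstar_inj; rewrite !cstarM dUS dAS (bs_proj (bsP n) _).2 cstar0 cmulA.
    exact: dAxU.
  - by have [c ->] := dUx k k' x; rewrite ifN.
have /choice[v hv] t : exists v, hasrk setT (@P m) (dl (PD t)) v.
  by apply: (hasrk_exists (bsP m)) => //; apply: star_hom_proj.
have hsum y : hasrk setT (@P m) (dl (gam (P y)))
    (v (inl y) + \sum_k v (inr k) *+ M k y).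
  have [x xy] : exists x, cl x = y.
    apply: contrapT => h; apply: (bs_neq0 (bsP n) y).
    rewrite -(hu (P y)).1 (frame_sum fs) !cmul_suml big1// => x _.
    rewrite -cmulA -{2}(frame_source (bsP n) x fs) cstarM (bs_proj (bsP n) _).2.
    by rewrite (bs_off (bsP n)) ?cmulr0//; apply/eqP => xy; apply: h; exists x.
  have hsx : hasrk setT (@P m) (dl (gam (sx x · (sx x)^†)))
      (v (inl y) + \sum_(p : 'I_s * 'I_N | (p.2 < M p.1 (cl x))%N) v (inr p.1)).
    rewrite gam_frame (star_homD hdl) (star_hom_sum hdl).
    apply: (hasrkD (bsP m)).
    - have -> : dl (dA (sx x · (sx x)^†)) = dl (dA (sx x)) · (dl (dA (sx x)))^†.
        by rewrite -(star_hom_star hdl) -(star_hom_mul hdl) dAS dAM.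
      apply: (hasrk_mvn (bsP m)) => //.
      rewrite -(star_hom_star hdl) -(star_hom_mul hdl) dAS dAM (frame_orth fs) eqxx xy.
      exact: (hv (inl y)).
    - apply: (hasrk_sum (bsP m)) => [[k t] _|[k t] [k' t'] _ _ ne] /=.
        set o : Z := Some (x, t).
        (* The matrix unit from [None] to [o] makes each diagonal unit of a block equivalent to the
           representative at [None]. *)
        have -> : dl (dU k o o) = dl (dU k o None) · (dl (dU k o None))^†.
          by rewrite -(star_hom_star hdl) -(star_hom_mul hdl) dUS dUM !eqxx.
        apply: (hasrk_mvn (bsP m)) => //.
        rewrite -(star_hom_star hdl) -(star_hom_mul hdl) dUS dUM !eqxx.
        exact: (hv (inr k)).
      rewrite -(star_hom_mul hdl) dUM ifN ?(star_hom0 hdl)//.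
      by apply: contra ne => /andP[/eqP -> /eqP[->]].
    - rewrite cmul_sumr big1// => p _.
      by rewrite -(star_hom_mul hdl) dAU (star_hom0 hdl).
  have -> : \sum_k v (inr k) *+ M k y =
      \sum_(p : 'I_s * 'I_N | (p.2 < M p.1 (cl x))%N) v (inr p.1).
    rewrite -(pair_big_dep xpredT (fun (k : 'I_s) (t : 'I_N) => (t < M k (cl x))%N)
      (fun k t => v (inr k))) /=.
    by apply: eq_bigr => k _; rewrite (big_ord_narrow (M_le k _)) sumr_const card_ord xy.
  have gs z : gam z^† = (gam z)^† by rewrite (star_hom_star gam_star_hom).
  have -> : dl (gam (P y)) = (dl (gam (sx x)))^† · ((dl (gam (sx x)))^†)^†.
    rewrite cstarK -(star_hom_star hdl) -(star_hom_mul hdl) -gs.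
    by rewrite -(star_hom_mul gam_star_hom) (frame_orth fs) eqxx xy.
  apply: (hasrk_mvn (bsP m)) => //.
  by rewrite cstarK -(star_hom_star hdl) -(star_hom_mul hdl) -gs -(star_hom_mul gam_star_hom).
have hphi y : v (inl y) + \sum_k v (inr k) *+ M k y = col y (phi n m).
  have [w hw] : exists w, hasrk setT (@P m) (@f n m (P y)) w.
    apply: (hasrk_exists (bsP m)) => //.
    by apply: star_hom_proj (bs_proj (bsP n) y); have [] := f_li nm.
  rewrite (hasrk_near (bsP m) (hsum y) hw); last first.
    by apply: near; apply: nrm_proj_le1; apply: (bs_proj (bsP n)).
  have := rk_emb hw; rewrite (limit_comp g_lim)// => hw'.
  exact: (hasrk_unique (bs_lev m) hw' (phiP y nm)).
(* As W M = 1, the sum L1 + L2 M equals (L1 W + L2) M. The row found for a block projection vanishes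
   on L1, so it remains a unit row of L1 W + L2. *)
have [W WM] := retr_linv rM.
pose L1 : 'M[nat]_(r m, r n) := \matrix_(k', y) v (inl y) k' ord0.
pose L2 : 'M[nat]_(r m, s) := \matrix_(k', k) v (inr k) k' ord0.
exists (L1 *m W + L2).
  move=> k0; have [||||k hk] := left_invertible_row (P := PD) (inr k0) dli _ _ _ _ (bsP m) => //.
  exists k => l; rewrite !mxE (hk _ _ (hv (inr l))) big1 ?add0r// => y _.
  by rewrite !mxE (hk _ _ (hv (inl y))) [LHS]mul0n.
apply: eq_col_mx => y; rewrite -hphi mulmxDl -mulmxA WM mulmx1.
apply/colP => k; rewrite !mxE summxE; congr (_ + _); apply: eq_bigr => l _.
by rewrite mxE mulmxnE -mulr_natr natn.
Qed.

End Extension.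

Lemma lev_subalg n : star_subalg (lev n).
Proof. exact: (bs_sub (bs_lev n)). Qed.

Lemma lev_local n b : lev n b ->
  exists E, [/\ star_subalg E, fdset E, E b & forall x, E x -> lev n x].
Proof.
move=> [k hb]; exists (mxsub e k (range (@g n))); split=> //.
- exact: (mxsub_subalg he).
- exact: (mxsub_fd he).
- by move=> x Ex; exists k.
Qed.

Lemma unit_exists N : exists u : An N, [/\ is_proj u & forall x, u · x = x /\ x · u = x].
Proof.
have [u [_ uu hu]] := fd_unit (full_subalg (An N)) (fdset_full (An_fd N)).
by exists u; split=> // x; apply: hu.
Qed.

(** An approximate unit of [A], made of the units of the stages. *)
Definition apx N : A := g (projT1 (cid (unit_exists N))).

Lemma apx_proj N : is_proj (apx N).
Proof.
by apply: (star_hom_proj (g_hom N)); have [] := projT2 (cid (unit_exists N)).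
Qed.

Lemma apx_mul N n (x : An n) : (n <= N)%N -> apx N · g x = g x /\ g x · apx N = g x.
Proof.
move=> nN; rewrite -(limit_comp g_lim x nN) /apx -!(star_hom_mul (g_hom N)).
by have [_ /(_ (@f n N x))[-> ->]] := projT2 (cid (unit_exists N)).
Qed.

Lemma apx_tends a : tends (fun N => apx N · a · apx N) a.
Proof.
move=> d d0; have d2 : 0 < d / 2 by rewrite divr_gt0.
have [n [x ax]] := limit_dense g_lim a d2; exists n => N nN.
have [xl xr] := apx_mul x nN.
have -> : apx N · a · apx N - a = apx N · (a - g x) · (apx N)^† + (g x - a).
  rewrite (apx_proj N).2 cmulBr cmulBl xl xr addrA subrK//.
rewrite (le_lt_trans (nrmD _ _))// [d]splitr ltr_leD//; last by rewrite nrm_distC ltW.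
rewrite (le_lt_trans (nrm_conjugate _ _))// (le_lt_trans _ ax)//.
by rewrite ler_piMl ?nrm_ge0// exprn_ile1 ?nrm_ge0// nrm_proj_le1//; apply: apx_proj.
Qed.

(** * Diagonal addition *)

Section Spread.
Variable k : nat.

(* The isometries implementing [diag_embed k], truncated: in general the stabilization
   has no unit. *)
Definition spread N : B := \sum_(i < N) e (i.*2 + k)%N i (apx N).

Lemma spread_mul N i j a : (i < N)%N -> spread N · e i j a = e (i.*2 + k)%N j (apx N · a).
Proof.
move=> iN; rewrite cmul_suml (bigD1 (Ordinal iN))//= (stab_mul_eq he).
rewrite big1 ?addr0// => i' i'i; rewrite (stab_mul_neq he)//.
Qed.

Lemma spread_mulr N i j a : (j < N)%N ->
  e i j a · (spread N)^† = e i (j.*2 + k)%N (a · apx N).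
Proof.
move=> jN; apply: cstar_inj; rewrite cstarM cstarK !(stab_star he) spread_mul//.
by rewrite cstarM (apx_proj N).2.
Qed.

Lemma spread_proj N : is_proj ((spread N)^† · spread N).
Proof.
have -> : (spread N)^† · spread N = \sum_(i < N) e i i (apx N).
  rewrite cmul_sumr; apply: eq_bigr => i _; rewrite cstar_sum cmul_suml (bigD1 i)//=.
  rewrite (stab_star he) (stab_mul_eq he) (apx_proj N).2 (apx_proj N).1.
  rewrite big1 ?addr0// => j ji; rewrite (stab_star he) (stab_mul_neq he)//.
  by rewrite eqn_add2r -!mul2n eqn_pmul2l.
apply: is_proj_sum => [i _|i j _ _ ij].
  by apply: (star_hom_proj (stab_diag_hom he i)); apply: apx_proj.
by rewrite (stab_mul_neq he).
Qed.

Lemma nrm_spread N x : nrm (spread N · x · (spread N)^†) <= nrm x.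
Proof.
rewrite (le_trans (nrm_conjugate _ _))// ler_piMl ?nrm_ge0//.
by rewrite exprn_ile1 ?nrm_ge0// (nrm_piso_le1 (spread_proj N)).
Qed.

Lemma spread_stable n x : lev n x -> exists M, forall N, (M <= N)%N ->
  spread N · x · (spread N)^† = spread M · x · (spread M)^†.
Proof.
move=> [m [a Da ->]].
have h N : (maxn n m <= N)%N -> spread N · mxe e m a · (spread N)^† =
    \sum_(i < m) \sum_(j < m) e (i.*2 + k)%N (j.*2 + k)%N (a i j).
  rewrite geq_max => /andP[nN mN].
  rewrite cmul_sumr cmul_suml; apply: eq_bigr => i _.
  rewrite cmul_sumr cmul_suml; apply: eq_bigr => j _.
  rewrite spread_mul ?(leq_trans _ mN)// spread_mulr ?(leq_trans _ mN)//.
  by have [y _ <-] := Da i j; have [-> ->] := apx_mul y nN.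
by exists (maxn n m) => N MN; rewrite !h.
Qed.

(** Conjugation by [spread N] is contractive, and eventually constant on the dense union of the
    levels. *)
Lemma spread_cvg b : exists l, tends (fun N => spread N · b · (spread N)^†) l.
Proof.
apply: cauchy_tends => d d0; have d2 : 0 < d / 2 by rewrite divr_gt0.
have [n [x [xn bx]]] := lev_dense b d2; have [M hM] := spread_stable xn.
exists M => N N' MN MN'; rewrite (le_lt_trans (nrm_distD (spread M · x · (spread M)^†) _ _))//.
rewrite [d]splitr ltrD//.
  rewrite -(hM N)// -cmulBl -cmulBr; exact: le_lt_trans (nrm_spread _ _) bx.
rewrite -(hM N')// -cmulBl -cmulBr; apply: le_lt_trans (nrm_spread _ _) _.
by rewrite nrm_distC.
Qed.

Definition spreadl b : B := projT1 (cid (spread_cvg b)).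

Lemma spreadlP b : tends (fun N => spread N · b · (spread N)^†) (spreadl b).
Proof. exact: (projT2 (cid (spread_cvg b))). Qed.

Lemma spreadl_stab i j a : spreadl (e i j a) = e (i.*2 + k)%N (j.*2 + k)%N a.
Proof.
apply: (tends_unique (spreadlP _)).
have h : tends (fun N => e (i.*2 + k)%N (j.*2 + k)%N (apx N · a · apx N))
    (e (i.*2 + k)%N (j.*2 + k)%N a).
  apply: (tends_dom (K := 1) (apx_tends a)) => N.
  by rewrite -(stabB he) mul1r (nrm_stab he).
apply: (tends_eventually (N := (maxn i j).+1) h) => N.
by rewrite gtn_max => /andP[iN jN]; rewrite spread_mul// spread_mulr.
Qed.

Lemma spread_cut b : tends (fun N => (spread N)^† · spread N · b) b.
Proof.
move=> d d0; have d2 : 0 < d / 2 by rewrite divr_gt0.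
have [n [x [[m [a Da xE]] bx]]] := lev_dense b d2; exists (maxn n m) => N.
rewrite geq_max => /andP[nN mN].
have ux : (spread N)^† · spread N · x = x.
  rewrite xE -cmulA /mxe !cmul_sumr; apply: eq_bigr => i _.
  rewrite !cmul_sumr; apply: eq_bigr => j _.
  have iN : (i < N)%N := leq_trans (ltn_ord i) mN.
  rewrite spread_mul// cstar_sum cmul_suml (bigD1 (Ordinal iN))//=.
  rewrite (stab_star he) (stab_mul_eq he) (apx_proj N).2 cmulA (apx_proj N).1.
  have [y _ <-] := Da i j; rewrite (apx_mul y nN).1 big1 ?addr0// => i' i'i.
  rewrite (stab_star he) (stab_mul_neq he)// eqn_add2r -!mul2n eqn_pmul2l//.
set u := (spread N)^† · spread N.
have -> : u · b - b = u · (b - x) + (x - b) by rewrite cmulBr ux addrA subrK.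
rewrite (le_lt_trans (nrmD _ _))// [d]splitr ltr_leD//; last by rewrite nrm_distC ltW.
rewrite (le_lt_trans (nrm_cmul _ _))// (le_lt_trans _ bx)//.
by rewrite ler_piMl ?nrm_ge0// nrm_proj_le1//; apply: spread_proj.
Qed.

Lemma spreadl_hom : star_hom spreadl.
Proof.
split=> [c a b|a b|a].
- apply: (tends_unique (spreadlP _)).
  have h := tendsD (tendsZ c (spreadlP a)) (spreadlP b).
  apply: (tends_eventually (N := 0) h) => N _.
  by rewrite cmulDr cmulDl cmulZr cmulZl.
(* The product of the truncations contains the projection spread† spread between [a] and [b]; by
   [spread_cut] it acts as the identity in the limit. *)
- have h := tends_cmul (spreadlP a) (spreadlP b).
  apply: tends_unique _ h.
  have ab : tends (fun N => a · ((spread N)^† · spread N · b)) (a · b).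
    exact: tends_cmul (tends_cst a) (spread_cut b).
  have h2 : tends (fun N => spread N · (a · ((spread N)^† · spread N · b) - a · b) · (spread N)^†) 0.
    apply: (tends_dom (K := 1) ab) => N; rewrite subr0 mul1r; exact: nrm_spread.
  have := tendsD h2 (spreadlP (a · b)); rewrite add0r.
  move/(tends_eventually (N := 0)); apply=> N _.
  by rewrite cmulBr cmulBl subrK !cmulA.
- apply: (tends_unique (spreadlP _)); apply: (tends_eventually (N := 0) (tends_cstar (spreadlP a))).
  by move=> N _; rewrite !cstarM cstarK cmulA.
Qed.

End Spread.

Let dg := diag_embed e.

(** [diag_embed] is defined by choice; [spreadl k] shows that there is something to choose. *)
Lemma diag_embedP k : star_hom (dg k) /\ forall i j a, dg k (e i j a) = e (i.*2 + k)%N (j.*2 + k)%N a.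
Proof.
pose Q := [set s : {classic B -> B} | star_hom (s : B -> B) /\
  forall i j a, (s : B -> B) (e i j a) = e (i.*2 + k)%N (j.*2 + k)%N a].
apply: (@xgetPex _ (id : {classic B -> B}) Q); exists (spreadl k).
by split; [exact: spreadl_hom|move=> i j a; exact: spreadl_stab].
Qed.

Let dg_hom k : star_hom (dg k) := (diag_embedP k).1.

Lemma diag_embed_lev k n x : lev n x -> lev n (dg k x).
Proof.
move=> [m [a Da ->]]; rewrite (star_hom_sum (dg_hom k)).
apply: (subalg_sum (lev_subalg n)) => i _; rewrite (star_hom_sum (dg_hom k)).
apply: (subalg_sum (lev_subalg n)) => j _; rewrite (diag_embedP k).2.
exact: (mxfin_unit he).
Qed.

(** The two embeddings use even and odd slots; density extends the orthogonality to all of [B]. *)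
Lemma diag_embed_orth x y : dg 0 x · dg 1 y = 0.
Proof.
have lev0 n m x' y' : lev n x' -> lev m y' -> dg 0 x' · dg 1 y' = 0.
  move=> [k [a _ ->]] [l [b _ ->]]; rewrite !(star_hom_sum (dg_hom _)).
  rewrite cmul_suml big1// => i _; rewrite cmul_sumr big1// => i' _.
  rewrite !(star_hom_sum (dg_hom _)) cmul_suml big1// => j _.
  rewrite cmul_sumr big1// => j' _; rewrite !(diag_embedP _).2.
  rewrite (stab_mul_neq he)// addn0 addn1; apply/eqP => /(congr1 odd).
  by rewrite /= !odd_double.
have app z : exists w : nat -> B, (forall N, exists n, lev n (w N)) /\ tends w z.
  have /choice[w hw] N : exists w, (exists n, lev n w) /\ nrm (z - w) < (1 / 2) ^+ N.
    have [|n [w [nw zw]]] := @lev_dense z ((1 / 2) ^+ N); first by rewrite exprn_gt0//; lra.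
    by exists w; split=> //; exists n.
  exists w; split=> [N|]; first by have [] := hw N.
  apply: (tends_bound (b := fun N => (1 / 2) ^+ N)) => [N|d d0].
    by rewrite nrm_distC ltW//; have [] := hw N.
  by apply: geom_lt => //; lra.
have [v [hv vx]] := app x; have [w [hw wy]] := app y.
apply: tends_unique (tends_cmul (tends_star_hom (dg_hom 0) vx) (tends_star_hom (dg_hom 1) wy)) _.
apply: (tends_eventually (N := 0) (tends_cst 0)) => N _ /=.
by have [n hn] := hv N; have [m hm] := hw N; apply: lev0 hn hm.
Qed.

Lemma diag_embed_orth' x y : dg 1 y · dg 0 x = 0.
Proof.
apply: cstar_inj; rewrite cstarM -!(star_hom_star (dg_hom _)) diag_embed_orth.
by rewrite cstar0.
Qed.

Lemma diag_sum_mul a b a' b' :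
  diag_sum e a b · diag_sum e a' b' = diag_sum e (a · a') (b · b').
Proof.
rewrite /diag_sum -/dg cmulDl !cmulDr diag_embed_orth diag_embed_orth' addr0 add0r.
by rewrite !(star_hom_mul (dg_hom _)).
Qed.

Lemma diag_sum_star a b : (diag_sum e a b)^† = diag_sum e a^† b^†.
Proof. by rewrite /diag_sum -/dg cstarD !(star_hom_star (dg_hom _)). Qed.

Lemma diag_sum_positive a b : positive a -> positive b -> positive (diag_sum e a b).
Proof.
move=> [x ->] [y ->]; exists (diag_sum e x y).
by rewrite diag_sum_star diag_sum_mul.
Qed.

Lemma diag_sum_proj q q' : is_proj q -> is_proj q' -> is_proj (diag_sum e q q').
Proof. by move=> [qq qs] [qq' qs']; split; rewrite ?diag_sum_mul ?diag_sum_star ?qq ?qs ?qq' ?qs'. Qed.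

Lemma nrm_diag_sum a b : nrm (diag_sum e a b) <= nrm a + nrm b.
Proof. by rewrite (le_trans (nrmD _ _))// lerD// star_hom_contractive. Qed.

Lemma diag_sumB a b a' b' :
  diag_sum e a b - diag_sum e a' b' = diag_sum e (a - a') (b - b').
Proof. by rewrite /diag_sum -/dg opprD addrACA !(star_homB (dg_hom _)). Qed.

Lemma diag_sum_sub a a' b b' : cuntz_sub a a' -> cuntz_sub b b' ->
  cuntz_sub (diag_sum e a b) (diag_sum e a' b').
Proof.
move=> /cuntz_subP aa' /cuntz_subP bb'; apply/cuntz_subP => d d0.
have d2 : 0 < d / 2 by rewrite divr_gt0.
have [z hz] := aa' _ d2; have [w hw] := bb' _ d2; exists (diag_sum e z w).
rewrite diag_sum_star !diag_sum_mul diag_sumB.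
by rewrite (le_lt_trans (nrm_diag_sum _ _))// [d]splitr ltrD.
Qed.

(** The embedding moves the reference projections from slot 0 to slot [k]; the partial isometries
    [w y] bring the frame back to slot 0. *)
Lemma diag_embed_rk k n q v : rk n q v -> rk n (dg k q) v.
Proof.
move=> [J [cl [s [fs cE]]]]; have bl := bs_lev n.
have Dp y : range (@g n) (g (P (n := n) y)) by exists (P y).
pose w y := e k 0%N (g (P (n := n) y)).
have lw y : lev n (w y) := mxfin_unit he _ _ (Ds n) (Dp y).
have gP y : is_proj (g (P (n := n) y)).
  by apply: (star_hom_proj (g_hom n)); apply: (bs_proj (bsP n)).
have dP y : dg k (levP y) = e k k (g (P (n := n) y)).
  by rewrite (diag_embedP k).2 double0 add0n.
exists J, cl, (fun j => dg k (s j) · w (cl j)); split=> //; split=> [j|i j|].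
- apply: (subalgM (lev_subalg n)) => //; apply: diag_embed_lev; exact: (frame_in fs).
- rewrite cstarM cmulA -(cmulA _^† _^†) -(star_hom_star (dg_hom k)) -(star_hom_mul (dg_hom k)).
  rewrite (frame_orth fs); case: eqVneq => [->|_]; last by rewrite (star_hom0 (dg_hom k)) cmulr0 cmul0r.
  rewrite dP /w (stab_star he) !(stab_mul_eq he) (gP _).2 !(gP _).1//.
- rewrite (frame_sum fs) (star_hom_sum (dg_hom k)); apply: eq_bigr => j _.
  rewrite cstarM cmulA -(cmulA (dg k (s j))) /w (stab_star he) (stab_mul_eq he).
  rewrite (gP _).2 (gP _).1 -dP -(star_hom_mul (dg_hom k)) (frame_source bl j fs).
  by rewrite -(star_hom_star (dg_hom k)) -(star_hom_mul (dg_hom k)).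
Qed.

Lemma diag_sum_rk n q v q' v' : rk n q v -> rk n q' v' -> rk n (diag_sum e q q') (v + v').
Proof.
move=> hq hq'; apply: (hasrkD (bs_lev n)); [exact: (diag_embed_rk 0)|exact: (diag_embed_rk 1)|].
exact: diag_embed_orth.
Qed.

Lemma lproj_common q q' : lproj lev q -> lproj lev q' -> exists n, lev n q /\ lev n q'.
Proof.
move=> [n nq _] [m mq' _]; exists (maxn n m); split.
  exact: lev_mono (leq_maxl _ _) nq.
exact: lev_mono (leq_maxr _ _) mq'.
Qed.

Lemma canonical_diag_sum x xs qs y ys ps : canonical lev x xs qs -> canonical lev y ys ps ->
  canonical lev (diag_sum e x y) (fun k => diag_sum e (xs k) (ys k))
    (fun k => diag_sum e (qs k) (ps k)).
Proof.
move=> cx cy; split=> [|k|k|k|k|k].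
- exact: tendsD (tends_star_hom (dg_hom 0) (can_tends cx)) (tends_star_hom (dg_hom 1) (can_tends cy)).
- by rewrite diag_sum_star (can_sa cx) (can_sa cy).
- have [n [nq np]] := lproj_common (can_proj cx k) (can_proj cy k).
  have [_ _ qq] := can_proj cx k; have [_ _ pp] := can_proj cy k.
  exists n; last exact: diag_sum_proj.
  by apply: (subalgD (lev_subalg n)); apply: diag_embed_lev.
- by apply: diag_sum_sub; [apply: (can_le cx)|apply: (can_le cy)].
- by apply: diag_sum_sub; [apply: (can_sub cx)|apply: (can_sub cy)].
- by apply: diag_sum_sub; [apply: (can_mono cx)|apply: (can_mono cy)].
Qed.

(** The conjugating element [z] is approximated in a higher level, where [hasrk_le] compares ranks;
    retractability of [phi] brings the inequality back to level [n]. *)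
Lemma rk_sub n q v q' v' : rk n q v -> rk n q' v' -> cuntz_sub q q' <-> vle v v'.
Proof.
move=> hq hq'; split=> [/cuntz_subP/(_ (1 / 2) ltac:(lra))[z hz]|vv]; last first.
  by have [z _ ->] := hasrk_sub (bs_lev n) hq hq' vv; apply: cuntz_sub_exact.
have [qq' qs'] := hasrk_proj (bs_lev n) hq'.
(* Replacing [z] by [w] moves z q' z† by at most |z - w| (2|z| + 1) < 1/2; with the 1/2 above, the
   total stays below 1. *)
have K0 : 0 < 4 * (nrm z + 1) by rewrite mulr_gt0// ltr_wpDl// nrm_ge0.
have m0 : 0 < Num.min 1 ((4 * (nrm z + 1))^-1) by rewrite lt_min ltr01 invr_gt0.
have [m [w [wm]]] := lev_dense z m0; rewrite lt_min -[_^-1]mul1r ltr_pdivlMr// => /andP[zw1 zw].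
have nN := leq_maxl n m; have mN := leq_maxr n m.
apply: (retr_vle (phi_retr nN)).
apply: (hasrk_le (bs_lev _) (rk_up nN hq) (rk_up nN hq') (lev_mono mN wm)).
rewrite (le_lt_trans (nrm_distD (z · q' · z^†) _ _))//.
have -> : z · q' · z^† - w · q' · w^† = (z - w) · q' · z^† + w · q' · (z - w)^†.
  by rewrite cstarB !cmulBl cmulBr addrA subrK.
rewrite nrm_distC; have := nrmD ((z - w) · q' · z^†) (w · q' · (z - w)^†).
have h a b : nrm (a · q' · b^†) <= nrm a * nrm b.
  rewrite (le_trans (nrm_cmul _ _))// nrm_cstar ler_wpM2r ?nrm_ge0//.
  by rewrite (le_trans (nrm_cmul _ _))// ler_piMr ?nrm_ge0// nrm_proj_le1.
have := h (z - w) z; have := h w (z - w); have := nrm_le_dist w z; rewrite (nrm_distC w).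
have := nrm_ge0 z; have := nrm_ge0 w; have := nrm_ge0 (z - w); nra.
Qed.

Lemma unit_rk n i y : rk n (e i i (g (P (n := n) y))) (col y 1%:M).
Proof.
have [gP gs] : is_proj (g (P (n := n) y)).
  by apply: (star_hom_proj (g_hom n)); apply: (bs_proj (bsP n)).
have Dp : range (@g n) (g (P (n := n) y)) by exists (P y).
have -> : e i i (g (P (n := n) y)) = e i 0%N (g (P (n := n) y)) · (e i 0%N (g (P (n := n) y)))^†.
  by rewrite (stab_star he) (stab_mul_eq he) gs gP.
apply: (hasrk_mvn (bs_lev n)); first exact: (mxfin_unit he _ _ (Ds n)).
rewrite (stab_star he) (stab_mul_eq he) gs gP.
exact: (hasrk_P y (bs_lev n)).
Qed.

(** * Positive elements with prescribed ranks *)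

Section Realize.
Variables (m : nat -> nat) (v : forall k, 'cV[nat]_(r (m k))).
Hypothesis m_mono : forall k, (m k <= m k.+1)%N.
Hypothesis v_mono : forall k, vle (phi (m k) (m k.+1) *m v k) (v k.+1).

(* The realization of an increasing sequence of ranks puts projections of ranks given by
   the successive increments, scaled down to make the sum converge, on disjoint slots of
   the diagonal. *)
Definition incr k : 'cV[nat]_(r (m k)) :=
  match k with
  | 0%N => v 0
  | k'.+1 => \col_y (v k'.+1 y ord0 - (phi (m k') (m k'.+1) *m v k') y ord0)%N
  end.

Definition slt k (y : 'I_(r (m k))) (t : nat) : nat := pickle (k, nat_of_ord y, t).

Definition dpart k : B :=
  \sum_y \sum_(t < incr k y ord0) e (slt y t) (slt y t) (g (P (n := m k) y)).

Lemma dpart_orth i j : i != j -> dpart i · dpart j = 0.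
Proof.
move=> ij; rewrite cmul_suml big1// => y _; rewrite cmul_suml big1// => t _.
rewrite cmul_sumr big1// => y' _; rewrite cmul_sumr big1// => t' _.
rewrite (stab_mul_neq he)//; apply: contraNneq ij.
by move=> /(pcan_inj pickleK)/(congr1 (fst \o fst))/= ij; apply/eqP.
Qed.

Lemma dpart_rk k : rk (m k) (dpart k) (incr k).
Proof.
have -> : incr k = \sum_y \sum_(t < incr k y ord0) col y 1%:M.
  apply/colP => z; rewrite summxE (bigD1 z)//= [X in _ + X]big1 ?addr0 => [|y yz].
    by rewrite sumr_const card_ord mulmxnE !mxE eqxx natn.
  by rewrite sumr_const card_ord mulmxnE !mxE eq_sym (negbTE yz) mul0rn.
apply: (hasrk_sum (bs_lev _)) => [y _|y y' _ _ yy'].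
  apply: (hasrk_sum (bs_lev _)) => [t _|t t' _ _ tt']; first exact: unit_rk.
  rewrite (stab_mul_neq he)//; apply: contraNneq tt'.
  by move=> /(pcan_inj pickleK)/(congr1 snd)/= /val_inj tt; apply/eqP.
rewrite cmul_suml big1// => t _; rewrite cmul_sumr big1// => t' _.
rewrite (stab_mul_neq he)//; apply: contraNneq yy'.
by move=> /(pcan_inj pickleK)/(congr1 (snd \o fst))/= /val_inj yy; apply/eqP.
Qed.

Lemma dpart_proj k : is_proj (dpart k).
Proof. by have := hasrk_proj (bs_lev (m k)) (dpart_rk k). Qed.

Definition dsum (c : nat -> R) N : B := \sum_(i < N.+1) (c i)%:C *: dpart i.

Lemma dsumS c N : dsum c N.+1 = dsum c N + (c N.+1)%:C *: dpart N.+1.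
Proof. by rewrite /dsum big_ord_recr. Qed.

Lemma dsum_mul c c' N : dsum c N · dsum c' N = dsum (fun i => c i * c' i) N.
Proof.
rewrite /dsum cmul_suml; apply: eq_bigr => i _; rewrite cmul_sumr (bigD1 i)//=.
rewrite big1 ?addr0 => [|j ji]; last by rewrite cmulZl cmulZr dpart_orth ?scaler0// eq_sym.
by rewrite cmulZl cmulZr (dpart_proj i).1 scalerA rmorphM.
Qed.

Lemma dsum_star c N : (dsum c N)^† = dsum c N.
Proof.
by rewrite cstar_sum; apply: eq_bigr => i _; rewrite cstarZ conj_real (dpart_proj i).2.
Qed.

Lemma dsum_mulS c c' N k : dsum c N · dsum c' (N + k) = dsum (fun i => c i * c' i) N.
Proof.
rewrite -dsum_mul {2}/dsum -addSn big_split_ord /= cmulDr -/(dsum c' N) -[RHS]addr0.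
congr (_ + _); rewrite cmul_suml big1// => i _; rewrite cmul_sumr big1// => j _.
rewrite cmulZl cmulZr dpart_orth ?scaler0//= neq_ltn.
by rewrite (leq_trans (ltn_ord i))// leq_addr.
Qed.

Lemma dsum_eq c c' N : c =1 c' -> dsum c N = dsum c' N.
Proof. by move=> cc; apply: eq_bigr => i _; rewrite cc. Qed.

Let q := dsum (fun=> 1).

Lemma dsum_rk N : rk (m N) (q N) (v N).
Proof.
elim: N => [|N IH].
  by rewrite /q /dsum big_ord1 scale1r; apply: (dpart_rk 0).
have -> : q N.+1 = q N + dpart N.+1 by rewrite /q dsumS scale1r.
have -> : v N.+1 = phi (m N) (m N.+1) *m v N + incr N.+1.
  apply/colP => y; rewrite [RHS]mxE [incr _ _ _]mxE addrC -[LHS](@subnK ((phi (m N) (m N.+1) *m v N) y ord0))//.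
  exact: v_mono.
apply: (hasrkD (bs_lev _)); [exact: rk_up|exact: dpart_rk|].
rewrite cmul_suml big1// => i _; rewrite cmulZl dpart_orth ?scaler0//=.
by rewrite neq_ltn ltn_ord.
Qed.

Lemma realize : exists x xs qs, [/\ positive x, canonical lev x xs qs &
  forall k, rk (m k) (qs k) (v k)].
Proof.
(* Any summable positive weights would do; the inverse weights 2^i recover each partial projection
   [q k] from [b]. *)
pose c i : R := (1 / 2) ^+ i.
have c0 i : 0 <= c i by rewrite exprn_ge0//; lra.
have [b bl] : exists b, tends (dsum c) b.
  apply: (geom_tends (K := 1) (q := 1 / 2)); [lra|lra|move=> N].
  rewrite dsumS addrC addKr nrmZ nrm_real ger0_norm ?c0// /c exprS.
  have := nrm_proj_le1 (dpart_proj N.+1); have := nrm_ge0 (dpart N.+1).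
  have := exprn_gt0 N (x := 1 / 2 : R) ltac:(lra).
  by set t := _ ^+ N; nra.
have bs : b^† = b.
  apply: tends_unique (tends_cstar bl) _; apply: (tends_eventually (N := 0) bl) => N _.
  exact: dsum_star.
have cut c' N : dsum c' N · b = dsum (fun i => c' i * c i) N.
  apply: tends_unique (tends_cmul (tends_cst (dsum c' N)) bl) _.
  apply: (tends_eventually (N := N) (tends_cst _)) => M NM.
  by rewrite -(subnKC NM) dsum_mulS.
exists (b^† · b), (fun N => dsum c N · dsum c N), q; split; last exact: dsum_rk.
  by exists b.
split=> [|k|k|k|k|k].
- by rewrite bs; apply: tends_cmul.
- by rewrite cstarM !dsum_star.
- exists (m k); last exact: (hasrk_proj (bs_lev _) (dsum_rk k)).
  exact: (hasrk_in (bs_lev _) (dsum_rk k)).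
- pose z := dsum (fun i => 2 ^+ i) k.
  have zb : z · b = q k.
    rewrite cut; apply: dsum_eq => i; rewrite /c -exprMn (_ : 2 * (1 / 2) = 1) ?expr1n//; lra.
  have -> : q k = z · (b^† · b) · z^†.
    by rewrite bs cmulA zb -cmulA -{1}bs -cstarM zb dsum_star dsum_mul; apply: dsum_eq => i; rewrite mulr1.
  exact: cuntz_sub_exact.
- have -> : dsum c k · dsum c k = dsum c k · q k · (dsum c k)^†.
    by rewrite dsum_star !dsum_mul; apply: dsum_eq => i; rewrite mulr1.
  exact: cuntz_sub_exact.
- have -> : q k = q k · q k.+1 · (q k)^†.
    rewrite dsum_star -{1}(addn1 k) dsum_mulS dsum_mul.
    by apply: dsum_eq => i; rewrite !mulr1.
  exact: cuntz_sub_exact.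
Qed.

End Realize.

Hypothesis A_emb : forall D : cstarType R, finite_dimensional D ->
  exists (i : nat) (d : D -> An i), left_invertible d.
Hypothesis A_ext : forall (i : nat) (eps : C) (D : cstarType R) (c : An i -> D),
  0 < eps -> finite_dimensional D -> left_invertible c ->
  exists (j : nat) (d : D -> An j),
    [/\ (i <= j)%N, left_invertible d & norm_dist_lt (d \o c) (@f i j) eps].

Lemma nonzero_proj : exists p : A, is_proj p /\ p <> 0.
Proof.
have [i [d [hd [pi hpi pd]]]] := A_emb (ccstar_fd R).
pose one : ccstar R := (1 : C).
have one_proj : is_proj one by split; rewrite /one; [apply: mul1r|apply: conjC1].
exists (g (d one)); split.
  by apply: (star_hom_proj (g_hom i)); apply: (star_hom_proj hd).
rewrite -(star_hom0 (g_hom i)) => /g_inj d0.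
have /(congr1 (@^~ one)) /= := pd; rewrite d0 (star_hom0 hpi) => /esym/eqP.
by apply/negP; apply: oner_neq0.
Qed.

Lemma norm_dist_nrm (D D' : cstarType R) (h h' : D -> D') a : norm_dist_lt h h' 1 ->
  nrm a <= 1 -> nrm (h a - h' a) < 1.
Proof.
(* In the order of [R[i]] the inequality [k < 1] makes [k] real. *)
move=> [k k1 hk] a1; have kr : k \is Num.real.
  apply/complex_realP; exists (complex.Re k); move: k1; rewrite ltcE => /andP[/eqP/esym + _].
  by case: k {hk} => x y /= ->.
have [x kE] : exists x : R, k = x%:C by apply/complex_realP.
have x1 : x < 1 by rewrite -ltcR -kE.
have := hk a; rewrite kE !nrmE -rmorphM/= lecR.
by have := nrm_ge0 a; case: (lerP x 0); nra.
Qed.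

Lemma AF_extension n s (M : 'M[nat]_(s, r n)) : retr M ->
  exists m (L : 'M[nat]_(r m, s)), [/\ (n <= m)%N, retr L & L *m M = phi n m].
Proof.
move=> rM; have [p0 [pp p0n]] := nonzero_proj.
have [u [_ uu hu]] := fd_unit (full_subalg (An n)) (fdset_full (An_fd n)).
have [J [cl [sx fs]]] := bs_frame (bsP n) (q := u) I uu.
have {}hu x : u · x = x /\ x · u = x by exact: hu.
have [m [dl [nm dli hd]]] := A_ext (i := n) ltr01 (ext_finite_dimensional M pp _)
  (gam_left_invertible M pp fs hu).
have [L rL LM] := extension_rank p0n hu nm dli (fun a => norm_dist_nrm hd (a := a)) rM.
by exists m, L.
Qed.

End AF.

(** * The isomorphism *)

Section CuntzComparison.
Variables (R : realType) (An : nat -> cstarType R) (f : forall i j, An i -> An j).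
Variables (A : cstarType R) (g : forall i, An i -> A).
Hypothesis An_fd : forall i, finite_dimensional (An i).
Hypothesis f_li : forall i j, (i <= j)%N -> left_invertible (@f i j).
Hypothesis f_id : forall i, @f i i = id.
Hypothesis f_comp : forall i j k, (i <= j)%N -> (j <= k)%N -> @f j k \o @f i j = @f i k.
Hypothesis g_lim : is_star_limit f g.
Variables (B : cstarType R) (e : nat -> nat -> A -> B).
Hypothesis he : is_stabilization e.
Variables (r : nat -> nat) (P : forall n, 'I_(r n) -> An n).
Hypothesis bsP : forall n, bsys [set: An n] (@P n).
Local Notation lev := (lev g e).
Local Notation rk n := (hasrk (lev n) (levP g e P (n := n))).
Local Notation phi := (phi An_fd f_li f_id f_comp g_lim he bsP).
Variables (S : cuType) (tau : forall n, 'cV[nat]_(r n) -> S).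
Hypothesis dT : dimlim phi tau.

Definition proj_val (q : B) (y : S) : Prop := exists n v, rk n q v /\ y = tau v.

Let bs n : bsys (lev n) (levP g e P (n := n)) := bs_lev An_fd f_li f_id f_comp g_lim he bsP n.

Lemma proj_val_exists q : lproj lev q -> exists y, proj_val q y.
Proof.
move=> [n nq pq]; have [v hv] := hasrk_exists (bs n) nq pq.
by exists (tau v), n, v.
Qed.

Lemma proj_val_common q y q' y' : proj_val q y -> proj_val q' y' ->
  exists n v v', [/\ rk n q v, rk n q' v', y = tau v & y' = tau v'].
Proof.
move=> [n [v [qv ->]]] [m [w [qw ->]]].
exists (maxn n m), (phi _ _ *m v), (phi _ _ *m w).
by rewrite !(dl_map dT) ?leq_maxl ?leq_maxr//; split=> //; apply: rk_up; rewrite ?leq_maxl ?leq_maxr.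
Qed.

Lemma proj_val_le q y q' y' : proj_val q y -> proj_val q' y' -> cuntz_sub q q' <-> y <= y'.
Proof.
move=> qy qy'; have [n [v [v' [rv rv' -> ->]]]] := proj_val_common qy qy'.
by rewrite (dl_le dT); exact: (rk_sub An_fd f_li f_id f_comp g_lim he bsP rv rv').
Qed.

Lemma proj_val_add q y q' y' : proj_val q y -> proj_val q' y' ->
  proj_val (diag_sum e q q') (cu_add y y').
Proof.
move=> qy qy'; have [n [v [v' [rv rv' -> ->]]]] := proj_val_common qy qy'.
by exists n, (v + v'); rewrite (dl_add dT); split=> //; exact: (diag_sum_rk An_fd f_li f_id f_comp g_lim he bsP rv rv').
Qed.

Lemma proj_val_compact q y : proj_val q y -> y ≪ y.
Proof. by move=> [n [v [_ ->]]]; apply: (dl_compact dT). Qed.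

(** A relation, because canonical sequences are not unique; [pos_val_le] shows that the value does
    not depend on them. *)
Definition pos_val (x : B) (s : S) : Prop := exists xs qs ys,
  [/\ canonical lev x xs qs, forall k, proj_val (qs k) (ys k) & supremums (range ys) s].

Lemma canonical_val_mono x xs qs ys : canonical lev x xs qs ->
  (forall k, proj_val (qs k) (ys k)) -> nondecreasing_seq ys.
Proof.
move=> cx qy; apply/nondecreasing_seqP => n.
exact: (proj_val_le (qy n) (qy n.+1)).1 (can_mono cx n).
Qed.

Lemma pos_val_exists x : positive x -> exists s, pos_val x s.
Proof.
move=> px.
have [xs [qs cx]] := canonical_exists (lev_dense g_lim he) (lev_local An_fd g_lim he) px.
have /choice[ys hy] k := proj_val_exists (can_proj cx k).
have [s hs] := cu_O1 ys (canonical_val_mono cx hy).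
by exists s, xs, qs, ys.
Qed.

(** Compactness is used on each side: of projections for Cuntz comparison in one direction, of their
    values in [S] in the other. *)
Lemma pos_val_le x s y t : pos_val x s -> pos_val y t -> cuntz_sub x y <-> s <= t.
Proof.
move=> [xs [qs [us [cx hu us_s]]]] [ys [ps [vs [cy hv vs_t]]]]; split=> [xy|st].
  apply: (sup_le us_s) => k; have [_ _ pq] := can_proj cx k.
  have [N /(_ _ (leqnn N)) hN] := canonical_cofinal cy pq (cuntz_sub_trans (can_le cx k) xy).
  exact: le_trans ((proj_val_le (hu k) (hv N)).1 hN) (sup_ge N vs_t).
apply: (canonical_sub cx) => k.
have [N hN] := proj_val_compact (hu k) (canonical_val_mono cy hv) vs_t
  (le_trans (sup_ge k us_s) st).
exact: cuntz_sub_trans ((proj_val_le (hu k) (hv N)).2 hN) (can_le cy N).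
Qed.

Lemma pos_val_add x s y t : pos_val x s -> pos_val y t ->
  pos_val (diag_sum e x y) (cu_add s t).
Proof.
move=> [xs [qs [us [cx hu us_s]]]] [ys [ps [vs [cy hv vs_t]]]].
exists (fun k => diag_sum e (xs k) (ys k)), (fun k => diag_sum e (qs k) (ps k)),
  (fun k => cu_add (us k) (vs k)); split.
- exact: (canonical_diag_sum An_fd f_li f_id f_comp g_lim he bsP).
- by move=> k; apply: proj_val_add.
- by apply: cu_O4 => //; [apply: canonical_val_mono cx hu|apply: canonical_val_mono cy hv].
Qed.

Lemma pos_val_surj s : exists x, positive x /\ pos_val x s.
Proof.
have [z [zn zK zs]] := dl_dense dT s.
have /choice[i hi] := zK; pose w n := projT1 (cid (hi n)).
have zE n : z n = tau (w n) := projT2 (cid (hi n)).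
(* The compact elements approaching [s] come from unordered stages; running maxima make the stages
   increase, as [realize] requires. *)
pose m k := (\max_(l < k.+1) i l)%N.
have im k : (i k <= m k)%N by apply: (leq_bigmax (F := fun l : 'I_k.+1 => i l) ord_max).
have m_mono k : (m k <= m k.+1)%N by rewrite {2}/m big_ord_recr leq_maxl.
pose v k := phi (i k) (m k) *m w k.
have zv k : z k = tau (v k) by rewrite (dl_map dT)// zE.
have v_mono k : vle (phi (m k) (m k.+1) *m v k) (v k.+1).
  by apply/(dl_le dT); rewrite (dl_map dT)// -!zv; apply: zn.
have [x [xs [qs [px cx rx]]]] := realize m_mono v_mono.
exists x; split=> //; exists xs, qs, z; split=> // k.
by exists (m k), (v k).
Qed.

Lemma dimlim_cuntz_semigroup : is_cuntz_semigroup e S.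
Proof.
pose F (x : B) : S := xget cu_zero [set s | pos_val x s].
have FP x : positive x -> pos_val x (F x).
  by move=> /pos_val_exists[s hs]; apply: xgetPex; exists s.
have Fle x y : positive x -> positive y -> cuntz_sub x y <-> F x <= F y.
  by move=> px py; apply: pos_val_le; apply: FP.
have Feq x y : positive x -> positive y -> cuntz_eq x y <-> F x = F y.
  move=> px py; rewrite /cuntz_eq !Fle//; split=> [[xy yx]|->//].
  by apply/eqP; rewrite eq_le xy yx.
have Fval x s : positive x -> pos_val x s -> F x = s.
  move=> px xs; have := (pos_val_le (FP x px) xs).1; have := (pos_val_le xs (FP x px)).1.
  move=> h1 h2; have xx : cuntz_sub x x by apply/Fle.
  by apply/eqP; rewrite eq_le h1 ?h2.
have pos0 : positive (0 : B) by exists 0; rewrite cmulr0.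
(* A class is evaluated at a chosen representative; [hE] shows that the choice does not matter. *)
pose h (X : set B) : S := F (xget 0 X).
have hE (X : set B) a s : X a -> (forall b, X b -> F b = s) -> h X = s.
  by move=> Xa; apply; apply: xgetPex; exists a.
have hclass a : positive a -> h (cuntz_class a) = F a.
  move=> pa; apply: (hE _ a) => [|b [pb ab]]; first by split=> //; apply/Feq.
  by apply/esym/Feq.
exists h; split.
- split=> //.
  + move=> X Y /set_mem[a pa <-] /set_mem[b pb <-]; rewrite !hclass// => ab.
    by apply/seteqP; split=> c [pc] /Feq hc; split=> //; apply/Feq => //;
      rewrite -hc// ab.
  + move=> s _; have [x [px xs]] := pos_val_surj s; exists (cuntz_class x); first by exists x.
    by rewrite hclass//; apply: Fval.
(* Some positive [x] has value zero and the element 0 is Cuntz-below it, so the value of 0 is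
   zero. *)
- rewrite hclass//; have [x [px xs]] := pos_val_surj cu_zero.
  apply/eqP; rewrite eq_le cu_ge0 andbT -(Fval _ _ px xs); apply/Fle => //.
  apply/cuntz_subP => d d0; exists 0.
  by rewrite cmul0r cmul0r subrr nrm0.
- move=> _ _ [a pa <-] [b pb <-]; rewrite !hclass//.
  have dp := diag_sum_positive An_fd g_lim he.
  have FD x y : positive x -> positive y -> F (diag_sum e x y) = cu_add (F x) (F y).
    by move=> px py; apply: Fval; [apply: dp|apply: pos_val_add; apply: FP].
  apply: (hE _ (diag_sum e a b)).
    by split; [apply: dp|exists a, b; split; [split=> //; apply/Feq|split=> //; apply/Feq|
      apply/Feq => //; apply: dp]].
  move=> c [pc [a' [b' [[pa' aa] [pb' bb] cab]]]].
  have -> : F c = F (diag_sum e a' b') by apply/(Feq _ _ pc (dp _ _ pa' pb')).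
  by rewrite FD// ((Feq _ _ pa pa').1 aa) ((Feq _ _ pb pb').1 bb).
- move=> _ _ [a pa <-] [b pb <-]; rewrite !hclass// -Fle//; split=> [|ab].
    move=> [a' [b' [[pa' aa] [pb' bb] ab]]].
    exact: cuntz_sub_trans aa.1 (cuntz_sub_trans ab bb.2).
  by exists a, b; split=> //; split=> //; apply/Feq.
Qed.

End CuntzComparison.

Theorem theorem4p9 :
  fraisse_category sdim /\
  forall (R : realType) (S : cuType) (A B : cstarType R)
         (e : nat -> nat -> A -> B),
    is_fraisse_limit sdim S -> universal_AF A -> is_stabilization e ->
    is_cuntz_semigroup e S.
Proof.
split=> [|R S A B e [Sn [fS [gS [fS_fr gS_lim]]]]]; first exact: sdim_fraisse.
move=> [An [f [g [[An_fd f_li f_id f_comp] g_lim A_emb A_ext]]]] he.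
have hP n := fd_bsys (full_subalg (An n)) (fdset_full (An_fd n)).
pose r n := projT1 (cid (hP n)); have hr n := projT2 (cid (hP n)).
pose P n := projT1 (cid (hr n)).
have bsP n : bsys [set: An n] (P n) := projT2 (cid (hr n)).
have [r' [F' [sig [dF' dS]]]] := sdim_limit_dimlim fS_fr gS_lim.
have dF : dimsys (phi An_fd f_li f_id f_comp g_lim he bsP).
  split.
  - exact: phi_id.
  - exact: phi_comp.
  - by move=> i j ij; apply: phi_retr.
  - by move=> i s M rM; apply: (AF_extension An_fd f_li f_id f_comp g_lim he bsP A_emb A_ext rM).
have [tau dT] := dimlim_transfer dF dF' dS.
exact: dimlim_cuntz_semigroup dT.
Qed.
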